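(* (1) Let $f$ be computed by $p$, $M$, ${\prec}$ in the free model (i.e., they witness $f \in \mathrm{CLU\#P}_{\rm free}$). If $\mathit{greatest}_{p,M,\prec} \in \mathrm{UPSV_p}$ and $\mathit{least}_{p,M,\prec} \in \mathrm{UPSV_p}$, then $f \in \mathrm{CLU\#P}$. (2) Let $f$ be computed by $p$, $M$, ${\prec}$ in the circular model (i.e., they witness $f \in \mathrm{CLU\#P}_{\rm circular}$). If $\mathit{greatest}_{p,M,\prec} \in \mathrm{UPSV_p}$ and $\mathit{least}_{p,M,\prec} \in \mathrm{UPSV_p}$, then $f \in \mathrm{CLU\#P}$.
   Context: Alphabet $\Sigma=\{0,1\}$. $a \prec_{\rm lex} b$ means $b$ is the lexicographic successor of $a$. An NPTM $M$ is $p$-balanced if on each input $x$ its computation paths are named exactly by the strings in $\{0,1\}^{p(|x|)}$; $\mathrm{acc}_M(x)$ is the set of accepting paths and $\#\mathrm{acc}_M(x)=\|\mathrm{acc}_M(x)\|$. $\mathrm{FP_t}$ denotes the total polynomial-time computable functions. A total $f:\Sigma^*\to\mathbb{N}$ is in $\mathrm{CLU\#P}$ if there are a polynomial $p$, a $p$-balanced NPTM $M$, functions $b,t \in \mathrm{FP_t}$, and a polynomial-time 3-argument predicate $\prec$ such that for every $x$ there is a bijection $h_x$ of $\Sigma^{p(|x|)}$ with: $|b(x)|=|t(x)|=p(|x|)$; $h_x(b(x))=0^{p(|x|)}$ and $h_x(t(x))=1^{p(|x|)}$; for all $y,z\in\{0,1\}^{p(|x|)}$, $\prec(x,y,z)\iff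 h_x(y)\prec_{\rm lex} h_x(z)$; if $f(x)\neq 0$ then there are $\ell,u$ with $\mathrm{acc}_M(x)=\{w : h_x(\ell)\le_{\rm lex} h_x(w)\le_{\rm lex} h_x(u)\}$ (accepting paths form a contiguous cluster); and $f(x)=\#\mathrm{acc}_M(x)$. The free model ($\mathrm{CLU\#P}_{\rm free}$) is the same but with no functions $b,t$ (no requirement on top/bottom elements). The circular model ($\mathrm{CLU\#P}_{\rm circular}$) is the same as the free model except the adjacency condition is $\prec(x,y,z)\iff (h_x(y)\prec_{\rm lex} h_x(z) \lor (h_x(y)=1^{p(|x|)} \land h_x(z)=0^{p(|x|)}))$. For $p,M,\prec$ in either model, with $f(x)=\#\mathrm{acc}_M(x)$: if $f(x)=0$, $\mathit{greatest}_{p,M,\prec}(x)$ and $\mathit{least}_{p,M,\prec}(x)$ are undefined. In the free model, if $f(x)\neq 0$, $\mathit{greatest}_{p,M,\prec}(x)$ is the unique accepting path $z$ of length $p(|x|)$ such that no length-$p(|x|)$ accepting path $w$ satisfies $\prec(x,z,w)$, and $\mathit{least}_{p,M,\prec}(x)$ is the unique accepting path $z$ of length $p(|x|)$ such that no length-$p(|x|)$ accepting path $w$ satisfies $\prec(x,w,z)$. In the circular model, if $0<f(x)<2^{p(|x|)}$ they are defined as in the free model; if $f(x)=2^{p(|x|)}$ then $\mathit{greatest}_{p,M,\prec}(x)=1^{p(|x|)}$, and $\mathit{least}_{p,M,\prec}(x)=\epsilon$ if $p(|x|)=0$, otherwise the unique length-$p(|x|)$ string $z$ with $\prec(x,1^{p(|x|)},z)$.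 $\mathrm{UPSV_p}$ is the class of (possibly partial) functions $g$ computed by an NPTM that on each input has at most one accepting path, outputs $g(x)$ on that path when it exists, and has no accepting path exactly when $g(x)$ is undefined. *)

(* Defs.v *)
From HB Require Import structures.
From mathcomp Require Import all_boot all_order all_algebra all_fingroup.
From mathcomp Require Import boolp.

Set Implicit Arguments.
Unset Strict Implicit.
Unset Printing Implicit Defensive.

Notation str := (seq bool).

(* Negative or fractional coefficients are allowed, as in n(n-1)/2, as long as
   the values on nat are natural numbers. *)
Definition is_polynomial (p : nat -> nat) : Prop :=
  exists P : {poly rat}, forall n : nat, ((p n)%:R = P.[n%:R])%R.

(** * Nondeterministic multitape Turing machines *)

(* Two-way infinite tape: cells to the left of the head (nearest first) and
   cells from the head on; cells that are not listed hold [None], the blank. *)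
Definition tape (A : Type) : Type := (seq (option A) * seq (option A))%type.

Variant move := Left | Stay | Right.

Definition read_tape A (t : tape A) : option A := head None t.2.

Definition write_move A (t : tape A) (a : option A * move) : tape A :=
  let: (l, r) := t in
  let r' := a.1 :: behead r in
  match a.2 with
  | Left => (behead l, head None l :: r')
  | Stay => (l, r')
  | Right => (a.1 :: l, behead r')
  end.

(* What a machine may do in a given situation: halt, and then accept ([true]) or
   reject ([false]); make a deterministic step; or make a nondeterministic
   binary choice, the two successors being named 0 and 1. *)
Variant instr (A : Type) :=
  | Halt of bool
  | Step of A
  | Guess of A & A.
Arguments Halt {A}.

(* A machine with [m] input strings has one tape per input, plus the tapes
   [work], among which [out] is the output tape.  A tape symbol is the blank
   [None], a bit [Some (inl b)], or an auxiliary symbol [Some (inr a)]. *)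
Record ntm (m : nat) := NTM {
  state : finType;
  aux : finType;
  work : finType;
  out : work;
  start : state;
  delta : state -> {ffun 'I_m + work -> option (bool + aux)} ->
    instr (state * {ffun 'I_m + work -> option (bool + aux) * move})
}.

Section Runs.
Variables (m : nat) (M : ntm m).

Definition config : Type :=
  (state M * ('I_m + work M -> tape (bool + aux M)))%type.

(* Input heads start on the first symbol of their input. *)
Definition init (v : m.-tuple str) : config :=
  (start M, fun t => match t with
                     | inl i => ([::], [seq Some (inl b) | b <- tnth v i])
                     | inr _ => ([::], [::])
                     end).

Definition instr_at (c : config) :=
  delta c.1 [ffun t => read_tape (c.2 t)].

Definition apply (c : config)
    (a : state M * {ffun 'I_m + work M -> option (bool + aux M) * move}) : config :=
  (a.1, fun t => write_move (c.2 t) (a.2 t)).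

(* [computation c w r c']: from [c], making the successive choices [w], the
   machine halts in [c'] with verdict [r], having used up exactly [w].  Thus
   [w] is the name of this computation path. *)
Inductive computation : config -> str -> bool -> config -> Prop :=
  | comp_halt c r : instr_at c = Halt r -> computation c [::] r c
  | comp_step c a w r c' : instr_at c = Step a ->
      computation (apply c a) w r c' -> computation c w r c'
  | comp_guess c a0 a1 g w r c' : instr_at c = Guess a0 a1 ->
      computation (apply c (if g then a1 else a0)) w r c' ->
      computation c (g :: w) r c'.

Fixpoint halts_within (n : nat) (c : config) : bool :=
  match instr_at c, n with
  | Halt _, _ => true
  | Step a, n'.+1 => halts_within n' (apply c a)
  | Guess a0 a1, n'.+1 =>
      halts_within n' (apply c a0) && halts_within n' (apply c a1)
  | _, 0 => false
  end.

Definition polytime : Prop :=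
  exists2 q, is_polynomial q &
    forall v : m.-tuple str, halts_within (q (\sum_(x <- v) size x)) (init v).

Definition deterministic : Prop :=
  forall (s : state M) a, if delta s a is Guess _ _ then False else True.

(* The output is the block of bits that starts under the head of [out]. *)
Fixpoint leading_bits (s : seq (option (bool + aux M))) : str :=
  if s is Some (inl b) :: s' then b :: leading_bits s' else [::].

Definition output (c : config) : str := leading_bits (c.2 (inr (out M))).2.

Definition path_name (v : m.-tuple str) (w : str) : Prop :=
  exists r c', computation (init v) w r c'.

Definition accepts (v : m.-tuple str) (w : str) : Prop :=
  exists c', computation (init v) w true c'.

End Runs.

(** * Function classes *)

Definition FPt (g : str -> str) : Prop :=
  exists M : ntm 1, [/\ deterministic M, polytime M &
    forall x, exists w r c',
      computation (init M [tuple x]) w r c' /\ output c' = g x].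

Definition polytime_pred3 (R : str -> str -> str -> bool) : Prop :=
  exists M : ntm 3, [/\ deterministic M, polytime M &
    forall x y z, R x y z <-> exists w, accepts M [tuple x; y; z] w].

(* Partial functions are option-valued. *)
Definition UPSVp (g : str -> option str) : Prop :=
  exists M : ntm 1, [/\ polytime M,
    forall x w w', accepts M [tuple x] w -> accepts M [tuple x] w' -> w = w' &
    forall x y, g x = Some y <->
      exists w c', computation (init M [tuple x]) w true c' /\ output c' = y].

Definition balanced (p : nat -> nat) (M : ntm 1) : Prop :=
  polytime M /\
  forall x w, path_name M [tuple x] w <-> size w = p (size x).

(* The accepting paths of length [p |x|]; all of them if [M] is [p]-balanced. *)
Definition acc (p : nat -> nat) (M : ntm 1) (x : str)
    : {set (p (size x)).-tuple bool} :=
  [set w : (p (size x)).-tuple bool | `[< accepts M [tuple x] w >]].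

(** * Cluster computation *)

Section Lex.
Variable n : nat.
Implicit Types a b : n.-tuple bool.

Definition lexle a b : bool := (a <= b :> n.-tuplelexi bool)%O.
Definition lexlt a b : bool := (a < b :> n.-tuplelexi bool)%O.

Definition lexsucc a b : bool :=
  lexlt a b && [forall c, ~~ (lexlt a c && lexlt c b)].

Definition zeros : n.-tuple bool := nseq_tuple n false.
Definition ones : n.-tuple bool := nseq_tuple n true.

Definition circsucc a b : bool :=
  lexsucc a b || (a == ones) && (b == zeros).

Definition contiguous (h : {perm n.-tuple bool}) (A : {set n.-tuple bool}) : Prop :=
  exists l u, A = [set w | lexle (h l) (h w) && lexle (h w) (h u)].

End Lex.
Arguments zeros {n}.
Arguments ones {n}.

Definition CLUP (f : str -> nat) : Prop :=
  exists (p : nat -> nat) (M : ntm 1) (b t : str -> str)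
         (prec : str -> str -> str -> bool),
  [/\ is_polynomial p, balanced p M, FPt b /\ FPt t, polytime_pred3 prec &
  forall x, exists h : {perm (p (size x)).-tuple bool},
    [/\ size (b x) = p (size x) /\ size (t x) = p (size x),
        (exists2 y, tval y = b x & h y = zeros) /\
        (exists2 y, tval y = t x & h y = ones),
        forall y z : (p (size x)).-tuple bool,
          prec x y z <-> lexsucc (h y) (h z),
        f x <> 0 -> contiguous h (acc p M x) &
        f x = #|acc p M x|]].

(* [p], [M] and [prec] witness that [f] is in CLU#P_free. *)
Definition computed_free (f : str -> nat) (p : nat -> nat) (M : ntm 1)
    (prec : str -> str -> str -> bool) : Prop :=
  [/\ is_polynomial p, balanced p M, polytime_pred3 prec &
  forall x, exists h : {perm (p (size x)).-tuple bool},
    [/\ forall y z : (p (size x)).-tuple bool,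
          prec x y z <-> lexsucc (h y) (h z),
        f x <> 0 -> contiguous h (acc p M x) &
        f x = #|acc p M x|]].

(* [p], [M] and [prec] witness that [f] is in CLU#P_circular. *)
Definition computed_circular (f : str -> nat) (p : nat -> nat) (M : ntm 1)
    (prec : str -> str -> str -> bool) : Prop :=
  [/\ is_polynomial p, balanced p M, polytime_pred3 prec &
  forall x, exists h : {perm (p (size x)).-tuple bool},
    [/\ forall y z : (p (size x)).-tuple bool,
          prec x y z <-> circsucc (h y) (h z),
        f x <> 0 -> contiguous h (acc p M x) &
        f x = #|acc p M x|]].

(* The unique [z] that satisfies [P], if there is one. *)
Definition the (T : finType) (P : pred T) : option T :=
  [pick z | P z && [forall w, P w ==> (w == z)]].

Section Extremes.
Variables (p : nat -> nat) (M : ntm 1) (prec : str -> str -> str -> bool).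

(* Undefined ([None]) when there is no accepting path. *)
Definition greatest_free (x : str) : option str :=
  omap val (the [pred z in acc p M x | [forall w in acc p M x, ~~ prec x z w]]).

Definition least_free (x : str) : option str :=
  omap val (the [pred z in acc p M x | [forall w in acc p M x, ~~ prec x w z]]).

Definition greatest_circular (x : str) : option str :=
  if #|acc p M x| == 2 ^ p (size x) then Some (nseq (p (size x)) true)
  else greatest_free x.

Definition least_circular (x : str) : option str :=
  if #|acc p M x| == 2 ^ p (size x) then
    if p (size x) == 0 then Some [::]
    else omap val (the (fun z : (p (size x)).-tuple bool =>
                          prec x (nseq (p (size x)) true) z))
  else least_free x.

End Extremes.

(* Main.v *)
Require Import Defs.
From mathcomp Require Import all_boot all_order all_algebra all_fingroup.
From mathcomp Require Import boolp zify.

(** Let [f] be computed by [M] and [prec], and let [w1], [w2] be the accepting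
    paths of the UPSV machines for the least and the greatest element [l], [u] of
    the cluster on [x].  The new machine guesses a string [c1 c2 y z], where [y] is
    a path of [M] and [z] should be [w1 w2 0...0], and it accepts if [c1 c2 = 01],
    [y] is accepted by [M], and [z] is correct.  As [z] is unique, the number of
    accepting paths does not change.  The strings are ordered by a binary counter
    [y z] and then by [c1 c2], except that the cluster is taken out and inserted,
    ordered by [prec], between [10 l z] and [11 l z], for the correct [z].  This
    starts at [0...0] and ends at [1...1].  Adjacency is easy to decide: whether a
    string is in the cluster is; removing the cluster only skips single strings;
    and both ends [l], [u] of the cluster can be computed from a correct [z], so
    that neither a wrap-around of [prec] nor its unknown extreme elements matter.

    The machines come from programs in a small structured language that compiles
    to Turing machines; the functions so computed are closed under composition
    because every intermediate result gets a fresh tape. *)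

Set Implicit Arguments.
Unset Strict Implicit.
Unset Printing Implicit Defensive.

(** * Tapes as pairs of streams *)

Section Streams.
Variable A : Type.

(** Adjacency has to be decided deterministically, while [l] and [u] are only available through
    unambiguous nondeterminism; hence the strings being compared must themselves carry [w1 w2].
    Balance demands one length for all paths, but the lengths of [w1] and [w2] are merely bounded,
    so zeros fill up the rest, and requiring zeros keeps [z] unique. The two control bits make room:
    [00s], [10s] and [11s] never accept, so a removed [01s] leaves the neighbours [00s] and [10s],
    and the gap is recognized by testing [s] alone; likewise the inserted cluster lies between two
    strings that are not part of it. For the same reason [0...0] and [1...1] are never moved, which
    supplies the functions for the bottom and the top element. The new order is handled through a
    numerical key: the edge relation is shown to be the successor relation of the key, and an
    injective key yields the permutation that the definition asks for. *)

Definition stream := nat -> option A.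
Definition stape := (stream * stream)%type.

Definition scons (a : option A) (s : stream) : stream :=
  fun i => if i is j.+1 then s j else a.
Definition stail (s : stream) : stream := fun i => s i.+1.

Definition swrite (t : stape) (a : option A * move) : stape :=
  match a.2 with
  | Left => (stail t.1, scons (t.1 0) (scons a.1 (stail t.2)))
  | Stay => (t.1, scons a.1 (stail t.2))
  | Right => (scons a.1 t.1, stail t.2)
  end.

(* Forgets the trailing blanks, so that tapes with the same cells become equal. *)
Definition den (t : tape A) : stape := (nth None t.1, nth None t.2).

Definition blank : stape := (fun=> None, fun=> None).

Lemma scons_nth a s : scons a (nth None s) = nth None (a :: s).
Proof. by apply: funext; case. Qed.

Lemma stail_nth s : stail (nth None s) = nth None (behead s).
Proof. by apply: funext => i; rewrite /stail nth_behead. Qed.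

Lemma scons_stail s : scons (s 0) (stail s) = s.
Proof. by apply: funext; case. Qed.

Lemma stail_scons a s : stail (scons a s) = s.
Proof. exact: funext. Qed.

Lemma den_write t a : den (write_move t a) = swrite (den t) a.
Proof.
case: t a => l r [a m]; rewrite /den /swrite /=.
by case: m; rewrite /= ?stail_nth ?nth0 ?scons_nth.
Qed.

Lemma den_read t : read_tape t = (den t).2 0.
Proof. by rewrite /read_tape /= nth0. Qed.

Lemma swrite_stay t : swrite t (t.2 0, Stay) = t.
Proof. by case: t => l r; rewrite /swrite /= scons_stail. Qed.

End Streams.
Arguments blank {A}.

(** * A structured programming language for Turing machines *)

Section Commands.
Variable X : finType.

Notation cell := (option (bool + X)).
Notation action := (nat -> cell * move).
Definition tapes := nat -> stape (bool + X).

(* Tapes are named by numbers; [js] lists the tapes that are read or moved. *)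
Inductive cmd :=
  | Act (js : seq nat) (f : (nat -> cell) -> action)
  | Flip (j : nat)
  | Seq (c1 c2 : cmd)
  | While (js : seq nat) (b : (nat -> cell) -> bool) (c : cmd).

Definition heads (ts : tapes) : nat -> cell := fun i => (ts i).2 0.

Definition mask (js : seq nat) (ra : nat -> cell) : nat -> cell :=
  fun i => if i \in js then ra i else None.

Definition moves (ts : tapes) (a : action) : tapes := fun i => swrite (ts i) (a i).

Definition act_on (js : seq nat) (f : (nat -> cell) -> action) (ra : nat -> cell)
  : action := fun i => if i \in js then f (mask js ra) i else (ra i, Stay).

Definition act js f ts := moves ts (act_on js f (heads ts)).

Definition flip j (b : bool) ts :=
  act [:: j] (fun _ _ => (Some (inl b), Right)) ts.

(* [run c ts w ts' n]: started on the tapes [ts], with the guesses [w], the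
   command [c] ends with the tapes [ts'] after at most [n] steps. *)
Inductive run : cmd -> tapes -> str -> tapes -> nat -> Prop :=
  | run_act js f ts n : 0 < n -> run (Act js f) ts [::] (act js f ts) n
  | run_flip j b ts n : 0 < n -> run (Flip j) ts [:: b] (flip j b ts) n
  | run_seq c1 c2 ts w1 t1 w2 t2 n1 n2 n : run c1 ts w1 t1 n1 ->
      run c2 t1 w2 t2 n2 -> n1 + n2 <= n -> run (Seq c1 c2) ts (w1 ++ w2) t2 n
  | run_exit js (b : _ -> bool) c ts n : ~~ b (mask js (heads ts)) -> 0 < n ->
      run (While js b c) ts [::] ts n
  | run_loop js (b : _ -> bool) c ts w1 t1 w2 t2 n1 n2 n : b (mask js (heads ts)) ->
      run c ts w1 t1 n1 -> run (While js b c) t1 w2 t2 n2 -> n1 + n2 < n ->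
      run (While js b c) ts (w1 ++ w2) t2 n.

Fixpoint noflip c :=
  match c with
  | Act _ _ => true
  | Flip _ => false
  | Seq c1 c2 => noflip c1 && noflip c2
  | While _ _ c => noflip c
  end.

Fixpoint below n c :=
  match c with
  | Act js _ => all (gtn n) js
  | Flip j => j < n
  | Seq c1 c2 => below n c1 && below n c2
  | While js _ c => all (gtn n) js && below n c
  end.

Lemma all_gtnW m n js : m <= n -> all (gtn m) js -> all (gtn n) js.
Proof. by move=> mn; apply: sub_all => i /=; lia. Qed.

Lemma belowW m n c : m <= n -> below m c -> below n c.
Proof.
move=> mn; elim: c => /= [js f|j|c1 h1 c2 h2|js b c h].
- exact: all_gtnW.
- lia.
- by case/andP=> /h1-> /h2->.
- by case/andP=> /(all_gtnW mn)-> /h->.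
Qed.

(** * Compilation *)

(** The exit is not a point of [c] but the [None] of [option (pts c)]; the surrounding command
    decides where it leads. *)
Fixpoint pts (c : cmd) : finType :=
  match c with
  | Act _ _ | Flip _ => unit
  | Seq c1 c2 => (pts c1 + pts c2)%type
  | While _ _ c => option (pts c)
  end.

Fixpoint entry c : pts c :=
  match c with
  | Act _ _ | Flip _ => tt
  | Seq c1 c2 => inl (entry c1)
  | While _ _ c => None
  end.

Definition imap T U (g : T -> U) (i : instr T) : instr U :=
  match i with
  | Halt b => Halt b
  | Step a => Step (g a)
  | Guess a0 a1 => Guess (g a0) (g a1)
  end.

Definition thru P Q (g : option P -> Q) (x : option P * action) : Q * action :=
  (g x.1, x.2).

Definition seq_next c1 c2 (o : option (pts c1)) : option (pts (Seq c1 c2)) :=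
  Some (if o is Some p then inl p else inr (entry c2)).

Definition seq_last c1 c2 (o : option (pts c2)) : option (pts (Seq c1 c2)) :=
  omap inr o.

(* [None] is the exit of a command, and also the test of a loop. *)
Fixpoint tr c : pts c -> (nat -> cell) -> instr (option (pts c) * action) :=
  match c with
  | Act js f => fun _ ra => Step (None, act_on js f ra)
  | Flip j => fun _ ra =>
      let g b := (None, act_on [:: j] (fun _ _ => (Some (inl b), Right)) ra) in
      Guess (g false) (g true)
  | Seq c1 c2 => fun p ra =>
      match p with
      | inl p => imap (thru (@seq_next c1 c2)) (tr p ra)
      | inr p => imap (thru (@seq_last c1 c2)) (tr p ra)
      end
  | While js b c => fun p ra =>
      if p is Some p then imap (thru (@Some _)) (tr p ra)
      else Step (if b (mask js ra) then Some (Some (entry c)) else None,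
                 fun i => (ra i, Stay))
  end.

Inductive go c : option (pts c) -> tapes -> str -> tapes -> nat -> Prop :=
  | go_exit ts n : go None ts [::] ts n
  | go_step p ts x w ts' n : tr p (heads ts) = Step x ->
      go x.1 (moves ts x.2) w ts' n -> go (Some p) ts w ts' n.+1
  | go_guess p ts x0 x1 (g : bool) w ts' n : tr p (heads ts) = Guess x0 x1 ->
      go (if g then x1 else x0).1 (moves ts (if g then x1 else x0).2) w ts' n ->
      go (Some p) ts (g :: w) ts' n.+1.

Lemma go_le c (o : option (pts c)) ts w ts' m n :
  go o ts w ts' m -> m <= n -> go o ts w ts' n.
Proof.
move=> h; elim: h n => {o ts w ts' m} [ts m|p ts x w ts' m e h IH|
  p ts x0 x1 g w ts' m e h IH] [|n] // mn; do ?exact: go_exit.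
- by apply: (go_step e); apply: IH.
- by apply: (go_guess e); apply: IH.
Qed.

Lemma go_seq_last c1 c2 (o : option (pts c2)) ts w ts' n :
  go o ts w ts' n -> go (@seq_last c1 c2 o) ts w ts' n.
Proof.
elim=> {o ts w ts' n} [ts n|p ts x w ts' n e h IH|p ts x0 x1 g w ts' n e h IH].
- exact: go_exit.
- by apply: (@go_step (Seq c1 c2) (inr p) ts (thru (@seq_last c1 c2) x));
    rewrite //= e.
- apply: (@go_guess (Seq c1 c2) (inr p) ts (thru (@seq_last c1 c2) x0)
    (thru (@seq_last c1 c2) x1)); first by rewrite /= e.
  by case: g h IH.
Qed.

(** The exit of [c1] is identified with the entry of [c2], so passing from one to the other costs no
    step. *)
Lemma go_seq_next c1 c2 (o : option (pts c1)) ts w1 t1 w2 t2 n1 n2 :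
  go o ts w1 t1 n1 -> go (Some (entry c2)) t1 w2 t2 n2 ->
  go (@seq_next c1 c2 o) ts (w1 ++ w2) t2 (n1 + n2).
Proof.
move=> h1 h2; elim: h1 h2 => {o ts w1 t1 n1} [ts n|p ts x w ts' n e h IH|
  p ts x0 x1 g w ts' n e h IH] h2.
- by apply: (go_le (go_seq_last c1 h2)); lia.
- by apply: (@go_step (Seq c1 c2) (inl p) ts (thru (@seq_next c1 c2) x));
    rewrite /= ?e //; exact: IH.
- apply: (@go_guess (Seq c1 c2) (inl p) ts (thru (@seq_next c1 c2) x0)
    (thru (@seq_next c1 c2) x1)); first by rewrite /= e.
  by move: (IH h2); case: g {h IH}.
Qed.

(** Inside the loop the exit [None] of the body is the test point itself, so [Some o] covers the
    body and its end alike. *)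
Lemma go_body js b c (o : option (pts c)) ts w1 t1 w2 t2 n1 n2 :
  go o ts w1 t1 n1 -> @go (While js b c) (Some None) t1 w2 t2 n2 ->
  @go (While js b c) (Some o) ts (w1 ++ w2) t2 (n1 + n2).
Proof.
move=> h1 h2; elim: h1 h2 => {o ts w1 t1 n1} [ts n|p ts x w ts' n e h IH|
  p ts x0 x1 g w ts' n e h IH] h2.
- by apply: (go_le h2); lia.
- by apply: (@go_step (While js b c) (Some p) ts (thru (@Some _) x));
    rewrite /= ?e //; exact: IH.
- apply: (@go_guess (While js b c) (Some p) ts (thru (@Some _) x0)
    (thru (@Some _) x1)); first by rewrite /= e.
  by move: (IH h2); case: g {h IH}.
Qed.

Lemma moves_nop ts : moves ts (fun i => (heads ts i, Stay)) = ts.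
Proof. by apply: funext => i; rewrite /moves swrite_stay. Qed.

Lemma run_go c ts w ts' n : run c ts w ts' n -> go (Some (entry c)) ts w ts' n.
Proof.
elim=> {c ts w ts' n} [js f ts [|n]|j b ts [|n]|c1 c2 ts w1 t1 w2 t2 n1 n2 n _ h1 _ h2|
  js b c ts [|n]|js b c ts w1 t1 w2 t2 n1 n2 [|n] hb _ h1 _ h2] //.
- by move=> _; apply: (@go_step (Act js f)) => //; exact: go_exit.
- move=> _; apply: (@go_guess (Flip j)) => //.
  by case: b; exact: go_exit.
- by move/(go_le (go_seq_next h1 h2)).
- move=> /negPf hb _; apply: (@go_step (While js b c)) => /=; first by rewrite hb.
  by rewrite /= moves_nop; exact: go_exit.
- move=> hn; apply: (@go_step (While js b c)) => /=; first by rewrite hb.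
  rewrite /= moves_nop; apply: (go_le (go_body h1 h2)); lia.
Qed.

Lemma noflip_tr c p ra : noflip c -> if tr (c := c) p ra is Guess _ _ then False else True.
Proof.
elim: c p => //= [c1 h1 c2 h2|js b c h] [] p.
- by case/andP=> /(h1 p) + _; case: tr.
- by case/andP=> _ /(h2 p); case: tr.
- by move/(h p); case: tr.
by [].
Qed.

Definition within N (ra : nat -> cell) (a : action) :=
  forall i, N <= i -> a i = (ra i, Stay).

Lemma within_act N js f ra : all (gtn N) js -> within N ra (act_on js f ra).
Proof.
move=> /allP js_lt i le_i; rewrite /act_on; case: ifP => // /js_lt /=.
by rewrite ltnNge le_i.
Qed.

Lemma below_tr N c p ra : below N c ->
  match tr (c := c) p ra with
  | Halt _ => True
  | Step x => within N ra x.2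
  | Guess x0 x1 => within N ra x0.2 /\ within N ra x1.2
  end.
Proof.
elim: c p => //= [js f|j|c1 h1 c2 h2|js b c h].
- by move=> _; exact: within_act.
- by move=> _ jN; split; apply: within_act; rewrite /= jN.
- by case=> p /andP[b1 b2]; [move: (h1 p b1)|move: (h2 p b2)]; case: tr.
- by case=> [p|] /andP[_ // bc]; move: (h p bc); case: tr.
Qed.

Section Machine.
Variables (m K : nat) (outp : 'I_K) (verdict : (nat -> cell) -> bool) (c : cmd).

Definition tname (t : 'I_m + 'I_K) : nat := unsplit t.

(* What the machine reads, with blanks on the tapes that it does not have. *)
Definition seen (a : {ffun 'I_m + 'I_K -> cell}) : nat -> cell :=
  fun i => if insub i is Some o then a (split (o : 'I_(m + K))) else None.

Definition machine : ntm m := @NTM m (option (pts c)) X 'I_K outp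
  (Some (entry c))
  (fun s a => if s is Some p
              then imap (fun x => (x.1, [ffun t => x.2 (tname t)])) (tr p (seen a))
              else Halt (verdict (seen a))).

Definition same (mt : 'I_m + 'I_K -> tape (bool + X)) (ts : tapes) :=
  (forall t, den (mt t) = ts (tname t)) /\ (forall i, m + K <= i -> ts i = blank).

Lemma seen_same mt ts : same mt ts -> seen [ffun t => read_tape (mt t)] = heads ts.
Proof.
case=> h1 h2; apply: funext => i; rewrite /seen /heads.
case: insubP => [o _ <-|]; last by rewrite -leqNgt => /h2->.
by rewrite ffunE den_read h1 /tname splitK.
Qed.

Lemma same_moves mt ts a : same mt ts -> within (m + K) (heads ts) a ->
  same (fun t => write_move (mt t) ([ffun t => a (tname t)] t)) (moves ts a).
Proof.
case=> h1 h2 ha; split=> [t|i le_i]; first by rewrite den_write ffunE h1.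
by rewrite /moves ha // /heads h2 // swrite_stay.
Qed.

(* A computation in at most [n] steps. *)
Inductive lasts k (M : ntm k) : nat -> config M -> str -> config M -> Prop :=
  | lasts_halt d r n : instr_at d = Halt r -> lasts n d [::] d
  | lasts_step d a w d' n : instr_at d = Step a ->
      lasts n (apply d a) w d' -> lasts n.+1 d w d'
  | lasts_guess d a0 a1 (g : bool) w d' n : instr_at d = Guess a0 a1 ->
      lasts n (apply d (if g then a1 else a0)) w d' -> lasts n.+1 d (g :: w) d'.

(** One induction gives both views of a run: [lasts] keeps the time, for [halts_within], and
    [computation] keeps the path name and the verdict. *)
Lemma go_machine o ts w ts' n mt : below (m + K) c -> same mt ts ->
  go o ts w ts' n ->
  exists mt', [/\ same mt' ts',
    lasts n ((o, mt) : config machine) w (None, mt') &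
    computation ((o, mt) : config machine) w (verdict (heads ts')) (None, mt')].
Proof.
move=> cK hs h; elim: h mt hs => {o ts w ts' n}
  [ts n|p ts x w ts' n e h IH|p ts x0 x1 g w ts' n e h IH] mt hs.
- have hh : instr_at ((None, mt) : config machine) = Halt (verdict (heads ts)).
    by rewrite /instr_at /= (seen_same hs).
  by exists mt; split=> //; [exact: lasts_halt hh|exact: comp_halt hh].
- have := below_tr p (heads ts) cK; rewrite e => wx.
  have [mt' [hs' l' c']] := IH _ (same_moves hs wx).
  have hh : instr_at ((Some p, mt) : config machine)
      = Step (x.1, [ffun t => x.2 (tname t)]).
    by rewrite /instr_at /= (seen_same hs) e.
  by exists mt'; split=> //; [exact: lasts_step hh _|exact: comp_step hh _].
- have := below_tr p (heads ts) cK; rewrite e => -[wx0 wx1].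
  have wx : within (m + K) (heads ts) (if g then x1 else x0).2 by case: g {h IH}.
  have [mt' [hs' l' c']] := IH _ (same_moves hs wx).
  have hh : instr_at ((Some p, mt) : config machine)
      = Guess (x0.1, [ffun t => x0.2 (tname t)]) (x1.1, [ffun t => x1.2 (tname t)]).
    by rewrite /instr_at /= (seen_same hs) e.
  exists mt'; split=> //.
    by apply: lasts_guess hh _; move: l'; case: (g).
  by apply: comp_guess hh _; move: c'; case: (g).
Qed.

Lemma machine_noflip : noflip c -> deterministic machine.
Proof. by move=> nf [p|] a //=; have := noflip_tr p (seen a) nf; case: tr. Qed.

End Machine.

Lemma lasts_inv k (M : ntm k) n (d : config M) w d' : lasts n d w d' ->
  match instr_at d, n with
  | Halt _, _ => True
  | Step a, n.+1 => lasts n (apply d a) w d'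
  | Guess a0 a1, n.+1 =>
      if w is g :: w' then lasts n (apply d (if g then a1 else a0)) w' d' else False
  | _, _ => False
  end.
Proof. by case=> {n d w d'} [d r n|d a w d' n|d a0 a1 g w d' n] ->. Qed.

(** Each guess uses up one symbol, so both successors again have all words of one common length as
    timed paths; every branch is therefore covered. *)
Lemma lasts_halts k (M : ntm k) n (d : config M) l :
  (forall w, size w = l -> exists d', lasts n d w d') -> halts_within n d.
Proof.
elim: n d l => [|n IH] d l h /=.
  have [d' /lasts_inv] := h (nseq l false) (size_nseq _ _).
  by case: instr_at.
case e: (instr_at d) => [r|a|a0 a1] //.
  by apply: (IH _ l) => w /h[d' /lasts_inv]; rewrite e; exists d'.
case: l h => [|l] h.
  by have [//|d' /lasts_inv] := h [::]; rewrite e.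
apply/andP; split; apply: (IH _ l) => w sw.
  by have [|d' /lasts_inv] := h (false :: w); rewrite ?e /= ?sw //; exists d'.
by have [|d' /lasts_inv] := h (true :: w); rewrite ?e /= ?sw //; exists d'.
Qed.

End Commands.

(** * Polynomial bounds *)

(** One parameter is both coefficient and exponent, so time bounds are compared, added and composed
    by adjusting a single number. *)
Definition poly e n := e * n.+1 ^ e.

Lemma leq_poly a b m n : a <= b -> m <= n -> poly a m <= poly b n.
Proof.
move=> ab mn; apply: leq_mul => //.
apply: leq_trans (_ : m.+1 ^ b <= _); first exact: leq_pexp2l.
by case: b ab => // b _; rewrite leq_exp2r.
Qed.

Lemma poly_linear e n : e * n + e <= poly e n.
Proof.
case: e => // e; rewrite /poly addnC -mulnS leq_mul2l /= -{1}(expn1 n.+1).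
exact: leq_pexp2l.
Qed.

Lemma poly_id e n : 0 < e -> n <= poly e n.
Proof. by case: e => // e _; apply: leq_trans (poly_linear _ _); nia. Qed.

Lemma poly_add a b n : poly a n + poly b n <= poly (a + b) n.
Proof.
by rewrite {3}/poly mulnDl leq_add // /poly leq_mul2l leq_pexp2l ?orbT //; lia.
Qed.

(** The sum of the coefficient and of the exponent that appear when [b * (a.+1 * n.+1 ^ a) ^ b] is
    expanded. *)
Definition poly_exp a b := b * a.+1 ^ b + a * b.

Lemma poly_comp a b n : poly b (poly a n) <= poly (poly_exp a b) n.
Proof.
have h : (poly a n).+1 <= a.+1 * n.+1 ^ a.
  by rewrite /poly mulSn addnC -addn1 leq_add2l expn_gt0.
apply: leq_trans (_ : b * (a.+1 * n.+1 ^ a) ^ b <= _).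
  by rewrite /poly leq_mul2l; case: b => // b; rewrite leq_exp2r // h orbT.
rewrite expnMn mulnA -expnM /poly; apply: leq_mul; first by rewrite /poly_exp; lia.
by apply: leq_pexp2l => //; rewrite /poly_exp; lia.
Qed.

Definition tot (v : seq str) := \sum_(x <- v) size x.

Definition upd X (ts : tapes X) j t : tapes X := fun i => if i == j then t else ts i.

Ltac upd_ext := apply: funext => i; rewrite /upd; repeat (case: eqP => [?|?]; subst) => //.

Section Programs.
Variable X : finType.

Notation cell := (option (bool + X)).
Notation tapes := (tapes X).
Notation cmd := (cmd X).
Implicit Types ts : tapes.

(** * Strings on tapes *)

Definition bit (b : bool) : cell := Some (inl b).

(** The string [u ++ v] with the head on the first symbol of [v]; the left half lists the nearest
    cell first, hence [rev u]. *)
Definition tp (u v : str) : stape (bool + X) :=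
  (nth None (map bit (rev u)), nth None (map bit v)).

Definition reg := tp [::].

Definition toL (t : stape (bool + X)) := swrite t (t.2 0, Left).
Definition toR (t : stape (bool + X)) := swrite t (t.2 0, Right).

Lemma toLR t : toL (toR t) = t.
Proof. by case: t => l r; rewrite /toL /toR /swrite /= stail_scons !scons_stail. Qed.

Lemma toRL t : toR (toL t) = t.
Proof. by case: t => l r; rewrite /toL /toR /swrite /= stail_scons !scons_stail. Qed.

Lemma blank_reg : blank = reg [::].
Proof. by rewrite /reg /tp /=; congr (_, _); apply: funext => i; rewrite nth_nil. Qed.

Lemma tp_put u v b : swrite (tp u v) (bit b, Right) = tp (rcons u b) (behead v).
Proof.
rewrite /swrite /tp /= scons_nth stail_nth rev_rcons; congr (_, _).
by case: v.
Qed.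

Lemma toR_tp u b v : toR (tp u (b :: v)) = tp (rcons u b) v.
Proof. by rewrite -[RHS](tp_put u (b :: v)). Qed.

Lemma toL_tp u b v : toL (tp (rcons u b) v) = tp u (b :: v).
Proof. by rewrite -toR_tp toLR. Qed.

Lemma upd_id ts j t : ts j = t -> upd ts j t = ts.
Proof. by move=> <-; apply: funext => i; rewrite /upd; case: eqP => // ->. Qed.

Lemma upd_upd ts j t t' : upd (upd ts j t) j t' = upd ts j t'.
Proof. by apply: funext => i; rewrite /upd; case: eqP. Qed.

Lemma upd_eq ts j t : upd ts j t j = t.
Proof. by rewrite /upd eqxx. Qed.

Lemma upd_ne ts i j t : i != j -> upd ts j t i = ts i.
Proof. by rewrite /upd => /negPf->. Qed.

Lemma act1 (j : nat) f ts :
  act [:: j] f ts = upd ts j (swrite (ts j) (f (mask [:: j] (heads ts)) j)).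
Proof.
apply: funext => i; rewrite /act /moves /act_on /upd inE.
by case: eqP => [->|_] //; rewrite swrite_stay.
Qed.

Lemma act2 (i j : nat) f ts : i != j ->
  act [:: i; j] f ts =
  upd (upd ts i (swrite (ts i) (f (mask [:: i; j] (heads ts)) i)))
    j (swrite (ts j) (f (mask [:: i; j] (heads ts)) j)).
Proof.
move=> ij; apply: funext => k; rewrite /act /moves /act_on /upd !inE.
case: (k =P i) => [->|_] /=; first by rewrite (negPf ij).
by case: eqP => [->|_] //; rewrite swrite_stay.
Qed.

Lemma mask_in (js : seq nat) (ra : nat -> cell) j : j \in js -> mask js ra j = ra j.
Proof. by rewrite /mask => ->. Qed.

(** * Rewinding and copying *)

Definition mv j d : cmd := Act [:: j] (fun ra i => (ra i, d)).
Definition busy j (ra : nat -> cell) := ra j != None.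

(** The head may stand on the blank behind the string; the first left move brings it onto the last
    symbol of the left part, or onto the blank before the string if that part is empty. *)
Definition rewind j : cmd :=
  Seq (mv j Left) (Seq (While [:: j] (busy j) (mv j Left)) (mv j Right)).

Lemma run_mvL j ts : run (mv j Left) ts [::] (upd ts j (toL (ts j))) 1.
Proof.
have := @run_act X [:: j] (fun ra i => (ra i, Left)) ts 1 isT.
by rewrite act1 mask_in ?inE.
Qed.

Lemma run_mvR j ts : run (mv j Right) ts [::] (upd ts j (toR (ts j))) 1.
Proof.
have := @run_act X [:: j] (fun ra i => (ra i, Right)) ts 1 isT.
by rewrite act1 mask_in ?inE.
Qed.

Lemma run_to c (ts t1 t2 : tapes) w n : run c ts w t1 n -> t1 = t2 -> run c ts w t2 n.
Proof. by move=> h <-. Qed.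

Lemma run_seq0 c1 c2 (ts t1 t2 : tapes) n1 n2 n : run c1 ts [::] t1 n1 ->
  run c2 t1 [::] t2 n2 -> n1 + n2 <= n -> run (Seq c1 c2) ts [::] t2 n.
Proof. exact: run_seq. Qed.

Lemma run_loop0 js (q : _ -> bool) c (ts t1 t2 : tapes) n1 n2 n :
  q (mask js (heads ts)) -> run c ts [::] t1 n1 ->
  run (While js q c) t1 [::] t2 n2 -> n1 + n2 < n ->
  run (While js q c) ts [::] t2 n.
Proof. exact: run_loop. Qed.

Lemma run_rewind_loop j ts u v : ts j = toL (tp u v) ->
  run (While [:: j] (busy j) (mv j Left)) ts [::]
    (upd ts j (toL (reg (u ++ v)))) (2 * size u).+1.
Proof.
elim/last_ind: u v ts => [|u b IH] v ts e.
  rewrite upd_id //; apply: run_exit => //.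
  by rewrite /busy mask_in ?inE // /heads e.
rewrite size_rcons cat_rcons; apply: run_loop0 (run_mvL j ts) _ _.
- by rewrite /busy mask_in ?inE // /heads e toL_tp.
- have := IH (b :: v) (upd ts j (toL (ts j))).
  by rewrite upd_eq e toL_tp upd_upd; apply.
- by lia.
Qed.

Lemma run_rewind j ts u v : ts j = tp u v ->
  run (rewind j) ts [::] (upd ts j (reg (u ++ v))) (2 * size u + 3).
Proof.
move=> e; apply: run_seq0; first exact: run_mvL.
  apply: run_seq0; first by apply: (@run_rewind_loop _ _ u v); rewrite upd_eq e.
    rewrite upd_upd; have := run_mvR j (upd ts j (toL (reg (u ++ v)))).
    by rewrite upd_upd upd_eq toRL; apply.
  exact: leqnn.
lia.
Qed.

(** Only [a] is rewound: the head of [b] stays at the end, so that successive calls concatenate. *)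
Definition append a b : cmd :=
  Seq (While [:: a] (busy a) (Act [:: a; b] (fun ra _ => (ra a, Right)))) (rewind a).

Lemma run_append_loop a b ts u v w : a != b -> ts a = tp u v -> ts b = tp w [::] ->
  run (While [:: a] (busy a) (Act [:: a; b] (fun ra _ => (ra a, Right)))) ts [::]
    (upd (upd ts a (tp (u ++ v) [::])) b (tp (w ++ v) [::])) (2 * size v).+1.
Proof.
move=> ab; elim: v ts u w => [|x v IH] ts u w ea eb.
  rewrite !cats0 upd_id ?upd_ne 1?eq_sym // upd_id //; apply: run_exit => //.
  by rewrite /busy mask_in ?inE // /heads ea.
apply: run_loop0 (_ : run _ _ _ _ 1) _ _.
- by rewrite /busy mask_in ?inE // /heads ea.
- exact: run_act.
- rewrite act2 // mask_in ?inE ?eqxx // /heads ea eb !(tp_put _ _ x).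
  rewrite -!(cat_rcons x); set ts1 := upd _ b _.
  have -> : upd (upd ts a (tp (rcons u x ++ v) [::])) b (tp (rcons w x ++ v) [::])
          = upd (upd ts1 a (tp (rcons u x ++ v) [::])) b (tp (rcons w x ++ v) [::]).
    by apply: funext => i; rewrite /ts1 /upd; case: eqP => //; case: eqP.
  apply: IH; rewrite /ts1 ?upd_eq // upd_ne ?upd_eq //.
- rewrite [size (x :: v)]/=; lia.
Qed.

Lemma run_append a b ts s w : a != b -> ts a = reg s -> ts b = tp w [::] ->
  run (append a b) ts [::] (upd ts b (tp (w ++ s) [::])) (4 * size s + 4).
Proof.
move=> ab ea eb; apply: run_seq0; first exact: (run_append_loop ab ea eb).
  apply: run_to; first by apply: (@run_rewind a _ s [::]); rewrite upd_ne ?upd_eq.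
  by upd_ext; [lia|rewrite ea cats0].
by lia.
Qed.

(** * Functions computed on registers *)

(* The inputs are in the registers [ds], the tapes from [n] on are blank; the
   output is put in the register [d], and the tapes from [n'] on stay blank. *)
Definition fp m (F : seq str -> str) : Prop :=
  forall n ds, size ds = m -> uniq ds -> all (gtn n) ds ->
  exists c d n' e, [/\ n <= d < n', noflip c, below n' c &
  forall v (ts : tapes), map ts ds = map reg v -> (forall i, n <= i -> ts i = blank) ->
  exists ts', [/\ run c ts [::] ts' (poly e (tot v)),
                  forall i, i < n -> ts' i = ts i,
                  ts' d = reg (F v),
                  forall i, n' <= i -> ts' i = blank &
                  size (F v) <= poly e (tot v)]].

Fixpoint every T (P : T -> Prop) (s : seq T) : Prop :=
  if s is x :: s' then P x /\ every P s' else True.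

Lemma tot_cons x v : tot (x :: v) = size x + tot v.
Proof. by rewrite /tot big_cons. Qed.

(** Each program leaves the tapes below its own [n] untouched, so the inputs and all earlier results
    survive while the next function is computed on fresh tapes. *)
Lemma fps k Gs : every (fp k) Gs ->
  forall n ds, size ds = k -> uniq ds -> all (gtn n) ds ->
  exists c rs n' e, [/\ size rs = size Gs /\ n <= n',
    uniq rs /\ all (fun r => n <= r < n') rs, noflip c, below n' c &
  forall v (ts : tapes), map ts ds = map reg v -> (forall i, n <= i -> ts i = blank) ->
  exists ts', [/\ run c ts [::] ts' (poly e (tot v)),
                  forall i, i < n -> ts' i = ts i,
                  map ts' rs = map reg [seq G v | G <- Gs],
                  forall i, n' <= i -> ts' i = blank &
                  tot [seq G v | G <- Gs] <= poly e (tot v)]].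
Proof.
elim: Gs => [_|G Gs IH /= [hG /IH{}IH]] n ds sds uds lds.
  exists (Act [::] (fun ra i => (ra i, Stay))), [::], n, 1; split=> // v ts e b.
  exists ts; split=> //; last by rewrite /tot big_nil.
  have := @run_act X [::] (fun ra i => (ra i, Stay)) ts (poly 1 (tot v)).
  have -> : act [::] (fun ra i => (ra i, Stay)) ts = ts by exact: moves_nop.
  by apply; rewrite /poly mul1n expn1.
have [c1 [d [n1 [e1 [/andP[nd dn1] nf1 b1 h1]]]]] := hG n ds sds uds lds.
have [|c2 [rs [n2 [e2 [[srs n12] [urs lrs] nf2 b2 h2]]]]] := IH n1 ds sds uds.
  by apply: all_gtnW lds; lia.
exists (Seq c1 c2), (d :: rs), n2, (e1 + e2); split.
- by split; [rewrite /= srs|lia].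
- split=> /=.
    rewrite urs andbT; apply/negP => /(allP lrs); lia.
  rewrite nd (leq_trans dn1 n12) /=; apply: sub_all lrs => r; lia.
- by rewrite /= nf1.
- by rewrite /= b2 (belowW n12 b1).
move=> v ts ets bts; have [t1 [r1 k1 o1 z1 s1]] := h1 v ts ets bts.
have [||t2 [r2 k2 o2 z2 s2]] := h2 v t1.
- rewrite -ets; apply/eq_in_map => i /(allP lds) /= i_n; exact: k1.
- exact: z1.
exists t2; split=> //.
- by apply: run_seq0 r1 r2 _; exact: poly_add.
- by move=> i i_n; rewrite k2 ?k1 //; lia.
- by rewrite /= k2 // o1 o2.
- by rewrite /= tot_cons; apply: leq_trans (poly_add _ _ _); lia.
Qed.

(** The intermediate results have polynomial total length, which is why [fp] bounds the size of its
    output too. *)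
Lemma fp_comp k m F Gs : fp m F -> size Gs = m -> every (fp k) Gs ->
  fp k (fun v => F [seq G v | G <- Gs]).
Proof.
move=> hF sGs hGs n ds sds uds lds.
have [c1 [rs [n1 [e1 [[srs nn1] [urs lrs] nf1 b1 h1]]]]] := fps hGs sds uds lds.
have [| | |c2 [d [n2 [e2 [/andP[nd dn2] nf2 b2 h2]]]]] := hF n1 rs.
- by rewrite srs.
- by [].
- by apply: sub_all lrs => r /=; lia.
exists (Seq c1 c2), d, n2, (e1 + poly_exp e1 e2); split.
- lia.
- by rewrite /= nf1.
- by rewrite /= b2 andbT; apply: belowW b1; lia.
move=> v ts ets bts; have [t1 [r1 k1 o1 z1 s1]] := h1 v ts ets bts.
have [t2 [r2 k2 o2 z2 s2]] := h2 _ t1 o1 z1.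
have le2 : poly e2 (tot [seq G v | G <- Gs]) <= poly (poly_exp e1 e2) (tot v).
  by apply: leq_trans (poly_comp _ _ _); apply: leq_poly.
exists t2; split=> //.
- apply: run_seq0 r1 r2 _; apply: leq_trans (poly_add _ _ _).
  by rewrite leq_add2l.
- by move=> i i_n; rewrite k2 ?k1 //; lia.
- apply: leq_trans (leq_trans s2 le2) _; apply: leq_trans (poly_add _ _ _).
  exact: leq_addl.
Qed.

Lemma fp_comp1 k F G : fp 1 F -> fp k G -> fp k (fun v => F [:: G v]).
Proof. by move=> hF hG; apply: (fp_comp (Gs := [:: G]) hF). Qed.

Lemma fp_comp2 k F G H : fp 2 F -> fp k G -> fp k H -> fp k (fun v => F [:: G v; H v]).
Proof. by move=> hF hG hH; apply: (fp_comp (Gs := [:: G; H]) hF). Qed.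

Lemma fp_ext k F G : fp k F -> (forall v, size v = k -> F v = G v) -> fp k G.
Proof.
move=> hF FG n ds sds uds lds.
have [c [d [n' [e [nd nf b h]]]]] := hF n ds sds uds lds.
exists c, d, n', e; split=> // v ts ets; rewrite -FG; first exact: h.
by rewrite -sds -(size_map ts) ets size_map.
Qed.

(** * Projections, concatenation, multiplication of lengths *)

Lemma fp_nth k i : i < k -> fp k (fun v => nth [::] v i).
Proof.
move=> ik n ds sds uds lds; set a := nth 0 ds i.
have an : a < n by apply: (all_nthP 0 lds); rewrite sds.
exists (Seq (append a n) (rewind n)), n, n.+1, 8; split=> //.
- by rewrite leqnn /=.
- by rewrite /=; lia.
move=> v ts ets bts.
have ea : ts a = reg (nth [::] v i).
  rewrite /a -(nth_map 0 blank) ?sds // ets (nth_map [::]) //.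
  by rewrite -(size_map reg) -ets size_map sds.
have le : size (nth [::] v i) <= tot v.
  have iv : i < size v by rewrite -(size_map reg) -ets size_map sds.
  by rewrite /tot (big_nth [::]) big_mkord (bigD1 (Ordinal iv)) //= leq_addr.
exists (upd ts n (reg (nth [::] v i))); split.
- have na : a != n by lia.
  have en : ts n = tp [::] [::] by rewrite bts // blank_reg.
  have := run_append na ea en; set ts1 := upd _ _ _ => r1.
  have := @run_rewind n ts1 (nth [::] v i) [::]; rewrite /ts1 upd_eq => /(_ erefl).
  rewrite upd_upd cats0 => r2; apply: run_seq0 r1 r2 _.
  apply: leq_trans (poly_linear _ _); lia.
- by move=> j jn; rewrite upd_ne // neq_ltn jn.
- by rewrite upd_eq.
- by move=> j jn; rewrite upd_ne ?bts //; lia.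
- by apply: leq_trans le _; exact: poly_id.
Qed.

Lemma fp_cat : fp 2 (fun v => nth [::] v 0 ++ nth [::] v 1).
Proof.
move=> n [|a [|b []]] //= _; rewrite inE andbT => ab /and3P[an bn _].
exists (Seq (append a n) (Seq (append b n) (rewind n))), n, n.+1, 20; split=> //.
- by rewrite leqnn /=.
- by rewrite /=; lia.
move=> [|x [|y []]] ts //= [ea eb] bts.
have tE : tot [:: x; y] = size x + size y by rewrite !tot_cons /tot big_nil addn0.
exists (upd ts n (reg (x ++ y))); split.
- have na : a != n by lia.
  have nb : b != n by lia.
  have en : ts n = tp [::] [::] by rewrite bts // blank_reg.
  have r1 := run_append na ea en; rewrite cat0s in r1.
  have := @run_append b n (upd ts n (tp x [::])) y x nb.
  rewrite upd_ne // upd_eq upd_upd => /(_ eb erefl) r2.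
  have := @run_rewind n (upd ts n (tp (x ++ y) [::])) (x ++ y) [::].
  rewrite upd_eq upd_upd cats0 => /(_ erefl) r3.
  apply: run_seq0 r1 (run_seq0 r2 r3 (leqnn _)) _.
  apply: leq_trans (poly_linear _ _); rewrite tE size_cat; lia.
- by move=> j jn; rewrite upd_ne // neq_ltn jn.
- by rewrite upd_eq.
- by move=> j jn; rewrite upd_ne ?bts //; lia.
- by rewrite size_cat -tE; exact: poly_id.
Qed.

(** Multiplication in unary: one copy of the second string for each symbol of the first. Polynomial
    lengths are built from this. *)
Lemma fp_mul : fp 2 (fun v => flatten (nseq (size (nth [::] v 0)) (nth [::] v 1))).
Proof.
move=> n [|a [|b []]] //= _; rewrite inE andbT => ab /and3P[an bn _].
pose loop := While [:: a] (busy a) (Seq (append b n) (mv a Right)).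
exists (Seq loop (Seq (rewind a) (rewind n))), n, n.+1, 40; split=> //.
- by rewrite leqnn /=.
- by rewrite /=; lia.
move=> [|x [|y []]] ts //= [ea eb] bts.
have tE : tot [:: x; y] = size x + size y by rewrite !tot_cons /tot big_nil addn0.
have na : a != n by lia.
have nb : b != n by lia.
have hloop u v w ts1 : ts1 a = tp u v -> ts1 b = reg y -> ts1 n = tp w [::] ->
    run loop ts1 [::] (upd (upd ts1 a (tp (u ++ v) [::])) n
       (tp (w ++ flatten (nseq (size v) y)) [::])) (size v * (4 * size y + 6)).+1.
  elim: v u w ts1 => [|c v IH] u w ts1 e1 e2 e3.
    rewrite !cats0 upd_id ?upd_ne 1?eq_sym // upd_id //; apply: run_exit => //.
    by rewrite /busy mask_in ?inE // /heads e1.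
  apply: run_loop0 (_ : run _ _ _ _ (4 * size y + 5)) _ _.
  - by rewrite /busy mask_in ?inE // /heads e1.
  - apply: run_seq0 (run_append nb e2 e3) (run_mvR _ _) _; lia.
  - have ab' : b != a by rewrite eq_sym.
    have an' : n != a by rewrite eq_sym.
    apply: run_to; first apply: (IH (rcons u c) (w ++ y)).
    + by rewrite upd_eq upd_ne // e1 toR_tp.
    + by rewrite !upd_ne.
    + by rewrite upd_ne // upd_eq.
    + by upd_ext; rewrite /= ?cat_rcons -?catA //; lia.
  - rewrite /=; lia.
exists (upd ts n (reg (flatten (nseq (size x) y)))).
have sF : size (flatten (nseq (size x) y)) = size x * size y.
  by rewrite size_flatten /shape map_nseq sumn_nseq mulnC.
have le : 10 * (size x * size y) + 20 * (size x + size y) + 20 <= poly 40 (tot [:: x; y]).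
  rewrite /poly tE; apply: leq_trans (_ : 40 * (size x + size y).+1 ^ 2 <= _).
    by rewrite expnS expn1; nia.
  by rewrite leq_mul2l /= leq_pexp2l.
split.
- have an' : n != a by rewrite eq_sym.
  have en : ts n = tp [::] [::] by rewrite bts // blank_reg.
  have r1 := hloop [::] x [::] ts ea eb en; rewrite !cat0s in r1.
  set ts1 := upd _ n _ in r1.
  have e1 : ts1 a = tp x [::] by rewrite /ts1 upd_ne // upd_eq.
  have e2 : upd ts1 a (reg (x ++ [::])) n = tp (flatten (nseq (size x) y)) [::].
    by rewrite upd_ne // /ts1 upd_eq.
  apply: run_seq0 r1 (run_seq0 (run_rewind e1) _ (leqnn _)) _.
    apply: run_to (run_rewind e2) _.
    by rewrite /ts1; upd_ext; rewrite ?cats0 ?ea //; lia.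
  apply: leq_trans le; rewrite sF; lia.
- by move=> j jn; rewrite upd_ne // neq_ltn jn.
- by rewrite upd_eq.
- by move=> j jn; rewrite upd_ne ?bts //; lia.
- by apply: leq_trans le; rewrite sF; lia.
Qed.

End Programs.

(** * Finite-state transducers *)

Section Transducers.
Variables (step : option bool -> seq (option bool) -> option bool * option bool)
          (fin : option bool -> option bool).

Definition reads (v : seq str) i := [seq onth x i | x <- v].

Fixpoint transit v i : option bool * str :=
  if i is j.+1 then
    let: (q, o) := transit v j in
    let: (q', e) := step q (reads v j) in (q', o ++ seq_of_opt e)
  else (None, [::]).

Definition longest (v : seq str) := \max_(x <- v) size x.

(* The inputs are read in parallel, up to the end of the longest one, from the
   initial state [None]. *)
Definition transduce v : str :=
  let: (q, o) := transit v (longest v) in o ++ seq_of_opt (fin q).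

Lemma size_transit v i : size (transit v i).2 <= i.
Proof.
elim: i => //= i; case: (transit v i) => q o /= so; case: (step _ _) => q' [e|] /=.
  by rewrite size_cat /= addn1.
by rewrite cats0; lia.
Qed.

Lemma longest_tot v : longest v <= tot v.
Proof.
rewrite /longest /tot; elim: v => [|x v IH]; first by rewrite !big_nil.
by rewrite !big_cons geq_max leq_addr (leq_trans IH) ?leq_addl.
Qed.

Lemma longestP v i :
  (i < longest v) = has (fun o => o != None) (reads v i).
Proof.
rewrite /longest; elim: v => [|x v IH]; first by rewrite big_nil.
rewrite big_cons /= -IH leq_max; congr (_ || _).
by rewrite onthE; case: ltnP => h; [rewrite (nth_map false)|rewrite nth_default ?size_map].
Qed.

Variable X : finType.
Notation tapes := (tapes X).
Notation cell := (option (bool + X)).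

(** The three states fit into one cell, and the initial state [None] is the blank, so a fresh tape
    needs no initialization. *)
Definition enc1 (q : option bool) : cell := omap inl q.
Definition dec1 (a : cell) : option bool := if a is Some (inl b) then Some b else None.

Lemma enc1K : cancel enc1 dec1. Proof. by case=> [[]|]. Qed.

Definition cellt (a : cell) : stape (bool + X) := (fun=> None, scons a (fun=> None)).

Lemma cellt0 : blank = cellt None.
Proof. by congr (_, _); apply: funext; case. Qed.

Lemma swrite_cellt a a' : swrite (cellt a) (a', Stay) = cellt a'.
Proof. by rewrite /swrite /= stail_scons. Qed.

Lemma iter_toR i (t : stape (bool + X)) j : (iter i (@toR X) t).2 j = t.2 (i + j).
Proof.
elim: i j => //= i IH j; rewrite /toR /swrite /= /stail IH.
by rewrite addnS.
Qed.

Lemma head_reg s i : dec1 ((reg X s).2 i) = onth s i.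
Proof.
rewrite /reg /tp /= onthE; case: (ltnP i (size s)) => h.
  by rewrite !(nth_map false).
by rewrite !nth_default ?size_map.
Qed.

Lemma busy_reg s i : ((reg X s).2 i != None) = (onth s i != None).
Proof.
rewrite /reg /tp /= onthE; case: (ltnP i (size s)) => h.
  by rewrite !(nth_map false).
by rewrite !nth_default ?size_map.
Qed.

(** For loops whose tapes after [i] rounds have a closed form [S i]. *)
Lemma run_iter js (q : _ -> bool) c L m (S : nat -> tapes) :
  (forall i, i < L -> q (mask js (heads (S i))) /\ run c (S i) [::] (S i.+1) m) ->
  ~~ q (mask js (heads (S L))) -> run (While js q c) (S 0) [::] (S L) (L * m.+1).+1.
Proof.
elim: L S => [|L IH] S h hL; first by apply: run_exit; rewrite ?mul0n.
have [q0 r0] := h 0 isT; apply: run_loop0 q0 r0 _ _.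
  by apply: (IH (fun i => S i.+1)) => // i iL; apply: h.
by rewrite /=; lia.
Qed.

(** Tape [n] holds the state, [n.+1] the output, and [n.+2] one mark per step; heads of exhausted
    inputs keep moving over blanks, so all inputs stay aligned. *)
Definition lockstep n ds : cmd X :=
  let all_busy ra := has (fun j => ra j != None) ds in
  let next ra := step (dec1 (ra n)) [seq dec1 (ra j) | j <- ds] in
  While ds all_busy
    (Act (n :: n.+1 :: n.+2 :: ds) (fun ra i =>
      if i == n then (enc1 (next ra).1, Stay)
      else if i == n.+1 then (if (next ra).2 is Some b then (bit X b, Right)
                              else (ra i, Stay))
      else if i == n.+2 then (bit X true, Right) else (ra i, Right))).

(* Tape [n.+2] counts the steps, so that all inputs can be rewound together. *)
Definition transducer n ds : cmd X :=
  Seq (lockstep n ds)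
  (Seq (mv X n.+2 Left)
  (Seq (While [:: n.+2] (@busy X n.+2) (Act (n.+2 :: ds) (fun ra i => (ra i, Left))))
  (Seq (Act [:: n; n.+1] (fun ra i => if (i == n.+1) then
          if fin (dec1 (ra n)) is Some b then (bit X b, Right) else (ra i, Stay)
        else (ra i, Stay)))
  (rewind X n.+1)))).

Lemma fp_transduce k : fp X k transduce.
Proof.
move=> n ds sds uds lds; exists (transducer n ds), n.+1, n.+3, 20; split=> //.
- lia.
- by rewrite /= !andbT !(all_gtnW _ lds) /=; lia.
move=> v ts ets bts; set L := longest v.
have dsn j : j \in ds -> [/\ (j == n) = false, (j == n.+1) = false & (j == n.+2) = false].
  by move/(allP lds) => /=; split; apply/eqP; lia.
pose S i : tapes := fun j =>
  if j == n then cellt (enc1 (transit v i).1)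
  else if j == n.+1 then tp X (transit v i).2 [::]
  else if j == n.+2 then tp X (nseq i true) [::]
  else if j \in ds then iter i (@toR X) (ts j) else ts j.
have S0 : S 0 = ts.
  apply: funext => j; rewrite /S /=; case: eqP => [->|_]; first by rewrite bts // -cellt0.
  case: eqP => [->|_]; first by rewrite bts // blank_reg.
  case: eqP => [->|_]; first by rewrite bts ?blank_reg //; lia.
  by case: ifP.
have Sds i j : j \in ds -> (S i j).2 0 = (ts j).2 i.
  by move=> jds; have [j1 j2 j3] := dsn j jds; rewrite /S j1 j2 j3 jds iter_toR addn0.
have rdE js i : {subset ds <= js} ->
    [seq dec1 (mask js (heads (S i)) j) | j <- ds] = reads v i.
  move=> sub; transitivity [seq dec1 (t.2 i) | t <- map ts ds].
    by rewrite -map_comp; apply/eq_in_map => j jds; rewrite mask_in ?sub //= /heads Sds.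
  by rewrite ets -map_comp; apply: eq_map => s; rewrite /= head_reg.
have busyE i : has (fun j => mask ds (heads (S i)) j != None) ds = (i < L).
  rewrite longestP; transitivity (has (fun t => t.2 i != None) (map ts ds)).
    by rewrite has_map; apply: eq_in_has => j jds; rewrite mask_in //= /heads Sds.
  by rewrite ets !has_map; apply: eq_has => s; rewrite /= busy_reg.
have r1 : run (lockstep n ds) ts [::] (S L) (L * 2).+1.
  rewrite -S0; apply: (run_iter (m := 1)) => [i iL|]; last by rewrite busyE ltnn.
  split; first by rewrite busyE.
  set js := n :: _; set f := fun ra : nat -> cell => _.
  have -> : S i.+1 = act js f (S i); last exact: run_act.
  apply: funext => j; rewrite /act /moves /act_on /f rdE; last first.
    by move=> l lds'; rewrite /js !inE lds' !orbT.
  have -> : dec1 (mask js (heads (S i)) n) = (transit v i).1.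
    by rewrite mask_in ?inE ?eqxx // /heads /S eqxx /= enc1K.
  rewrite {1}/S /=; case tE: (transit v i) => [q o].
  case sE: (step _ _) => [q' e] /=.
  have [->|jn] := eqVneq j n.
    by rewrite inE eqxx /= /S eqxx swrite_cellt.
  have [->|jn1] := eqVneq j n.+1.
    rewrite !inE eqxx orbT /=.
    have -> : S i n.+1 = tp X o [::] by rewrite /S eqxx tE; case: eqP => //; lia.
    case: e sE => [e|] sE /=; first by rewrite tp_put cats1.
    rewrite mask_in ?inE ?eqxx ?orbT // cats0 /heads /S eqxx tE.
    by case: eqP => [|_]; [lia|rewrite swrite_stay].
  have [->|jn2] := eqVneq j n.+2.
    rewrite !inE eqxx !orbT /=.
    have -> : S i n.+2 = tp X (nseq i true) [::].
      by rewrite /S eqxx; do 2 (case: eqP => [|_]; first lia).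
    by rewrite tp_put -cats1 -(nseqD i 1) addn1.
  rewrite !inE (negPf jn) (negPf jn1) (negPf jn2) /=.
  case: ifP => jds; last by rewrite swrite_stay /S (negPf jn) (negPf jn1) (negPf jn2) jds.
  by rewrite mask_in ?inE ?jds ?orbT // /heads /S (negPf jn) (negPf jn1) (negPf jn2) jds.
(* The tapes after [i] steps of rewinding. The counter head is one cell further left, on the last
   mark not yet passed, so the loop makes exactly [L] steps. *)
pose B i : tapes := fun j =>
  if j == n then cellt (enc1 (transit v L).1)
  else if j == n.+1 then tp X (transit v L).2 [::]
  else if j == n.+2 then toL (tp X (nseq (L - i) true) (nseq i true))
  else if j \in ds then iter (L - i) (@toR X) (ts j) else ts j.
have r2 : run (mv X n.+2 Left) (S L) [::] (B 0) 1.
  apply: run_to (run_mvL _ _) _; apply: funext => j; rewrite /upd /B /S subn0.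
  case: (j =P n.+2) => // ->; rewrite eqxx.
  by do 2 (case: eqP => [|_]; first lia).
have Bk i : B i n.+2 = toL (tp X (nseq (L - i) true) (nseq i true)).
  by rewrite /B eqxx; do 2 (case: eqP => [|_]; first lia).
have r3 : run (While [:: n.+2] (@busy X n.+2) (Act (n.+2 :: ds) (fun ra i => (ra i, Left))))
    (B 0) [::] (B L) (L * 2).+1.
  have hd i : busy n.+2 (mask [:: n.+2] (heads (B i))) = (i < L).
    rewrite /busy mask_in ?inE // /heads Bk.
    rewrite -subn_gt0; case: (L - i) => [|l] //.
    by rewrite -{1}(addn1 l) nseqD cats1 toL_tp.
  apply: (run_iter (m := 1)) => [i iL|]; last by rewrite hd ltnn.
  split; first by rewrite hd.
  set js := n.+2 :: _; set f := fun ra : nat -> cell => _.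
  have -> : B i.+1 = act js f (B i); last exact: run_act.
  apply: funext => j; rewrite /act /moves /act_on /f.
  have [->|jn2] := eqVneq j n.+2.
    rewrite !inE eqxx mask_in ?inE ?eqxx // Bk /heads Bk.
    have -> : L - i = (L - i.+1) + 1 by lia.
    by rewrite nseqD cats1 toL_tp.
  rewrite inE (negPf jn2) /=; case: ifP => jds; last first.
    by rewrite /heads swrite_stay /B (negPf jn2) jds.
  rewrite mask_in ?inE ?jds ?orbT //; have [j1 j2 j3] := dsn j jds.
  rewrite /heads /B j1 j2 j3 jds (_ : L - i = (L - i.+1).+1) ?iterS; last by lia.
  by rewrite -[LHS]toLR.
have BL : B L = upd (upd (upd ts n.+2 (toL (tp X [::] (nseq L true))))
    n.+1 (tp X (transit v L).2 [::])) n (cellt (enc1 (transit v L).1)).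
  apply: funext => j; rewrite /B /upd subnn /=.
  by do 3 (case: eqP => // _); case: ifP.
case tE: (transit v L) => [q o] in BL *; rewrite /= in BL.
pose f := fun (ra : nat -> cell) i => if i == n.+1 then
          if fin (dec1 (ra n)) is Some b then (bit X b, Right) else (ra i, Stay)
        else (ra i, Stay).
have r4 : run (Act [:: n; n.+1] f) (B L) [::]
    (upd (B L) n.+1 (tp X (transduce v) [::])) 1.
  have -> : upd (B L) n.+1 (tp X (transduce v) [::]) = act [:: n; n.+1] f (B L).
    have nn1 : n != n.+1 by lia.
    rewrite act2 // /f (negPf nn1) eqxx !mask_in ?inE ?eqxx ?orbT //.
    rewrite /heads swrite_stay (@upd_id _ _ n) // -/(heads (B L)).
    rewrite -[(B L n).2 0]/(heads (B L) n).
    have -> : heads (B L) n = enc1 q by rewrite /heads BL upd_eq.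
    rewrite enc1K /heads; have -> : B L n.+1 = tp X o [::].
      by rewrite BL upd_ne 1?eq_sym // upd_eq.
    rewrite /transduce -/L tE; case: (fin q) => [b|] /=.
      by rewrite tp_put cats1.
    by rewrite cats0 swrite_stay.
  exact: run_act.
have r5 := @run_rewind X n.+1 (upd (B L) n.+1 (tp X (transduce v) [::]))
  (transduce v) [::].
rewrite upd_eq upd_upd cats0 in r5; have {}r5 := r5 erefl.
have sz : size (transduce v) <= L.+1.
  have := size_transit v L; rewrite /transduce -/L tE size_cat /=.
  by case: (fin q) => /=; lia.
exists (upd (B L) n.+1 (reg X (transduce v))); split.
- apply: run_seq0 r1 (run_seq0 r2 (run_seq0 r3 (run_seq0 r4 r5 (leqnn _))
    (leqnn _)) (leqnn _)) _.
  apply: leq_trans (poly_linear _ _); have := longest_tot v; lia.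
- by move=> i i_n; rewrite BL !upd_ne //; lia.
- by rewrite upd_eq.
- by move=> i i_n; rewrite BL !upd_ne ?bts //; lia.
- by apply: leq_trans (poly_linear _ _); have := longest_tot v; lia.
Qed.

End Transducers.

(** * Replaying a nondeterministic machine *)

Section Replay.
Variables (k : nat) (N : ntm k).

(* The path of [N] whose choices are read from [o], completed with zeros. *)
Fixpoint replay n (c : config N) (o : str) : str * config N :=
  match instr_at c, n with
  | Step a, n'.+1 => replay n' (apply c a) o
  | Guess a0 a1, n'.+1 =>
      let: (w, c') := replay n' (apply c (if head false o then a1 else a0)) (behead o) in
      (head false o :: w, c')
  | _, _ => ([::], c)
  end.

Definition verdict (c : config N) : bool := if instr_at c is Halt r then r else false.

Lemma computation_replay n (c : config N) o : halts_within n c ->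
  computation c (replay n c o).1 (verdict (replay n c o).2) (replay n c o).2.
Proof.
elim: n c o => [|n IH] c o /=; case e: (instr_at c) => [r|a|a0 a1] //=.
- by move=> _; apply: comp_halt; rewrite /verdict e.
- by move=> _; apply: comp_halt; rewrite /verdict e.
- by move=> h; apply: comp_step e (IH _ _ h).
case/andP=> h0 h1.
have /(IH _ (behead o)) : halts_within n (apply c (if head false o then a1 else a0)).
  by case: ifP.
case: replay => w c' /= h; exact: comp_guess e h.
Qed.

(** Choices behind the path are never read, so [z] is arbitrary. This allows a path to be stored
    with other data after it. *)
Lemma replay_computation n (c : config N) w r c' z : computation c w r c' -> halts_within n c ->
  replay n c (w ++ z) = (w, c') /\ instr_at c' = Halt r.
Proof.
move=> h; elim: h n => {c w r c'} [c r e|c a w r c' e h IH|c a0 a1 g w r c' e h IH] [|n] /=;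
  rewrite e //.
- exact: IH.
- case/andP=> h0 h1; have /IH[-> ->] // : halts_within n (apply c (if g then a1 else a0)).
  by case: (g).
Qed.

Lemma size_computation n (c : config N) w r c' : computation c w r c' -> halts_within n c ->
  size w <= n.
Proof.
move=> h; elim: h n => {c w r c'} [c r e|c a w r c' e h IH|c a0 a1 g w r c' e h IH] [|n] /=;
  rewrite e //.
- by move/IH/leqW.
- by case: (g) IH => IH /andP[h0 h1]; apply: IH.
Qed.

Lemma halts_le m n (c : config N) : m <= n -> halts_within m c -> halts_within n c.
Proof.
elim: m n c => [|m IH] [|n] c //=; case e: (instr_at c) => [r|a|a0 a1] //=.
  by move=> mn; apply: IH.
by move=> mn /andP[h0 h1]; apply/andP; split; apply: IH.
Qed.

Lemma size_replay n (c : config N) o : size (replay n c o).1 <= n.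
Proof.
elim: n c o => [|n IH] c o /=; case e: (instr_at c) => [r|a|a0 a1] //=.
  by apply: leq_trans (IH _ _) _.
by have := IH (apply c (if head false o then a1 else a0)) (behead o); case: replay.
Qed.

Lemma size_write_move A (t : tape A) a :
  size (write_move t a).1 + size (write_move t a).2 <= (size t.1 + size t.2).+2.
Proof. by case: t a => l r [a []] /=; rewrite ?size_behead /=; lia. Qed.

(** A step adds at most two listed cells to a tape; hence outputs have polynomial size. *)
Lemma size_tapes_replay n (c : config N) o t :
  size ((replay n c o).2.2 t).1 + size ((replay n c o).2.2 t).2 <=
  size (c.2 t).1 + size (c.2 t).2 + 2 * n.
Proof.
elim: n c o => [|n IH] c o /=; case e: (instr_at c) => [r|a|a0 a1] //=; try lia.
  by apply: leq_trans (IH _ _) _; have := size_write_move (c.2 t) (a.2 t) => /=; lia.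
set b := head false o; have := IH (apply c (if b then a1 else a0)) (behead o).
case: replay => w c' /= h; apply: leq_trans h _.
by have := size_write_move (c.2 t) ((if b then a1 else a0).2 t) => /=; lia.
Qed.

Lemma size_leading_bits (s : seq (option (bool + aux N))) :
  size (leading_bits s) <= size s.
Proof. by elim: s => [|[[b|a]|] s IH]. Qed.

(** Defined for lists of any length: missing inputs are empty, and further entries, such as the
    choices, are dropped. *)
Definition inputs (v : seq str) : k.-tuple str := [tuple nth [::] v i | i < k].

Lemma inputs_val (v : k.-tuple str) u : inputs (v ++ u) = v.
Proof.
apply: eq_from_tnth => i; rewrite tnth_mktuple nth_cat size_tuple ltn_ord.
by rewrite (tnth_nth [::]).
Qed.

Lemma size_inputs v : \sum_(x <- inputs v) size x <= tot v.
Proof.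
rewrite big_tuple; under eq_bigr do rewrite tnth_mktuple.
rewrite /tot; case: (leqP k (size v)) => h.
  rewrite (big_nth [::]) (big_cat_nat _ h) //= big_mkord; exact: leq_addr.
rewrite (big_nth [::]) -(big_mkord predT (fun i => size (nth [::] v i))).
rewrite (big_cat_nat _ (ltnW h)) //= [X in _ + X]big_nat_cond.
by rewrite [X in _ + X]big1 ?addn0 // => i /andP[/andP[vi _] _]; rewrite nth_default.
Qed.

Variables (e : nat)
  (halts : forall v : k.-tuple str, halts_within (poly e (\sum_(x <- v) size x)) (init N v)).

(* The string that follows the inputs of [N] holds the choices. *)
Definition result (v : seq str) : str * config N :=
  replay (poly e (tot v)) (init N (inputs v)) (nth [::] v k).

Lemma halts_inputs v : halts_within (poly e (tot v)) (init N (inputs v)).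
Proof. by apply: halts_le (halts _); apply: leq_poly => //; exact: size_inputs. Qed.

Lemma resultP (v : k.-tuple str) o : computation (init N v) (result (rcons v o)).1
  (verdict (result (rcons v o)).2) (result (rcons v o)).2.
Proof.
rewrite -{1}[v](inputs_val v [:: o]) -cats1; apply: computation_replay.
exact: halts_inputs.
Qed.

Lemma result_eq (v : k.-tuple str) w r c z : computation (init N v) w r c ->
  result (rcons v (w ++ z)) = (w, c) /\ verdict c = r.
Proof.
rewrite -{1}[v](inputs_val v [:: w ++ z]) => h.
rewrite /result nth_rcons size_tuple ltnn eqxx -cats1.
have [-> e'] := replay_computation z h (halts_inputs _).
by rewrite /verdict e'.
Qed.

(** * Programming the replay *)

(** Several machines will be replayed over one common alphabet [X], hence an embedding with a
    partial inverse. States are coded as well, since the simulated state is written on a tape. *)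
Variables (X : finType) (code : aux N + state N -> X) (decode : X -> option (aux N + state N)).
Hypothesis codeK : pcancel code decode.

Notation tapes := (tapes X).
Notation cell := (option (bool + X)).
Notation ncell := (option (bool + aux N)).
Notation tname := ('I_k + work N)%type.

Definition ecell (a : ncell) : cell :=
  omap (fun z => match z with inl b => inl b | inr a => inr (code (inl a)) end) a.
Definition dcell (a : cell) : ncell :=
  match a with
  | Some (inl b) => Some (inl b)
  | Some (inr x) => if decode x is Some (inl a) then Some (inr a) else None
  | None => None
  end.

Lemma ecellK : cancel ecell dcell.
Proof. by case=> [[b|a]|] //=; rewrite codeK. Qed.

Definition etape (t : stape (bool + aux N)) : stape (bool + X) :=
  (ecell \o t.1, ecell \o t.2).

Lemma etape_write t (a : ncell * move) :
  etape (swrite t a) = swrite (etape t) (ecell a.1, a.2).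
Proof.
by case: t a => l r [a []]; rewrite /etape /swrite /=; congr (_, _);
  apply: funext; case=> // -[].
Qed.

Section Program.
Variables (n : nat) (ds : seq nat).

Definition nm (t : tname) : nat := n + 2 + enum_rank t.
Definition unm (j : nat) : option tname := [pick t | nm t == j].
Definition sims : seq nat := [seq nm t | t <- enum {: tname}].

Lemma nm_inj : injective nm.
Proof. by move=> t t' /addnI /val_inj /enum_rank_inj. Qed.

Lemma unm_nm t : unm (nm t) = Some t.
Proof.
by rewrite /unm; case: pickP => [t' /eqP/nm_inj->|/(_ t)] //; rewrite eqxx.
Qed.

Lemma nm_sims t : nm t \in sims.
Proof. by apply: map_f; rewrite mem_enum. Qed.

Lemma unm_sims j t : unm j = Some t -> j \in sims.
Proof. by rewrite /unm; case: pickP => // t' /eqP<- _; exact: nm_sims. Qed.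

Lemma unm_lt j : j < n + 2 -> unm j = None.
Proof. by rewrite /unm; case: pickP => // t /eqP<-; rewrite ltnNge leq_addr. Qed.

Lemma unm_ge j : n + 2 + #|{: tname}| <= j -> unm j = None.
Proof.
by rewrite /unm; case: pickP => // t /eqP<-; rewrite leq_add2l leqNgt ltn_ord.
Qed.

Definition instr_seen (ra : nat -> cell) : instr _ :=
  if ra n is Some (inr x) then
    if decode x is Some (inr s) then @delta k N s [ffun t => dcell (ra (nm t))]
    else Halt false
  else Halt false.

Definition running ra := if instr_seen ra is Halt _ then false else true.

(** At a guess the choice is written back before the head moves on. A zero supplied after the end of
    the choices is thus recorded too, and the part left of the head is always the path name so
    far. *)
Definition sim_step (ra : nat -> cell) (i : nat) : cell * move :=
  let b := odflt false (dec1 (ra n.+1)) in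
  let sim (a : state N * {ffun tname -> ncell * move}) :=
    if i == n then (Some (inr (code (inr a.1))), Stay)
    else if unm i is Some t then (ecell (a.2 t).1, (a.2 t).2)
    else (ra i, Stay) in
  match instr_seen ra with
  | Halt _ => (ra i, Stay)
  | Step a => sim a
  | Guess a0 a1 => if i == n.+1 then (bit X b, Right) else sim (if b then a1 else a0)
  end.

Definition sim_loop : cmd X :=
  While (n :: sims) running (Act (n :: n.+1 :: sims) sim_step).

(* Tape [n] holds the state of [N], tape [n.+1] the choices. *)
Definition sim (ts : tapes) (c : config N) (u o : str) : tapes := fun j =>
  if j == n then cellt (Some (inr (code (inr c.1))))
  else if j == n.+1 then tp X u o
  else if unm j is Some t then etape (den (c.2 t)) else ts j.

Lemma sim_nm ts c u o t : sim ts c u o (nm t) = etape (den (c.2 t)).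
Proof.
rewrite /sim unm_nm /nm; case: eqP => [|_]; first lia.
by case: eqP => [|_] //; lia.
Qed.

Lemma instr_sim js ts c u o : {subset n :: sims <= js} ->
  instr_seen (mask js (heads (sim ts c u o))) = instr_at c.
Proof.
move=> sub; rewrite /instr_seen mask_in; last by apply: sub; rewrite inE eqxx.
rewrite {1}/heads {1}/sim eqxx /= codeK; congr delta; apply/ffunP => t.
rewrite !ffunE mask_in; last by apply: sub; rewrite inE nm_sims orbT.
by rewrite /heads sim_nm /= ecellK den_read.
Qed.

Lemma sub_sims : {subset n :: sims <= n :: n.+1 :: sims}.
Proof. by move=> j; rewrite !inE => /orP[->|->] //; rewrite !orbT. Qed.

Lemma sim_act_tape ts c u o (a : state N * {ffun tname -> ncell * move}) j :
  j != n -> j != n.+1 ->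
  swrite (sim ts c u o j)
    (if j \in n :: n.+1 :: sims
     then if unm j is Some t then (ecell (a.2 t).1, (a.2 t).2)
          else (mask (n :: n.+1 :: sims) (heads (sim ts c u o)) j, Stay)
     else (heads (sim ts c u o) j, Stay)) =
  if unm j is Some t then etape (den (write_move (c.2 t) (a.2 t))) else ts j.
Proof.
move=> jn jn1; rewrite /sim (negPf jn) (negPf jn1); case jt: (unm j) => [t|].
  by rewrite !inE (unm_sims jt) !orbT den_write etape_write.
by case: ifP => js; rewrite ?mask_in // /heads (negPf jn) (negPf jn1) jt swrite_stay.
Qed.

Lemma run_sim_step ts c u o a : instr_at c = Step a ->
  run (Act (n :: n.+1 :: sims) sim_step) (sim ts c u o) [::] (sim ts (apply c a) u o) 1.
Proof.
move=> e'; apply: run_to; first exact: run_act.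
apply: funext => j; rewrite /act /moves /act_on /sim_step (instr_sim _ _ _ _ sub_sims) e'.
have [->|jn] := eqVneq j n; first by rewrite inE eqxx /= /sim eqxx swrite_cellt.
have [->|jn1] := eqVneq j n.+1.
  rewrite !inE eqxx orbT /= unm_lt; last by lia.
  by rewrite mask_in ?inE ?eqxx ?orbT // swrite_stay /sim eqxx; case: eqP => //; lia.
by rewrite sim_act_tape // [RHS]/sim (negPf jn) (negPf jn1).
Qed.

Lemma run_sim_guess ts c u o a0 a1 : instr_at c = Guess a0 a1 ->
  run (Act (n :: n.+1 :: sims) sim_step) (sim ts c u o) [::]
    (sim ts (apply c (if head false o then a1 else a0)) (rcons u (head false o))
       (behead o)) 1.
Proof.
move=> e'; apply: run_to; first exact: run_act.
have n1E x : sim ts x u o n.+1 = tp X u o by rewrite /sim eqxx; case: eqP => //; lia.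
have bE : odflt false (dec1 (mask (n :: n.+1 :: sims) (heads (sim ts c u o)) n.+1))
    = head false o.
  by rewrite mask_in ?inE ?eqxx ?orbT // /heads n1E; case: (o).
apply: funext => j; rewrite /act /moves /act_on /sim_step (instr_sim _ _ _ _ sub_sims) e'.
rewrite bE; set b := head false o.
have [->|jn] := eqVneq j n.
  rewrite inE eqxx /=; case: eqP => [|_]; first lia.
  by rewrite /sim eqxx swrite_cellt.
have [->|jn1] := eqVneq j n.+1.
  rewrite !inE eqxx orbT /= n1E tp_put /sim eqxx.
  by case: eqP => // h; lia.
by rewrite sim_act_tape // [RHS]/sim (negPf jn) (negPf jn1).
Qed.

Lemma run_sim_loop m ts c u o : halts_within m c ->
  run sim_loop (sim ts c u o) [::]
    (sim ts (replay m c o).2 (u ++ (replay m c o).1) (drop (size (replay m c o).1) o))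
    (2 * m).+1.
Proof.
have q x u' o' : running (mask (n :: sims) (heads (sim ts x u' o'))) =
    if instr_at x is Halt _ then false else true.
  by rewrite /running instr_sim.
elim: m c u o => [|m IH] c u o /=; case e': (instr_at c) => [r|a|a0 a1] //=.
- by move=> _; rewrite cats0 drop0; apply: run_exit => //; rewrite q e'.
- by move=> _; rewrite cats0 drop0; apply: run_exit => //; rewrite q e'.
- move=> h; apply: run_loop0 (run_sim_step _ _ _ e') (IH _ _ _ h) _; first by rewrite q e'.
  lia.
case/andP=> h0 h1.
have h : halts_within m (apply c (if head false o then a1 else a0)) by case: ifP.
have := IH _ (rcons u (head false o)) (behead o) h.
case: replay => w c' /= r; apply: (run_loop0 (n2 := (2 * m).+1)) (run_sim_guess _ _ _ e') _ _.
- by rewrite q e'.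
- move: r; rewrite cat_rcons; case: (o) => //=.
  lia.
Qed.

Fixpoint copies (ps : seq (nat * nat)) : cmd X :=
  if ps is p :: ps then Seq (append X p.1 p.2) (Seq (rewind X p.2) (copies ps))
  else Act [::] (fun ra i => (ra i, Stay)).

Lemma run_copies (ps : seq (nat * nat)) (ts : tapes) B :
  uniq (map snd ps) ->
  (forall p, p \in ps -> [/\ p.1 \notin map snd ps, ts p.2 = blank &
    exists2 s, ts p.1 = reg X s & size s <= B]) ->
  exists ts', [/\ run (copies ps) ts [::] ts' (size ps * (6 * B + 7)).+1,
    forall p, p \in ps -> ts' p.2 = ts p.1 &
    forall j, j \notin map snd ps -> ts' j = ts j].
Proof.
elim: ps ts => [|[a b] ps IH] ts /=.
  move=> _ _; exists ts; split=> //; apply: run_to; first exact: run_act.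
  exact: moves_nop.
case/andP=> bps ups h.
have [+ tb [s ea sB]] := h (a, b) (mem_head _ _).
rewrite inE negb_or => /andP[/= ab aps].
have tb' : ts b = tp X [::] [::] by rewrite tb blank_reg.
have r1 := run_append ab ea tb'; rewrite cat0s in r1.
have := @run_rewind X b (upd ts b (tp X s [::])) s [::].
rewrite upd_eq upd_upd cats0 => /(_ erefl) r2.
have [||ts' [r3 h1 h2]] := IH (upd ts b (reg X s)); first exact: ups.
  move=> p pps; have [] := h p; first by rewrite inE pps orbT.
  rewrite inE negb_or => /andP[pb pn] tp2 [s' es' sB'].
  have p2b : p.2 != b by apply: contraNneq bps => <-; apply: map_f.
  by split=> //; [rewrite upd_ne|exists s'; rewrite ?upd_ne].
exists ts'; split.
- apply: run_seq0 r1 (run_seq0 r2 r3 (leqnn _)) _; lia.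
- move=> p; rewrite inE => /orP[/eqP->|pps] /=; first by rewrite h2 // upd_eq ea.
  rewrite h1 // upd_ne //.
  have [] := h p; first by rewrite inE pps orbT.
  by rewrite inE negb_or => /andP[].
- by move=> j; rewrite inE negb_or => /andP[jb jps]; rewrite h2 // upd_ne.
Qed.

(** The last argument supplies the choices; the simulated work tapes start blank and receive
    nothing. *)
Definition sim_copies : seq (nat * nat) :=
  (nth 0 ds k, n.+1) :: [seq (nth 0 ds (i : 'I_k), nm (inl i)) | i <- enum 'I_k].

Definition replayer : cmd X :=
  Seq (copies sim_copies)
  (Seq (Act [:: n] (fun _ _ => (Some (inr (code (inr (start N)))), Stay)))
  sim_loop).

Hypotheses (sds : size ds = k.+1) (lds : all (gtn n) ds).

Lemma below_copies m ps : (forall p, p \in ps -> p.1 < m /\ p.2 < m) ->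
  below m (copies ps).
Proof.
elim: ps => //= p ps IH h; rewrite IH ?andbT; last first.
  by move=> q qps; apply: h; rewrite inE qps orbT.
by have [-> ->] := h p (mem_head _ _).
Qed.

Lemma noflip_copies ps : noflip (copies ps).
Proof. by elim: ps. Qed.

Definition top : nat := n + 2 + #|{: tname}|.

Lemma nm_top t : nm t < top.
Proof. by rewrite /nm /top ltn_add2l. Qed.

Lemma sims_top : all (gtn top) sims.
Proof. by apply/allP => j /mapP[t _ ->]; exact: nm_top. Qed.

Lemma below_replayer : below top replayer.
Proof.
have n1 : n.+1 < top by rewrite /top; lia.
have n0 : n < top by lia.
rewrite /= n1 n0 sims_top /= !andbT andbA andbC below_copies //.
  have -> : nth 0 ds k < top.
    by have := all_nthP 0 lds k; rewrite sds => /(_ (leqnn _)) /=; lia.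
  by [].
move=> p /mapP[i _ ->] /=; split; last exact: nm_top.
have := all_nthP 0 lds i; rewrite sds => /(_ _) /=.
by have := ltn_ord i => h /(_ (ltnW h)); lia.
Qed.

Lemma run_replayer v (ts : tapes) : map ts ds = map (reg X) v ->
  (forall i, n <= i -> ts i = blank) ->
  run replayer ts [::]
    (sim ts (result v).2 (result v).1 (drop (size (result v).1) (nth [::] v k)))
    ((k.+1 * (6 * tot v + 7)) + 2 * poly e (tot v) + 3).
Proof.
move=> ets bts.
have sv : size v = k.+1 by rewrite -sds -(size_map ts) ets size_map.
have vE i : i < k.+1 -> ts (nth 0 ds i) = reg X (nth [::] v i).
  by move=> ik; rewrite -(nth_map 0 blank) ?sds // ets (nth_map [::]) ?sv.
have vB i : i < k.+1 -> size (nth [::] v i) <= tot v.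
  move=> ik; rewrite -sv in ik.
  by rewrite /tot (big_nth [::]) big_mkord (bigD1 (Ordinal ik)) //= leq_addr.
have dn i : i < k.+1 -> nth 0 ds i < n.
  by move=> ik; have := all_nthP 0 lds i; rewrite sds => /(_ ik).
have sndE : map snd sim_copies = n.+1 :: [seq nm (inl i) | i <- enum 'I_k].
  by rewrite /= -map_comp.
have nmn j : j \in [seq nm (inl i) | i <- enum 'I_k] -> n.+1 < j.
  by case/mapP=> i _ ->; rewrite /nm; lia.
have := @run_copies sim_copies ts (tot v).
rewrite sndE => -[||t1 [r1 h1 h2]].
- rewrite /= map_inj_uniq ?enum_uniq ?andbT; last by move=> i i' /nm_inj[].
  by apply/negP => /nmn; rewrite ltnn.
- move=> p; have pn i : i < k.+1 ->
      nth 0 ds i \notin n.+1 :: [seq nm (inl i) | i <- enum 'I_k].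
    move=> ik; rewrite inE negb_or; have := dn i ik => lt.
    by apply/andP; split; [lia|apply/negP => /nmn; lia].
  rewrite inE => /orP[/eqP->|/mapP[i _ ->]] /=; split.
  + exact: pn.
  + by apply: bts; lia.
  + by exists (nth [::] v k); [exact: vE|exact: vB].
  + by apply: pn; apply: leqW.
  + by apply: bts; rewrite /nm; lia.
  + by exists (nth [::] v i); [apply: vE|apply: vB]; apply: leqW.
set t2 := act [:: n] (fun _ _ => (Some (inr (code (inr (start N)))), Stay)) t1.
have t2E : t2 = sim ts (init N (inputs v)) [::] (nth [::] v k).
  apply: funext => j; rewrite /t2 act1 /upd /sim.
  case: (j =P n) => [_|/eqP jn].
    rewrite h2; last by rewrite inE negb_or; apply/andP; split; [lia|apply/negP => /nmn; lia].
    by rewrite bts // cellt0 swrite_cellt.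
  case: (j =P n.+1) => [->|/eqP jn1]; first by rewrite (h1 (nth 0 ds k, n.+1)) ?mem_head // vE.
  case jt: (unm j) => [[i|t]|].
  - have jE : nm (inl i) = j by move: jt; rewrite /unm; case: pickP => // t' /eqP <- [->].
    rewrite -jE (h1 (nth 0 ds i, nm (inl i))); last first.
      by rewrite inE; apply/orP; right; apply/mapP; exists i; rewrite // mem_enum.
    rewrite vE; last by apply: leqW.
    rewrite /etape /den /= tnth_mktuple; congr (_, _); apply: funext => l; rewrite /= ?nth_nil //.
    case: (ltnP l (size (nth [::] v i))) => h.
      by rewrite !(nth_map false).
    by rewrite nth_default ?size_map // nth_default ?size_map.
  - have jE : nm (inr t) = j by move: jt; rewrite /unm; case: pickP => // t' /eqP <- [->].
    rewrite h2; last first.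
      rewrite inE negb_or jn1; apply/negP => /mapP[i _]; rewrite -jE.
      by move/nm_inj.
    rewrite bts; last by rewrite -jE /nm; lia.
    by rewrite /etape /den /=; congr (_, _); apply: funext => l; rewrite /= nth_nil.
  - rewrite h2 // inE negb_or jn1; apply/negP => /mapP[i _ jE].
    by rewrite jE unm_nm in jt.
apply: run_seq0 r1 (run_seq0 (_ : run _ _ _ t2 1) _ (leqnn _)) _.
- exact: run_act.
- rewrite t2E; exact: run_sim_loop (halts_inputs v).
- by rewrite /= size_map size_enum_ord; lia.
Qed.

End Program.

(** * The results of the replay *)

(** Common frame for extracting a result: [obs] starts on the final tapes of the replay and leaves
    its answer on the fresh tape [top n]. *)
Lemma fp_observe F (obs : nat -> cmd X) a :
  (forall n, noflip (obs n)) -> (forall n, below (top n).+1 (obs n)) ->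
  (forall n v ts, (forall i, n <= i -> ts i = blank) -> exists ts',
    [/\ run (obs n) (sim n ts (result v).2 (result v).1
              (drop (size (result v).1) (nth [::] v k))) [::] ts'
          (a * (poly e (tot v) + tot v) + a),
        forall i, i < n -> ts' i = ts i,
        ts' (top n) = reg X (F v),
        forall i, (top n).+1 <= i -> ts' i = blank &
        size (F v) <= a * (poly e (tot v) + tot v) + a]) ->
  fp X k.+1 F.
Proof.
move=> nf bl h n ds sds uds lds.
exists (Seq (replayer n ds) (obs n)), (top n), (top n).+1, (10 * k.+1 + a + (a + 2) * e + 10).
have le v : k.+1 * (6 * tot v + 7) + 2 * poly e (tot v) + 3 +
    (a * (poly e (tot v) + tot v) + a) <= poly (10 * k.+1 + a + (a + 2) * e + 10) (tot v).
  set b := 10 * k.+1 + a.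
  apply: leq_trans (_ : (b * tot v + b) + ((a + 2) * poly e (tot v) + 3) <= _).
    rewrite /b; lia.
  rewrite -(addnA b); apply: leq_trans (poly_add _ _ _); apply: leq_add; first exact: poly_linear.
  rewrite /poly; apply: leq_trans (_ : ((a + 2) * e + 10) * (tot v).+1 ^ e <= _).
    have : 0 < (tot v).+1 ^ e by rewrite expn_gt0.
    by move: (_ ^ e) => P; nia.
  by rewrite leq_mul2l leq_pexp2l ?orbT //; nia.
split.
- by rewrite /top; lia.
- by rewrite /= noflip_copies nf.
- rewrite -[below _ _]/(below _ (replayer n ds) && below _ (obs n)) bl andbT.
  exact: belowW (leqnSn _) (below_replayer sds lds).
move=> v ts ets bts; have [ts' [r k1 o z s]] := h n v ts bts.
exists ts'; split=> //.
- exact: run_seq0 (run_replayer sds lds ets bts) r (le v).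
- by apply: leq_trans s _; apply: leq_trans (le v); lia.
Qed.

Lemma sim_out n ts c u o i : i < n \/ top n <= i -> sim n ts c u o i = ts i.
Proof.
move=> h; rewrite /sim; case: eqP => [e'|_]; first by move: h; rewrite /top; lia.
case: eqP => [e'|_]; first by move: h; rewrite /top; lia.
case: h => h; first by rewrite unm_lt //; lia.
by rewrite unm_ge.
Qed.

Lemma sim_choices n ts c u o : sim n ts c u o n.+1 = tp X u o.
Proof. by rewrite /sim eqxx; case: eqP => //; lia. Qed.

Lemma blank_toL : blank = toL (reg X [::]).
Proof.
by rewrite -blank_reg /toL /swrite /=; congr (_, _); apply: funext; case=> [|[]].
Qed.

Lemma put_toL s b : swrite (toL (reg X s)) (bit X b, Left) = toL (reg X (b :: s)).
Proof.
by rewrite /toL /swrite /=; congr (_, _); apply: funext; case=> [|[|[]]].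
Qed.

(** The head is at the end of the path name, so the name is read leftwards; writing leftwards as
    well preserves the order, and a single right move makes the result a register. *)
Definition read_back n : cmd X :=
  Seq (mv X n.+1 Left)
  (Seq (While [:: n.+1] (@busy X n.+1)
         (Act [:: n.+1; top n] (fun ra _ => (ra n.+1, Left))))
  (mv X (top n) Right)).

Lemma run_read_back n ts u o w : ts n.+1 = toL (tp X u o) -> ts (top n) = toL (reg X w) ->
  exists ts', [/\ run (While [:: n.+1] (@busy X n.+1)
         (Act [:: n.+1; top n] (fun ra _ => (ra n.+1, Left)))) ts [::] ts' (2 * size u).+1,
    ts' (top n) = toL (reg X (u ++ w)) &
    forall i, i != n.+1 -> i != top n -> ts' i = ts i].
Proof.
have tn : n.+1 != top n by rewrite /top; lia.
elim/last_ind: u o w ts => [|u b IH] o w ts e1 e2.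
  by exists ts; split=> //; apply: run_exit; rewrite // /busy mask_in ?inE // /heads e1.
pose ts1 := upd (upd ts n.+1 (toL (tp X u (b :: o)))) (top n) (toL (reg X (b :: w))).
have [||ts' [r o' h]] := IH (b :: o) (b :: w) ts1.
- by rewrite /ts1 upd_ne // upd_eq.
- by rewrite /ts1 upd_eq.
exists ts'; split.
- apply: run_loop0 (_ : run _ _ _ ts1 1) r _; last by rewrite size_rcons; lia.
    by rewrite /busy mask_in ?inE // /heads e1 toL_tp.
  apply: run_to; first exact: run_act.
  rewrite act2 // /ts1 mask_in ?inE ?eqxx // /heads e1 e2 toL_tp -put_toL.
  by [].
- by rewrite cat_rcons.
- by move=> i i1 i2; rewrite h // /ts1 !upd_ne.
Qed.

Lemma fp_consumed : fp X k.+1 (fun v => (result v).1).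
Proof.
apply: (@fp_observe _ read_back 10) => [//|n|n v ts bts].
  by rewrite /= /top; lia.
set ts0 := sim _ _ _ _ _; set w := (result v).1.
have tn : n.+1 != top n by rewrite /top; lia.
have tn' : top n != n.+1 by rewrite eq_sym.
pose ts1 := upd ts0 n.+1 (toL (ts0 n.+1)).
have [||ts' [r o' h]] := @run_read_back n ts1 w (drop (size w) (nth [::] v k)) [::].
- by rewrite /ts1 upd_eq /ts0 sim_choices.
- rewrite /ts1 upd_ne // /ts0 sim_out; last by right.
  by rewrite bts -?blank_toL // /top; lia.
have sw : size w <= poly e (tot v) by exact: size_replay.
exists (upd ts' (top n) (toR (ts' (top n)))); split.
- apply: run_seq0 (run_mvL _ _) (run_seq0 r (run_mvR _ _) (leqnn _)) _; lia.
- move=> i i_n; have [h1 h2] : i != n.+1 /\ i != top n by rewrite /top; lia.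
  by rewrite upd_ne // h // /ts1 upd_ne // /ts0 sim_out //; left.
- by rewrite upd_eq o' toRL cats0.
- move=> i i_n; have [h1 h2] : i != n.+1 /\ i != top n by move: i_n; rewrite /top; lia.
  rewrite upd_ne // h // /ts1 upd_ne // /ts0 sim_out; last by right; lia.
  by apply: bts; move: i_n; rewrite /top; lia.
- by apply: leq_trans sw _; lia.
Qed.

Definition read_verdict n : cmd X :=
  Act (top n :: n :: sims n) (fun ra i =>
    if i == top n then (bit X (if instr_seen n ra is Halt r then r else false), Stay)
    else (ra i, Stay)).

Lemma fp_verdict : fp X k.+1 (fun v => [:: verdict (result v).2]).
Proof.
apply: (@fp_observe _ read_verdict 10) => [//|n|n v ts bts].
  rewrite /= (all_gtnW _ (sims_top n)) //.
  by rewrite /top; lia.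
set ts0 := sim _ _ _ _ _.
exists (upd ts0 (top n) (reg X [:: verdict (result v).2])); split.
- apply: run_to; first by apply: run_act; lia.
  apply: funext => i; rewrite /act /moves /act_on /upd; case: (i =P top n) => [->|_].
    rewrite inE eqxx instr_sim; last by move=> j; rewrite [in X in _ -> X]inE => ->; rewrite orbT.
    rewrite {1}/ts0 sim_out; last by right.
    rewrite bts ?blank_reg; last by rewrite /top; lia.
    rewrite -/(verdict _) /reg /tp /swrite /=; congr (_, _).
    by apply: funext; case=> // j; rewrite /stail /= !nth_nil.
  by case: ifP => [/mask_in->|_]; rewrite /heads swrite_stay.
- move=> i i_n; rewrite upd_ne; last by rewrite /top; lia.
  by rewrite /ts0 sim_out //; left.
- by rewrite upd_eq.
- move=> i i_n; rewrite upd_ne; last by lia.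
  rewrite /ts0 sim_out; last by right; lia.
  by apply: bts; move: i_n; rewrite /top; lia.
- by rewrite /=; lia.
Qed.

(** Copying starts where the head of [out] stands and ends at the first cell that is not a bit,
    blank or auxiliary, in agreement with [leading_bits]. *)
Definition read_output n : cmd X :=
  let j := nm n (inr (out N)) in
  Seq (While [:: j] (fun ra => dec1 (ra j) != None)
        (Act [:: j; top n] (fun ra _ => (ra j, Right))))
  (rewind X (top n)).

Lemma run_read_output n ts l r w (j := nm n (inr (out N))) :
  ts j = (l, ecell \o nth None r) -> ts (top n) = tp X w [::] ->
  exists ts', [/\ run (While [:: j] (fun ra => dec1 (ra j) != None)
        (Act [:: j; top n] (fun ra _ => (ra j, Right)))) ts [::] ts' (2 * size (leading_bits r)).+1,
    ts' (top n) = tp X (w ++ leading_bits r) [::] &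
    forall i, i != j -> i != top n -> ts' i = ts i].
Proof.
have tj : j != top n by have := nm_top n (inr (out N)); rewrite -/j; lia.
elim: r l w ts => [|[[b|a]|] r IH] l w ts e1 e2.
- by exists ts; split; rewrite ?cats0 //; apply: run_exit; rewrite // mask_in ?inE // /heads e1.
- pose ts1 := upd (upd ts j (scons (bit X b) l, ecell \o nth None r)) (top n)
    (tp X (rcons w b) [::]).
  have [||ts' [r' o' h]] := IH (scons (bit X b) l) (rcons w b) ts1.
  + by rewrite /ts1 upd_ne // upd_eq.
  + by rewrite /ts1 upd_eq.
  exists ts'; split.
  + apply: run_loop0 (_ : run _ _ _ ts1 1) r' _; last by rewrite /=; lia.
      by rewrite mask_in ?inE // /heads e1.
    apply: run_to; first exact: run_act.
    by rewrite act2 // /ts1 mask_in ?inE ?eqxx // /heads e1 e2 (tp_put _ _ _ b).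
  + by rewrite o' cat_rcons.
  + by move=> i i1 i2; rewrite h // /ts1 !upd_ne.
- by exists ts; split; rewrite ?cats0 //; apply: run_exit; rewrite // mask_in ?inE // /heads e1.
- by exists ts; split; rewrite ?cats0 //; apply: run_exit; rewrite // mask_in ?inE // /heads e1.
Qed.

Lemma fp_output : fp X k.+1 (fun v => output (result v).2).
Proof.
apply: (@fp_observe _ read_output 20) => [//|n|n v ts bts].
  by have := nm_top n (inr (out N)); rewrite /=; lia.
set ts0 := sim _ _ _ _ _; set j := nm n (inr (out N)).
have tj : j < top n by exact: nm_top.
have nj : n < j by rewrite /j /nm; lia.
have sw : size (output (result v).2) <= tot v + 2 * poly e (tot v).
  apply: leq_trans (size_leading_bits _) _.
  have := size_tapes_replay (poly e (tot v)) (init N (inputs v)) (nth [::] v k) (inr (out N)).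
  rewrite -/(result v) /=; lia.
have [||ts' [r o' h]] := @run_read_output n ts0 (ecell \o nth None ((result v).2.2 (inr (out N))).1)
    ((result v).2.2 (inr (out N))).2 [::].
- by rewrite /ts0 sim_nm.
- rewrite /ts0 sim_out; last by right.
  by rewrite bts ?blank_reg // /top; lia.
rewrite -/(output _) cat0s in r o'.
exists (upd ts' (top n) (reg X (output (result v).2))); split.
- have := run_rewind o'; rewrite cats0 => r2; apply: run_seq0 r r2 _; lia.
- move=> i i_n; rewrite upd_ne; last by lia.
  by rewrite h; [rewrite /ts0 sim_out //; left|lia|lia].
- by rewrite upd_eq.
- move=> i i_n; rewrite upd_ne; last by lia.
  rewrite h; [rewrite /ts0 sim_out; last by right; lia|lia|lia].
  by apply: bts; move: i_n; rewrite /top; lia.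
- by lia.
Qed.

End Replay.

(** * From programs to machines *)

Lemma is_polynomial_poly e : is_polynomial (poly e).
Proof.
exists (e%:R *: ('X + 1) ^+ e)%R => n.
by rewrite hornerZ horner_exp !hornerE /poly GRing.natrM GRing.natrX
  -[n.+1%:R%R]GRing.natr1.
Qed.

Section Computations.
Variables (m : nat) (M : ntm m).

Lemma computation_inv (c : config M) w r d : computation c w r d ->
  match instr_at c with
  | Halt r' => [/\ w = [::], r = r' & d = c]
  | Step a => computation (apply c a) w r d
  | Guess a0 a1 =>
      if w is g :: w' then computation (apply c (if g then a1 else a0)) w' r d else False
  end.
Proof. by case=> {c w r d} [c r|c a w r d|c a0 a1 g w r d] ->. Qed.

Lemma computation_uniq (c : config M) w r d r' d' :
  computation c w r d -> computation c w r' d' -> r = r' /\ d = d'.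
Proof.
move=> h; elim: h => {c w r d} [c r|c a w r d|c a0 a1 g w r d] e.
- by move/computation_inv; rewrite e => -[_ -> ->].
- by move=> _ IH /computation_inv; rewrite e.
- by move=> _ IH /computation_inv; rewrite e.
Qed.

(** Path names are prefix-free; once all words of length [l] are names, no name of another length is
    possible. *)
Lemma computation_size (c : config M) l w r d :
  (forall w, size w = l -> exists r d, computation c w r d) ->
  computation c w r d -> size w = l.
Proof.
move=> + h; elim: h l => {c w r d} [c r|c a w r d|c a0 a1 g w r d] e.
- move=> l /(_ _ (size_nseq l false))[r' [d' /computation_inv]].
  by rewrite e => -[/(congr1 size)]; rewrite size_nseq.
- move=> _ IH l h; apply: IH => w' /h[r' [d' /computation_inv]].
  by rewrite e; exists r', d'.
- move=> _ IH [|l] h.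
    by have [//|r' [d' /computation_inv]] := h [::]; rewrite e.
  rewrite /= (IH l) // => w' sw.
  by have [|r' [d' /computation_inv]] := h (g :: w'); rewrite /= ?sw // e; exists r', d'.
Qed.

End Computations.

Section Tops.
Variable X : finType.

Definition init_tapes (v : seq str) : tapes X := fun i => reg X (nth [::] v i).

Lemma same_init m K outp vd c (v : m.-tuple str) :
  same (init (@machine X m K outp vd c) v).2 (init_tapes v).
Proof.
split=> [[i|j]|i mi].
- rewrite /init_tapes /tname /= (tnth_nth [::]) /den /reg /tp /=.
  by congr (_, _); apply: funext.
- by rewrite /init_tapes /tname /= nth_default ?size_tuple ?leq_addr.
- rewrite /init_tapes nth_default -?blank_reg // size_tuple.
  exact: leq_trans (leq_addr _ _) mi.
Qed.

Lemma machine_halts m K outp vd c (v : m.-tuple str) l t :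
  below (m + K) c ->
  (forall w, size w = l -> exists ts', run c (init_tapes v) w ts' t) ->
  halts_within t (init (@machine X m K outp vd c) v).
Proof.
move=> cK h; apply: (@lasts_halts _ _ _ _ l) => w /h[ts' /run_go r].
by have [mt' [_ hl _]] := go_machine outp vd cK (same_init outp vd c v) r; exists (None, mt').
Qed.

Lemma machine_computation m K outp vd c (v : m.-tuple str) w ts' t :
  below (m + K) c -> run c (init_tapes v) w ts' t ->
  exists2 mt', same mt' ts' &
    computation (init (@machine X m K outp vd c) v) w (vd (heads ts')) (None, mt').
Proof.
move=> cK /run_go r.
by have [mt' [hs _ hc]] := go_machine outp vd cK (same_init outp vd c v) r; exists mt'.
Qed.

Lemma fp_init m F : fp X m F -> exists c d n' e, [/\ m <= d < n', noflip c, below n' c &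
  forall v : m.-tuple str, exists2 ts',
    run c (init_tapes v) [::] ts' (poly e (tot v)) & ts' d = reg X (F v)].
Proof.
move=> hF; have [|||c [d [n' [e [mdn nf bl h]]]]] := hF m (iota 0 m).
- by rewrite size_iota.
- exact: iota_uniq.
- by apply/allP => i /=; rewrite mem_iota.
exists c, d, n', e; split=> // v; have [||ts' [r _ o _ _]] := h v (init_tapes v).
- apply: (@eq_from_nth _ blank); rewrite size_map size_iota ?size_map ?size_tuple // => i im.
  by rewrite !(nth_map 0) ?size_iota // nth_iota // (nth_map [::]) ?size_tuple.
- by move=> i mi; rewrite /init_tapes nth_default -?blank_reg // size_tuple.
by exists ts'.
Qed.

Lemma leading_bits_reg m (M : ntm m) (r : seq (option (bool + aux M))) s :
  nth None r = nth None [seq Some (inl b) | b <- s] -> leading_bits r = s.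
Proof.
elim: r s => [|a r IH] [|b s] e //.
- by have := congr1 (fun f => f 0) e.
- by have := congr1 (fun f => f 0) e => /= ->.
- have := congr1 (fun f => f 0) e => /= ->.
  by rewrite (IH s) //; apply: funext => i; apply: (congr1 (fun f => f i.+1) e).
Qed.

Lemma fp_FPt F : fp X 1 F -> FPt (fun x => F [:: x]).
Proof.
move=> /fp_init[c [d [n' [e [/andP[d0 dn] nf bl h]]]]].
(* Tape 0 is the input, so tape [d] is the work tape number [d.-1]. *)
have dn1 : d.-1 < n' by lia.
pose M := @machine X 1 n' (Ordinal dn1) (fun=> true) c.
have cK : below (1 + n') c by apply: belowW bl; lia.
exists M; split.
- exact: machine_noflip.
- exists (poly e); first exact: is_polynomial_poly.
  move=> v; apply: (@machine_halts _ _ _ _ _ _ 0) => // w /size0nil->.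
  by have [ts' r _] := h v; exists ts'.
move=> x; have [ts' r o] := h [tuple x].
have [mt' [hs _] hc] := machine_computation (Ordinal dn1) (fun=> true) cK r.
exists [::], true, (None, mt'); split=> //.
apply: leading_bits_reg; have := hs (inr (Ordinal dn1)).
rewrite /tname /= add1n prednK // o => /(congr1 snd) /= ->.
by [].
Qed.

Definition yes d (ra : nat -> option (bool + X)) : bool :=
  if ra d is Some (inl b) then b else false.

Lemma yes_reg ts d s : ts d = reg X s -> yes d (heads ts) = head false s.
Proof. by rewrite /yes /heads => ->; case: s. Qed.

Lemma fp_pred3 F : fp X 3 F -> polytime_pred3 (fun x y z => head false (F [:: x; y; z])).
Proof.
move=> /fp_init[c [d [n' [e [/andP[d0 dn] nf bl h]]]]].
have n0 : 0 < n' by lia.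
pose M := @machine X 3 n' (Ordinal n0) (yes d) c.
have cK : below (3 + n') c by apply: belowW bl; lia.
exists M; split.
- exact: machine_noflip.
- exists (poly e); first exact: is_polynomial_poly.
  move=> v; apply: (@machine_halts _ _ _ _ _ _ 0) => // w /size0nil->.
  by have [ts' r _] := h v; exists ts'.
move=> x y z; have [ts' r o] := h [tuple x; y; z].
have [mt' _] := machine_computation (Ordinal n0) (yes d) cK r.
rewrite (yes_reg o) => hc; split=> [hy|[w [c' hc']]].
  by rewrite hy in hc; exists [::], (None, mt').
have w0 : w = [::].
  apply: size0nil; apply: computation_size hc' => w' /size0nil->.
  by exists (head false (F [:: x; y; z])), (None, mt').
by rewrite w0 in hc'; have [] := computation_uniq hc hc'.
Qed.

(** The register [d] acts as a unary clock: one bit is guessed for each of its symbols. *)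
Lemma run_guesses d g (ts : tapes X) u s w z : d != g ->
  ts d = tp X u s -> ts g = tp X z [::] -> size w = size s ->
  run (While [:: d] (@busy X d) (Seq (Flip X g) (mv X d Right))) ts w
    (upd (upd ts d (tp X (u ++ s) [::])) g (tp X (z ++ w) [::])) (3 * size s).+1.
Proof.
move=> dg; elim: s u w z ts => [|a s IH] u [|b w] z ts //= ed eg.
  move=> _; have -> : upd (upd ts d (tp X (u ++ [::]) [::])) g (tp X (z ++ [::]) [::]) = ts.
    by upd_ext; rewrite cats0.
  by apply: run_exit; rewrite // /busy mask_in ?inE // /heads ed.
move=> [sw]; rewrite -[b :: w]cat1s.
apply: (run_loop (n1 := 2) (n2 := (3 * size s).+1)).
- by rewrite /busy mask_in ?inE // /heads ed.
- rewrite -[[:: b]]cats0; apply: (run_seq (n1 := 1) (n2 := 1)) => //.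
    exact: run_flip.
  exact: run_mvR.
- have ts1E : flip g b ts = upd ts g (tp X (rcons z b) [::]).
    by rewrite /flip act1 eg (tp_put _ _ _ b).
  have gd : g != d by rewrite eq_sym.
  apply: run_to; first apply: (IH (rcons u a) w (rcons z b)) => //.
  + by rewrite upd_eq ts1E upd_ne // ed toR_tp.
  + by rewrite upd_ne // ts1E upd_eq.
  by rewrite ts1E !cat_rcons; upd_ext.
- lia.
Qed.

(** All guessing takes place in one loop clocked by [U], and [F] is then evaluated without guesses
    on the input and the guessed word; this forces the common path length. *)
Lemma fp_balanced U F (p : nat -> nat) : fp X 1 U -> fp X 2 F ->
  (forall x, size (U [:: x]) = p (size x)) ->
  exists2 M : ntm 1, balanced p M &
    forall x w, size w = p (size x) ->
      accepts M [tuple x] w <-> head false (F [:: x; w]).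
Proof.
move=> hU hF sU.
have [|||c1 [d1 [g [e1 [/andP[d10 d1g] nf1 b1 h1]]]]] := hU 1 [:: 0] => //.
have [||/=|c2 [d2 [n' [e2 [/andP[gd2 d2n] nf2 b2 h2]]]]] := hF g.+1 [:: 0; g] => //.
- by rewrite /= inE; lia.
- by rewrite /=; lia.
pose loop := While [:: d1] (@busy X d1) (Seq (Flip X g) (mv X d1 Right)).
pose c := Seq c1 (Seq loop (Seq (rewind X g) c2)).
have n0 : 0 < n' by lia.
pose M := @machine X 1 n' (Ordinal n0) (yes d2) c.
have cK : below (1 + n') c.
  rewrite /= (belowW _ b1) ?(belowW _ b2) /=; lia.
pose E := e1 + (5 * e1 + 5) + poly_exp (e1 + 1) e2.
have hrun (x w : str) : size w = p (size x) -> exists2 ts',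
    run c (init_tapes [:: x]) w ts' (poly E (size x)) & ts' d2 = reg X (F [:: x; w]).
  move=> sw; have tx : tot [:: x] = size x by rewrite tot_cons /tot big_nil addn0.
  have [||t1 [r1 k1 o1 z1 s1]] := h1 [:: x] (init_tapes [:: x]) => //.
    by case=> // i _; rewrite /init_tapes /= nth_nil -blank_reg.
  rewrite tx in r1 s1; have sw' : size w = size (U [:: x]) by rewrite sU.
  have dg : d1 != g by lia.
  have tg : t1 g = tp X [::] [::] by rewrite z1 // blank_reg.
  have r2 := run_guesses dg o1 tg sw'.
  set t2 := upd _ _ _ in r2.
  have tg2 : t2 g = tp X w [::] by rewrite /t2 upd_eq.
  have r3 := run_rewind tg2; rewrite cats0 in r3.
  set t3 := upd _ _ _ in r3.
  have [||t4 [r4 k4 o4 z4 s4]] := h2 [:: x; w] t3.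
  - rewrite /= /t3 upd_eq /t2 !upd_ne ?k1 //; lia.
  - by move=> i gi; rewrite /t3 /t2 !upd_ne ?z1 //; lia.
  have tw : tot [:: x; w] <= poly (e1 + 1) (size x).
    rewrite tot_cons tot_cons /tot big_nil addn0 sw' addnC.
    apply: leq_trans (poly_add _ _ _); apply: leq_add => //.
    by apply: poly_id.
  (* The path name is split according to the phases: nothing for [c1], [w] for the loop, nothing
     afterwards. *)
  exists t4 => //; rewrite -[w]cats0 -[w]cat0s -catA.
  apply: (run_seq r1 (n2 := (5 * size w + 5) + poly e2 (tot [:: x; w]))).
    rewrite cats0 -[X in run _ _ X]cats0.
    apply: (run_seq r2 (run_seq0 r3 r4 (leqnn _))); lia.
  rewrite /E -(addnA e1); apply: leq_trans (poly_add _ _ _); rewrite leq_add2l.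
  apply: leq_trans (poly_add _ _ _); apply: leq_add; last first.
    by apply: leq_trans (poly_comp _ _ _); apply: leq_poly.
  rewrite sw'; apply: leq_trans (_ : 5 * poly e1 (size x) + 5 <= _); first lia.
  rewrite /poly; apply: leq_trans (_ : (5 * e1 + 5) * (size x).+1 ^ e1 <= _).
    have : 0 < (size x).+1 ^ e1 by rewrite expn_gt0.
    by move: (_ ^ e1) => P; nia.
  by rewrite leq_mul2l leq_pexp2l ?orbT //; lia.
have tupE (v : 1.-tuple str) : v = [tuple thead v].
  by case/tupleP: v => x v; rewrite tuple0; apply: val_inj.
have hcomp x w : size w = p (size x) -> exists mt',
    computation (init M [tuple x]) w (head false (F [:: x; w])) (None, mt').
  move=> /hrun[ts' r o]; exists 
    (sval (cid2 (machine_computation (Ordinal n0) (yes d2) cK (v := [tuple x]) r))).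
  by case: cid2 => mt' /=; rewrite (yes_reg o).
have hpath x w : path_name M [tuple x] w <-> size w = p (size x).
  split=> [[r [c' hc]]|/hcomp[mt' hc]]; last by exists (head false (F [:: x; w])), (None, mt').
  apply: computation_size hc => w' /hcomp[mt' hc'].
  by exists (head false (F [:: x; w'])), (None, mt').
exists M.
  split=> //; exists (poly E); first exact: is_polynomial_poly.
  move=> v; rewrite (tupE v); set x := thead v.
  have -> : \sum_(y <- [tuple x]) size y = size x by rewrite big_cons big_nil addn0.
  apply: (@machine_halts _ _ _ _ _ _ (p (size x))) => // w /hrun[ts' r _].
  by exists ts'.
move=> x w sw; have [mt' hc] := hcomp x w sw.
split=> [[c' /(computation_uniq hc)[]] //|hy].
by rewrite hy in hc; exists (None, mt').
Qed.

End Tops.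

(** * Ranks *)

Section Rank.
Variables (T : finType) (lt : rel T).
Hypotheses (lt_irr : irreflexive lt) (lt_tr : transitive lt)
  (lt_tot : forall a b, a != b -> lt a b || lt b a).

Definition rank (a : T) : nat := #|[set c | lt c a]|.

Lemma rank_lt_card a : rank a < #|T|.
Proof.
rewrite -cardsT; apply: proper_card; apply/properP; split; first exact: subsetT.
by exists a; rewrite // inE lt_irr.
Qed.

Lemma rank_lt a b : (rank a < rank b) = lt a b.
Proof.
have imp c d : lt c d -> rank c < rank d.
  move=> cd; apply: proper_card; apply/properP; split.
    by apply/subsetP => e; rewrite !inE => /lt_tr; apply.
  by exists c; rewrite inE ?lt_irr.
apply/idP/idP; last exact: imp.
move=> ab; have [e|/lt_tot/orP[//|/imp]] := eqVneq a b; first by rewrite e ltnn in ab.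
by move=> /(ltn_trans ab); rewrite ltnn.
Qed.

Lemma rank_inj : injective rank.
Proof.
move=> a b ab; apply/eqP; apply/negPn/negP => /lt_tot.
by rewrite -!rank_lt ab ltnn.
Qed.

Lemma rank_onto i : i < #|T| -> exists a, rank a = i.
Proof.
move=> iN; pose f a : 'I_#|T| := Ordinal (rank_lt_card a).
have fi : injective f by move=> a b /(congr1 val) /rank_inj.
have [g _ gK] : bijective f by apply: inj_card_bij; rewrite ?card_ord.
by exists (g (Ordinal iN)); have /(congr1 val) := gK (Ordinal iN).
Qed.

End Rank.

(** * Lexicographic successors as successors of ranks *)

Section Lexicographic.
Variable n : nat.
Notation word := (n.-tuple bool).
Implicit Types a b c : word.

Lemma lexlt_irr : irreflexive (@lexlt n).
Proof. by move=> a; rewrite /lexlt Order.POrderTheory.ltxx. Qed.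

Lemma lexlt_tr : transitive (@lexlt n).
Proof. by move=> a b c; exact: Order.POrderTheory.lt_trans. Qed.

Lemma lexlt_tot a b : a != b -> lexlt a b || lexlt b a.
Proof. by rewrite /lexlt; case: (Order.TotalTheory.ltgtP (a : n.-tuplelexi bool) b). Qed.

Lemma lexleE a b : lexle a b = ~~ lexlt b a.
Proof. by rewrite /lexlt /lexle Order.TotalTheory.leNgt. Qed.

Definition rk : word -> nat := rank (@lexlt n).

Lemma rk_lt a b : (rk a < rk b) = lexlt a b.
Proof. exact: rank_lt lexlt_irr lexlt_tr lexlt_tot _ _. Qed.

Lemma rk_le a b : (rk a <= rk b) = lexle a b.
Proof. by rewrite lexleE -rk_lt leqNgt. Qed.

Lemma rk_inj : injective rk.
Proof. exact: rank_inj lexlt_irr lexlt_tr lexlt_tot. Qed.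

Lemma rk_bound a : rk a < 2 ^ n.
Proof. by have := rank_lt_card lexlt_irr a; rewrite card_tuple card_bool. Qed.

Lemma rk_onto i : i < 2 ^ n -> exists a, rk a = i.
Proof.
move=> h; apply: (rank_onto lexlt_irr lexlt_tr lexlt_tot).
by rewrite card_tuple card_bool.
Qed.

(** Ranks leave no gaps: if [rk b] exceeded [(rk a).+1], a word with the latter rank would lie
    strictly between. *)
Lemma lexsuccE a b : lexsucc a b = (rk b == (rk a).+1).
Proof.
rewrite /lexsucc -rk_lt; apply/andP/eqP => [[ab /forallP h]|eb].
  apply/eqP; rewrite eqn_leq ab andbT leqNgt; apply/negP => lt.
  have [c ec] : exists c, rk c = (rk a).+1.
    by apply: rk_onto; apply: ltn_trans lt (rk_bound b).
  by have := h c; rewrite -!rk_lt ec ltnSn lt.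
split; first by rewrite eb.
by apply/forallP => c; rewrite -!rk_lt eb; lia.
Qed.

Lemma lexi_zeros_le (s : n.-tuple bool) :
  (Order.le (nseq n false : seqlexi bool) (s : seqlexi bool)).
Proof.
case: s => s /= /eqP <-; elim: s => [|b s IH] //=.
by rewrite Order.SeqLexiOrder.lexi_cons IH; case: b.
Qed.

Lemma lexi_ones_ge (s : n.-tuple bool) :
  (Order.le (s : seqlexi bool) (nseq n true : seqlexi bool)).
Proof.
case: s => s /= /eqP <-; elim: s => [|b s IH] //=.
by rewrite Order.SeqLexiOrder.lexi_cons IH; case: b.
Qed.

Lemma rk_zeros : rk zeros = 0.
Proof.
apply/eqP; rewrite cards_eq0; apply/eqP/setP => c; rewrite !inE.
by apply/negbTE; rewrite -lexleE; exact: lexi_zeros_le.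
Qed.

Lemma rk_ones : rk ones = (2 ^ n).-1.
Proof.
have [|c ec] := @rk_onto (2 ^ n).-1; first by rewrite prednK // expn_gt0.
have := rk_bound ones; have : rk c <= rk ones by rewrite rk_le; exact: lexi_ones_ge.
by rewrite ec; lia.
Qed.

Lemma circsuccE a b :
  circsucc a b = (rk b == if (rk a).+1 < 2 ^ n then (rk a).+1 else 0).
Proof.
rewrite /circsucc lexsuccE -!(inj_eq rk_inj) rk_ones rk_zeros.
by have := rk_bound a; have := rk_bound b; case: ifP; lia.
Qed.

(** A word is sent to the word whose lexicographic rank equals its rank under [K]; so only the order
    of the keys matters, and gaps between them do no harm. *)
Lemma perm_of_key (K : word -> nat) : injective K ->
  exists h : {perm word}, forall a b, lexlt (h a) (h b) = (K a < K b).
Proof.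
move=> Ki; pose lt a b := K a < K b.
have irr : irreflexive lt by move=> a; rewrite /lt ltnn.
have tr : transitive lt by move=> a b c; exact: ltn_trans.
have tot a b : a != b -> lt a b || lt b a by rewrite -(inj_eq Ki) /lt; lia.
have ex a : exists b, rk b == rank lt a.
  have [|b eb] := @rk_onto (rank lt a); last by exists b; apply/eqP.
  by have := rank_lt_card irr a; rewrite card_tuple card_bool.
pose h a := xchoose (ex a).
have hE a : rk (h a) = rank lt a by exact/eqP/(xchooseP (ex a)).
have hi : injective h.
  by move=> a b ab; apply: (rank_inj irr tr tot); rewrite -!hE ab.
by exists (perm hi) => a b; rewrite -rk_lt !permE !hE rank_lt.
Qed.

End Lexicographic.

(** * The index of an element in the cluster *)

Lemma the_eq (T : finType) (P : pred T) z :
  P z -> (forall w, P w -> w = z) -> the P = Some z.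
Proof.
move=> Pz Pu; rewrite /the; case: pickP => [w /andP[/Pu->] //|/(_ z)].
rewrite Pz => /negP[]; apply/forallP => w; apply/implyP => /Pu->; exact: eqxx.
Qed.

(* What the construction needs to know about a cluster: its elements are
   numbered from [0], at [l], on, up to [u], consecutively for [R]. *)
Record indexed n (R : rel (n.-tuple bool)) (A : {set n.-tuple bool})
    (l u : n.-tuple bool) (idx : n.-tuple bool -> nat) : Prop := Indexed {
  idx_l : l \in A;
  idx_u : u \in A;
  idx_l0 : idx l = 0;
  idx_le y : y \in A -> idx y <= idx u;
  idx_inj : {in A &, injective idx};
  idx_succ y y' : y \in A -> y != u -> R y y' = (y' \in A) && (idx y' == (idx y).+1);
  idx_next y : y \in A -> y != u -> exists2 y', y' \in A & idx y' = (idx y).+1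
}.

Section Clusters.
Variables (n : nat) (R : rel (n.-tuple bool)) (h : {perm n.-tuple bool}).
Variable A : {set n.-tuple bool}.

Let rh_inj : injective (fun y => rk (h y)).
Proof. by move=> y y' /rk_inj /perm_inj. Qed.

Let rh_onto i : i < 2 ^ n -> exists y, rk (h y) = i.
Proof. by move=> /(@rk_onto n)[a <-]; exists (h^-1 a)%g; rewrite permKV. Qed.

(** The index is the distance in rank from [l]. [R] is described only for [y != u], because in the
    circular model the successor of [u] may arise by wrapping around. *)
Lemma interval_indexed l u :
  (forall y, (y \in A) = (rk (h l) <= rk (h y) <= rk (h u))) -> A != set0 ->
  (forall y y', y \in A -> y != u -> R y y' = (rk (h y') == (rk (h y)).+1)) ->
  indexed R A l u (fun y => rk (h y) - rk (h l)).
Proof.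
move=> AE /set0Pn[y0]; rewrite AE => /andP[ly yu] RE.
have lu : rk (h l) <= rk (h u) by exact: leq_trans yu.
have yn y : y \in A -> y != u -> rk (h y) < rk (h u).
  by rewrite AE -(inj_eq rh_inj); lia.
split.
- by rewrite AE leqnn.
- by rewrite AE leqnn lu.
- exact: subnn.
- by move=> y; rewrite AE; lia.
- by move=> y y'; rewrite !AE => ? ? ?; apply: rh_inj; lia.
- by move=> y y' yA nu; rewrite RE // AE; have := yn y yA nu; move: yA; rewrite AE; lia.
- move=> y yA nu; have lt := yn y yA nu.
  have [|y' e] := @rh_onto (rk (h y)).+1; first exact: leq_ltn_trans lt (rk_bound _).
  by exists y'; rewrite ?AE e; move: yA; rewrite AE; lia.
Qed.

(** An element below [u] has its rank successor inside the interval. [R] is used only between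
    members of [A], so a wrap-around that leaves the cluster is harmless. *)
Lemma interval_greatest l u :
  (forall y, (y \in A) = (rk (h l) <= rk (h y) <= rk (h u))) -> A != set0 ->
  (forall y y', y \in A -> y' \in A -> R y y' = (rk (h y') == (rk (h y)).+1)) ->
  the [pred z in A | [forall w in A, ~~ R z w]] = Some u.
Proof.
move=> AE /set0Pn[y0]; rewrite AE => /andP[ly yu] RE.
have lu : rk (h l) <= rk (h u) by exact: leq_trans yu.
have uA : u \in A by rewrite AE lu leqnn.
apply: the_eq => [|z /= /andP[zA /forallP hz]].
  rewrite /= uA; apply/forallP => w; apply/implyP => wA; rewrite RE //.
  by move: wA; rewrite AE; lia.
apply: rh_inj; apply/eqP; move: (zA); rewrite AE eqn_leq => /andP[lz ->] /=.
rewrite leqNgt; apply/negP => lt.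
have [|y e] := @rh_onto (rk (h z)).+1; first exact: leq_ltn_trans lt (rk_bound _).
have yA : y \in A by rewrite AE e lt leqW.
by have := hz y; rewrite yA RE // e eqxx.
Qed.

Lemma interval_least l u :
  (forall y, (y \in A) = (rk (h l) <= rk (h y) <= rk (h u))) -> A != set0 ->
  (forall y y', y \in A -> y' \in A -> R y y' = (rk (h y') == (rk (h y)).+1)) ->
  the [pred z in A | [forall w in A, ~~ R w z]] = Some l.
Proof.
move=> AE /set0Pn[y0]; rewrite AE => /andP[ly yu] RE.
have lu : rk (h l) <= rk (h u) by exact: leq_trans yu.
have lA : l \in A by rewrite AE lu leqnn.
apply: the_eq => [|z /= /andP[zA /forallP hz]].
  rewrite /= lA; apply/forallP => w; apply/implyP => wA; rewrite RE //.
  by move: wA; rewrite AE; lia.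
apply: rh_inj; apply/eqP; move: (zA); rewrite AE eqn_leq => /andP[lz zu].
rewrite lz andbT leqNgt; apply/negP => lt.
have [|y e] := @rh_onto (rk (h z)).-1; first by have := rk_bound (h z); lia.
have yA : y \in A by rewrite AE e; lia.
by have := hz y; rewrite yA RE // e; lia.
Qed.

(** The cycle is cut open between [u] and its successor [l]; the index is [rk (h y) - rk (h u) - 1]
    modulo [2 ^ n], the number of steps from [l]. *)
Lemma full_indexed l u : A = setT ->
  (forall y y', R y y' = circsucc (h y) (h y')) -> R u l ->
  exists idx, indexed R A l u idx.
Proof.
move=> AT RE; rewrite RE circsuccE => /eqP el.
have hb y := rk_bound (h y).
exists (fun y => if rk (h y) <= rk (h u) then rk (h y) + 2 ^ n - (rk (h u)).+1
                 else rk (h y) - (rk (h u)).+1); split; rewrite ?AT ?inE //.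
- by have := hb u; rewrite el; case: ifP; case: ifP; lia.
- by move=> y _; have := hb y; have := hb u; rewrite leqnn; case: ifP; lia.
- move=> y y' _ _ e; apply: rh_inj; move: e; have := hb y; have := hb y'; have := hb u.
  by case: ifP; case: ifP; lia.
- move=> y y' _ nu; rewrite RE circsuccE inE /=.
  have := hb y; have := hb y'; have := hb u; move: nu; rewrite -(inj_eq rh_inj).
  by do 3 case: ifP; lia.
- move=> y _ nu; have [|y' e] := @rh_onto (if (rk (h y)).+1 < 2 ^ n then (rk (h y)).+1 else 0).
    by case: ifP; rewrite ?expn_gt0.
  exists y'; first by rewrite inE.
  rewrite e; have := hb y; have := hb u; move: nu; rewrite -(inj_eq rh_inj).
  by do 3 case: ifP; lia.
Qed.

End Clusters.

(** * The new order *)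

(* Strings as binary counters, least significant bit first. *)
Fixpoint lval (s : str) : nat := if s is b :: s' then b + 2 * lval s' else 0.

(** With the least significant bit first, the carry runs in the reading direction, so three states
    suffice to decide this relation. *)
Fixpoint inc (a b : str) : bool :=
  match a, b with
  | false :: a', true :: b' => a' == b'
  | true :: a', false :: b' => inc a' b'
  | _, _ => false
  end.

Lemma lval_inj a b : size a = size b -> lval a = lval b -> a = b.
Proof.
elim: a b => [|x a IH] [|y b] //= [sab] e.
have [-> e'] : x = y /\ lval a = lval b by case: x y e => [] []; split=> //; lia.
by rewrite (IH b).
Qed.

Lemma incE a b : size a = size b -> inc a b = (lval b == (lval a).+1).
Proof.
elim: a b => [|x a IH] [|y b] //= [sab].
case: x y => [] [] /=; rewrite ?IH //; try lia.
by apply/eqP/eqP => [->|e]; [lia|apply: lval_inj; lia].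
Qed.

Lemma lval_ones n : lval (nseq n true) = (2 ^ n).-1.
Proof. by elim: n => //= n ->; rewrite expnS; have := expn_gt0 2 n; lia. Qed.

Lemma lval_zeros n : lval (nseq n false) = 0.
Proof. by elim: n => //= n ->. Qed.

Lemma lval_lt s : lval s < 2 ^ size s.
Proof. by elim: s => //= b s IH; rewrite expnS; case: b; lia. Qed.

Lemma inc_exists s : s != nseq (size s) true -> exists2 s', size s' = size s & inc s s'.
Proof.
elim: s => //= -[] s IH; last by exists (true :: s) => //=.
rewrite eqseq_cons /= => /IH[s' ss i]; exists (false :: s') => //=; by rewrite ss.
Qed.

Lemma word_split p T (r : str) : size r = (p + T).+2 ->
  exists c1 c2 y z, [/\ r = [:: c1, c2 & y ++ z], size y = p & size z = T].
Proof.
case: r => [|c1 [|c2 s]] //= [ss]; exists c1, c2, (take p s), (drop p s).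
rewrite cat_take_drop size_drop size_take ss; split=> //; last lia.
by case: ifP => //; lia.
Qed.

Section Edges.
(* [A] says that the path [y] of the original machine accepts, [good] that the
   certificate [z] is correct, and then [lo z] and [hi z] are the ends of the
   cluster. *)
Variables (p : nat) (A good : pred str) (lo hi : str -> str) (pr : rel str).

Definition inside (s : str) : bool := A (take p s) && good (drop p s).

Definition cluster (r : str) : bool :=
  (take 2 r == [:: false; true]) && inside (drop 2 r).

(* For each [s] the strings [00s, 01s, 10s, 11s] follow one another, except that
   those in the cluster are moved between [10s] and [11s] where [s] consists of
   the least element of the cluster and of the correct certificate. *)
Definition edge (r r' : str) : bool :=
  let c := take 2 r in let c' := take 2 r' in
  let s := drop 2 r in let s' := drop 2 r' in
  let y := take p s in let z := drop p s in
  if c == [:: false; false] then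
    (s == s') && (if inside s then c' == [:: true; false] else c' == [:: false; true])
  else if c == [:: false; true] then
    if inside s then
      (z == drop p s') &&
      (if y == hi z then (c' == [:: true; true]) && (take p s' == lo z)
       else (c' == [:: false; true]) && pr y (take p s'))
    else (s == s') && (c' == [:: true; false])
  else if c == [:: true; false] then
    (s == s') && (if inside s && (y == lo z) then c' == [:: false; true]
                  else c' == [:: true; true])
  else (c' == [:: false; false]) && inc s s'.

Variables (T : nat) (z0 l u : str) (idx : str -> nat).
Hypotheses (sl : size l = p) (su : size u = p) (sz0 : size z0 = T).
(** Assumed only for an accepting [y], so that the case without accepting paths is included, with
    arbitrary [z0], [l], [u] of the right lengths. *)
Hypothesis goodP : forall y z, size y = p -> size z = T -> A y -> good z ->
  [/\ z = z0, lo z = l, hi z = u, A l & A u].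
Hypothesis l0 : idx l = 0.
Hypothesis idx_le : forall y, size y = p -> A y -> idx y <= idx u.
Hypothesis idx_inj : forall y y', size y = p -> size y' = p -> A y -> A y' ->
  idx y = idx y' -> y = y'.
Hypothesis idx_succ : forall y y', size y = p -> size y' = p -> A y -> y != u ->
  pr y y' = A y' && (idx y' == (idx y).+1).
Hypothesis idx_next : forall y, size y = p -> A y -> y != u ->
  exists y', [/\ size y' = p, A y' & idx y' = (idx y).+1].

Let q := p + T.
(** The number of offsets reserved for each [s]: 0, 1, 2 for [00s], [01s], [10s], then [idx u + 1]
    places for the cluster, from 3 to [B - 2], and [B - 1] for [11s]. *)
Let B := idx u + 5.

Definition offset (c1 c2 : bool) : nat :=
  if c1 then (if c2 then B.-1 else 2) else c2.

(** Block number times block size plus offset; cluster strings are counted in the block of [l ++ z0]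
    instead of their own. Offset 1 of their own block and the middle of all other blocks remain
    vacant. *)
Definition key (r : str) : nat :=
  let s := drop 2 r in
  if cluster r then lval (l ++ z0) * B + (3 + idx (take p s))
  else lval s * B + offset (nth false r 0) (nth false r 1).

Lemma insideE y z : size y = p -> inside (y ++ z) = A y && good z.
Proof. by move=> sy; rewrite /inside take_size_cat ?drop_size_cat. Qed.

Lemma keyE c1 c2 y z : size y = p -> key [:: c1, c2 & y ++ z] =
  if [&& ~~ c1, c2, A y & good z] then lval (l ++ z0) * B + (3 + idx y)
  else lval (y ++ z) * B + offset c1 c2.
Proof.
move=> sy; rewrite /key /cluster /= !take0 drop0 insideE // take_size_cat //.
by case: c1; case: c2.
Qed.

Lemma base_inj v v' o o' : o < B -> o' < B -> v * B + o = v' * B + o' -> v = v' /\ o = o'.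
Proof.
move=> oB oB' e; have B0 : 0 < B by rewrite /B; lia.
have := congr1 (divn^~ B) e; rewrite !divnMDl // !divn_small // !addn0 => ev.
by split=> //; move: e; rewrite ev => /addnI.
Qed.

Lemma offset_lt c1 c2 : offset c1 c2 < B.
Proof. by rewrite /offset /B; case: c1; case: c2; lia. Qed.

Lemma lval_cat_inj y z y' z' : size y = p -> size y' = p -> size z = T -> size z' = T ->
  lval (y ++ z) = lval (y' ++ z') -> y = y' /\ z = z'.
Proof.
move=> sy sy' sz sz' /lval_inj; rewrite !size_cat sy sy' sz sz' => /(_ erefl) /eqP.
by rewrite eqseq_cat ?sy ?sy' // => /andP[/eqP-> /eqP->].
Qed.

(** Cluster offsets lie strictly between 2 and [B - 1], so they never meet those of other strings;
    within the cluster the certificate is unique and [idx] separates the paths. *)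
Lemma key_inj r r' : size r = q.+2 -> size r' = q.+2 -> key r = key r' -> r = r'.
Proof.
move=> /word_split[c1 [c2 [y [z [-> sy sz]]]]] /word_split[d1 [d2 [y' [z' [-> sy' sz']]]]].
rewrite !keyE //; case: ifP => [/and4P[n1 n2 Ay gz]|h]; case: ifP => [/and4P[n1' n2' Ay' gz']|h'].
- have [-> _ _ _ _] := goodP sy sz Ay gz; have [-> _ _ _ _] := goodP sy' sz' Ay' gz'.
  move=> /addnI /addnI /idx_inj -> //.
  by case: c1 c2 d1 d2 n1 n2 n1' n2' => [] [] [] [].
- have := idx_le sy Ay => le; move/base_inj => -[]; rewrite ?offset_lt /B //; first lia.
  by rewrite /offset /B; case: d1 {h'}; case: d2; lia.
- have := idx_le sy' Ay' => le; move/base_inj => -[]; rewrite ?offset_lt /B //; first lia.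
  by rewrite /offset /B; case: c1 {h}; case: c2; lia.
- move/base_inj => -[]; rewrite ?offset_lt // => /lval_cat_inj[] // -> ->.
  by rewrite /offset /B; case: c1 {h} => [] []; case: c2; case: d1 {h'}; case: d2 => //; lia.
Qed.

Definition next (a b : str) : Prop :=
  key a < key b /\ forall c, size c = q.+2 -> ~~ (key a < key c < key b).

Lemma next_S a b : key b = (key a).+1 -> next a b.
Proof. by move=> e; split=> [|c _]; lia. Qed.

Lemma eq_pair (a b c d : bool) : ([:: a; b] == [:: c; d]) = (a == c) && (b == d).
Proof. by rewrite !eqseq_cons eqxx andbT. Qed.

Ltac edge_words := rewrite /edge /= !take0 !drop0 ?take_size_cat // ?drop_size_cat //
  ?insideE //.

Lemma edge_next a b : size a = q.+2 -> size b = q.+2 -> edge a b -> next a b.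
Proof.
move=> /word_split[c1 [c2 [y [z [-> sy sz]]]]] /word_split[d1 [d2 [y' [z' [-> sy' sz']]]]].
edge_words.
case: c1 c2 => [] [] /=.
- case/andP=> /eqP[-> ->]; rewrite incE ?size_cat ?sy ?sy' ?sz ?sz' // => /eqP e.
  apply: next_S; rewrite !keyE //= e /offset /B; nia.
- case/andP=> /eqP/(congr1 (fun s => (take p s, drop p s))).
  rewrite !take_size_cat // !drop_size_cat // => -[<- <-].
  case: ifP => [/andP[/andP[Ay gz] /eqP yl] /eqP[-> ->]|h /eqP[-> ->]].
    have [ez el eu Al Au] := goodP sy sz Ay gz.
    rewrite el in yl; subst y z; apply: next_S.
    by rewrite !keyE //= Ay gz l0 /offset /=; lia.
  (* No key lies between [10s] and [11s] here: a cluster string in this block would force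
     [y ++ z = l ++ z0], against [h]. *)
  rewrite /next !keyE //= /offset /B; split; first lia.
  move=> c /word_split[e1 [e2 [y2 [z2 [-> sy2 sz2]]]]].
  rewrite keyE //; case: ifP => [/and4P[n1 n2 Ay2 gz2]|_].
    have [ez el eu Al Au] := goodP sy2 sz2 Ay2 gz2; have le := idx_le sy2 Ay2.
    apply/negP => /andP[lt1 lt2].
    have ev : lval (y ++ z) = lval (l ++ z0) by move: lt1 lt2; rewrite /B; nia.
    have [yl zz] := lval_cat_inj sy sl sz sz0 ev.
    by move: h; rewrite yl zz -ez el eqxx Al gz2.
  apply/negP => /andP[lt1 lt2].
  have ev : lval (y ++ z) = lval (y2 ++ z2).
    by have := offset_lt e1 e2; move: lt1 lt2; rewrite /B; nia.
  move: lt1 lt2; rewrite ev /offset; case: e1; case: e2; rewrite /B; lia.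
- case: ifP => [/andP[Ay gz]|h]; last first.
    case/andP=> /eqP/(congr1 (fun s => (take p s, drop p s))).
    rewrite !take_size_cat // !drop_size_cat // => -[<- <-] /eqP[-> ->].
    by apply: next_S; rewrite !keyE //= h /offset; lia.
  case/andP=> /eqP <-; have [ez el eu Al Au] := goodP sy sz Ay gz.
  (* At [u] the offset is [B - 2], directly before the [11] string of the insertion block. *)
  rewrite el eu; case: eqP => [->|/eqP yu] /andP[/eqP[-> ->]].
    move=> /eqP->; apply: next_S; rewrite !keyE //= Au gz ez /offset /B /=; nia.
  rewrite idx_succ // => /andP[Ay' /eqP e]; apply: next_S.
  by rewrite !keyE //= Ay gz Ay' e /=; lia.
case/andP=> /eqP/(congr1 (fun s => (take p s, drop p s))).
rewrite !take_size_cat // !drop_size_cat // => -[<- <-].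
case: ifP => [/andP[Ay gz]|h] /eqP[-> ->]; last first.
  by apply: next_S; rewrite !keyE //= h /offset; lia.
(* Offset 1 of this block is vacant: its only candidate [01s] belongs to the cluster, and cluster
   offsets start at 3. *)
rewrite /next !keyE //= /offset /B; split; first lia.
move=> c /word_split[e1 [e2 [y2 [z2 [-> sy2 sz2]]]]].
rewrite keyE //; case: ifP => [/and4P[n1 n2 Ay2 gz2]|h].
  have le := idx_le sy2 Ay2; apply/negP => /andP[lt1 lt2].
  have ev : lval (y ++ z) = lval (l ++ z0) by move: lt1 lt2; rewrite /B; nia.
  by move: lt1 lt2; rewrite ev; lia.
apply/negP => /andP[lt1 lt2].
have ev : lval (y ++ z) = lval (y2 ++ z2).
  by have := offset_lt e1 e2; move: lt1 lt2; rewrite /B; nia.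
have [ey ez] := lval_cat_inj sy sy2 sz sz2 ev.
by move: lt1 lt2 h; rewrite ev -ey -ez Ay gz /offset; case: e1; case: e2; rewrite /B //; lia.
Qed.

(** With an edge leaving every word but the last, the converse of [edge_next] follows without a
    second case analysis. *)
Lemma edge_exists a : size a = q.+2 -> a != nseq q.+2 true ->
  exists2 b, size b = q.+2 & edge a b.
Proof.
move=> /word_split[c1 [c2 [y [z [-> sy sz]]]]].
have sq (y' z' : str) d1 d2 : size y' = p -> size z' = T -> size [:: d1, d2 & y' ++ z'] = q.+2.
  by move=> /= s1 s2; rewrite size_cat s1 s2.
have E d1 d2 (y' z' : str) : size y' = p -> size z' = T ->
    edge [:: c1, c2 & y ++ z] [:: d1, d2 & y' ++ z'] ->
    exists2 b, size b = q.+2 & edge [:: c1, c2 & y ++ z] b.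
  by move=> sy' sz' e; exists [:: d1, d2 & y' ++ z']; rewrite ?sq.
case: c1 c2 E => [] [] E; rewrite /= ?eqseq_cons /= => ne.
- have [|s' ss' i] := @inc_exists (y ++ z).
    by rewrite size_cat sy sz.
  have sq' : size s' = q by rewrite ss' size_cat sy sz.
  apply: (E false false (take p s') (drop p s')).
  + by rewrite size_takel // sq' /q; lia.
  + by rewrite size_drop sq' /q; lia.
  by rewrite /edge /= !take0 !drop0 cat_take_drop i.
- case h: (A y && good z && (y == lo z));
    [apply: (E false true y z)|apply: (E true true y z)] => //; by edge_words; rewrite h !eqxx.
- case h: (A y && good z); last first.
    by apply: (E true false y z) => //; edge_words; rewrite h !eqxx.
  case/andP: (h) => Ay gz; have [ez el eu Al Au] := goodP sy sz Ay gz.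
  case: (eqVneq y u) => yu.
    by apply: (E true true l z) => //; edge_words; rewrite h eqxx el eu yu !eqxx.
  have [y' [sy' Ay' ei]] := idx_next sy Ay yu.
  apply: (E false true y' z) => //; edge_words; rewrite h eqxx eu (negPf yu) /=.
  by rewrite idx_succ // Ay' ei !eqxx.
- case h: (A y && good z); [apply: (E true false y z)|apply: (E false true y z)] => //;
    by edge_words; rewrite h !eqxx.
Qed.

Lemma key_max c : size c = q.+2 -> key c <= key (nseq q.+2 true).
Proof.
have -> : nseq q.+2 true = [:: true, true & nseq p true ++ nseq T true] by rewrite -nseqD.
move=> /word_split[c1 [c2 [y [z [-> sy sz]]]]]; rewrite !keyE ?size_nseq //=.
rewrite -nseqD lval_ones /=.
have hb (y' z' : str) : size y' = p -> size z' = T -> lval (y' ++ z') <= (2 ^ (p + T)).-1.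
  by move=> s1 s2; have := lval_lt (y' ++ z'); rewrite size_cat s1 s2; lia.
case: ifP => [/and4P[n1 n2 Ay gz]|_].
  have := hb _ _ sl sz0; have := idx_le sy Ay; rewrite /B; nia.
have := hb _ _ sy sz; have := offset_lt c1 c2; rewrite /B; nia.
Qed.

Lemma key_min : key (nseq q.+2 false) = 0.
Proof. by rewrite /key /cluster /= drop0 lval_zeros. Qed.

(** Since [key] is injective, [next] determines its target; the edge leaving [a] must therefore lead
    to [b]. From the all-one word [next] is excluded by [key_max]. *)
Lemma edgeP a b : size a = q.+2 -> size b = q.+2 -> edge a b <-> next a b.
Proof.
move=> sa sb; split; first exact: edge_next.
move=> [lt nb]; have [aT|aT] := eqVneq a (nseq q.+2 true).
  by have := key_max sb; rewrite -aT leqNgt lt.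
have [b' sb' e] := edge_exists sa aT; have [lt' nb'] := edge_next sa sb' e.
suff -> : b = b' by [].
by apply: key_inj => //; have := nb _ sb'; have := nb' _ sb; lia.
Qed.

(** The cluster fills exactly the offsets 3 to [B - 2] of one block. The element [r'] ensures that
    [l], [u], [z0] are the genuine ends and certificate. *)
Lemma cluster_key r : size r = q.+2 -> (exists2 r', size r' = q.+2 & cluster r') ->
  cluster r = (key [:: false, true & l ++ z0] <= key r <= key [:: false, true & u ++ z0]).
Proof.
move=> + [r' /word_split[d1 [d2 [y' [z' [-> sy' sz']]]]]].
move=> /word_split[c1 [c2 [y [z [-> sy sz]]]]].
rewrite /cluster /= !take0 !drop0 !insideE // => /andP[_ /andP[Ay' gz']].
have [ez' el' eu' Al Au] := goodP sy' sz' Ay' gz'; subst z'.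
rewrite !keyE // Al Au gz' l0 /= eq_pair.
case: ifP => [/and4P[n1 n2 Ay gz]|h].
  rewrite Ay gz; have := idx_le sy Ay; case: c1 n1 => // _; case: c2 n2 => // _ le.
  by rewrite leq_add2l addn0 leq_addr leq_add2l leq_add2l le.
have -> : (c1 == false) && (c2 == true) && (A y && good z) = false.
  by move: h; case: c1; case: c2.
symmetry; apply/negbTE/negP => /andP[le1 le2].
have ev : lval (y ++ z) = lval (l ++ z0).
  by have := offset_lt c1 c2; move: le1 le2; rewrite /B; nia.
by move: le1 le2; rewrite ev /offset /B; case: c1 {h}; case: c2; lia.
Qed.

Theorem edge_perm : exists h : {perm q.+2.-tuple bool},
  [/\ h zeros = zeros, h ones = ones,
      forall a b : q.+2.-tuple bool, edge a b <-> lexsucc (h a) (h b) &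
      forall D : {set q.+2.-tuple bool}, (forall r, (r \in D) = cluster r) ->
        D != set0 -> contiguous h D].
Proof.
have Ki : injective (fun r : q.+2.-tuple bool => key r).
  by move=> r r' /key_inj e; apply: val_inj; apply: e; rewrite size_tuple.
have [h hE] := perm_of_key Ki; exists h; split.
(* Otherwise the word mapped to [zeros] would have a key below that of [zeros], which is 0. *)
- apply/eqP/negPn/negP => /lexlt_tot; rewrite -!rk_lt rk_zeros ltn0 /= => lt.
  have := hE ((h^-1)%g zeros) zeros; rewrite permKV -rk_lt rk_zeros lt.
  by rewrite [key zeros]key_min.
- apply/eqP/negPn/negP => /lexlt_tot.
  have := rk_bound (h ones); rewrite -!rk_lt rk_ones => lt1 lt2.
  have := hE ones ((h^-1)%g ones); rewrite permKV -rk_lt rk_ones.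
  have := @key_max ((h^-1)%g ones) (size_tuple _).
  have -> : rk (h ones) < (2 ^ q.+2).-1 by move: (2 ^ _) lt1 lt2; lia.
  by rewrite leqNgt => /negPf->.
- move=> a b; rewrite edgeP ?size_tuple // /next /lexsucc hE; split.
    case=> -> nb; apply/forallP => c; have := nb ((h^-1)%g c) (size_tuple _).
    by rewrite -!hE permKV.
  case/andP=> -> /forallP nb; split=> // c sc.
  by have := nb (h (Tuple (introT eqP sc))); rewrite !hE.
- move=> D DE /set0Pn[r0]; rewrite DE => cr0.
  have ex : exists2 r', size r' = q.+2 & cluster r' by exists r0; rewrite ?size_tuple.
  have s1 : size [:: false, true & l ++ z0] == q.+2 by rewrite /= size_cat sl sz0.
  have s2 : size [:: false, true & u ++ z0] == q.+2 by rewrite /= size_cat su sz0.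
  exists (Tuple s1), (Tuple s2); apply/setP => r.
  by rewrite DE inE !lexleE !hE -!leqNgt cluster_key ?size_tuple.
Qed.

End Edges.

(** * Some polynomial-time functions *)

Section Runs.
Variables (step : option bool -> seq (option bool) -> option bool * option bool)
          (fin : option bool -> option bool).

Lemma reads_behead v n : reads (map behead v) n = reads v n.+1.
Proof. by rewrite /reads -map_comp; apply: eq_map; case=> //=; case: n. Qed.

(** [transit] recurses on the last step; this form consumes the first symbols and fits inductions on
    the strings. *)
Fixpoint runs (q : option bool) (v : seq str) n : option bool :=
  if n is n'.+1 then runs (step q (reads v 0)).1 (map behead v) n' else q.

Lemma runsS q v n : runs q v n.+1 = (step (runs q v n) (reads v n)).1.
Proof. by elim: n q v => // n IH q v; rewrite -reads_behead -IH. Qed.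

Lemma transit_runs v n : (transit step v n).1 = runs None v n.
Proof.
elim: n => // n IH; rewrite runsS -IH /=.
by case: transit => q o /=; case: step.
Qed.

Lemma transit_mute v n : (forall q r, (step q r).2 = None) -> (transit step v n).2 = [::].
Proof.
move=> mute; elim: n => //= n; case: transit => q o /= ->.
by have := mute q (reads v n); case: step => q' e /= ->.
Qed.

Lemma transduce_mute v : (forall q r, (step q r).2 = None) ->
  transduce step fin v = seq_of_opt (fin (runs None v (longest v))).
Proof.
move=> mute; have := transit_mute v (longest v) mute; have := transit_runs v (longest v).
by rewrite /transduce; case: transit => q o /= -> ->.
Qed.

End Runs.

Section Emissions.
Variable e : seq (option bool) -> option bool.

Definition emit (q : option bool) r : option bool * option bool := (q, e r).

Fixpoint emitted (v : seq str) n : str :=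
  if n is n'.+1 then seq_of_opt (e (reads v 0)) ++ emitted (map behead v) n' else [::].

Lemma emittedS v n : emitted v n.+1 = emitted v n ++ seq_of_opt (e (reads v n)).
Proof.
elim: n v => [v|n IH v]; first by rewrite /= cats0.
by rewrite -reads_behead [emitted v n.+1]/= -catA -IH.
Qed.

Lemma transduce_emit v : transduce emit (fun=> None) v = emitted v (longest v).
Proof.
rewrite /transduce; have : (transit emit v (longest v)).2 = emitted v (longest v).
  by elim: (longest v) => // n IH; rewrite emittedS -IH /=; case: transit.
by case: transit => q o /= ->; rewrite cats0.
Qed.

End Emissions.

Lemma longest1 s : longest [:: s] = size s.
Proof. by rewrite /longest big_seq1. Qed.

Lemma longest2 a b : longest [:: a; b] = maxn (size a) (size b).
Proof. by rewrite /longest big_cons big_seq1. Qed.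

Section Closure.
Variables (X : finType) (k : nat).
Implicit Types f g : seq str -> str.

(** A transducer without inputs makes no step, so its output is just what [fin] emits. *)
Lemma fp_opt (b : option bool) : fp X k (fun=> seq_of_opt b).
Proof.
have h := @fp_transduce (fun q _ => (q, None)) (fun=> b) X 0.
apply: fp_ext (fp_comp (Gs := [::]) h erefl I) _ => v _.
by rewrite transduce_mute.
Qed.

Lemma fp_const (s : str) : fp X k (fun=> s).
Proof.
elim: s => [|b s IH]; first exact: (fp_opt None).
exact: (fp_comp2 (@fp_cat X) (fp_opt (Some b)) IH).
Qed.

Lemma fp_append f g : fp X k f -> fp X k g -> fp X k (fun v => f v ++ g v).
Proof. exact: (fp_comp2 (@fp_cat X)). Qed.

Lemma fp_emit2 e f g : fp X k f -> fp X k g ->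
  fp X k (fun v => emitted e [:: f v; g v] (maxn (size (f v)) (size (g v)))).
Proof.
move=> hf hg.
apply: fp_ext (fp_comp2 (@fp_transduce (emit e) (fun=> None) X 2) hf hg) _ => v _.
by rewrite transduce_emit longest2.
Qed.

(** Lengths are passed as strings: the first argument only measures, and will be a path of [M] or a
    constant of length 2. *)
Lemma fp_take f g : fp X k f -> fp X k g -> fp X k (fun v => take (size (f v)) (g v)).
Proof.
move=> hf hg; pose e (r : seq (option bool)) := if r is [:: Some _; x] then x else None.
apply: fp_ext (fp_emit2 e hf hg) _ => v _; move: (f v) (g v) => {f g hf hg} a b.
have e1 n b' : emitted e [:: [::]; b'] n = [::] by elim: n b' => //= n IH [].
have e2 n a' : emitted e [:: a'; [::]] n = [::].
  by elim: n a' => //= n IH [|x a'] /=; rewrite IH.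
elim: a b => [|x a IH] [|y b]; rewrite ?e1 ?e2 ?take0 //=.
by rewrite maxnSS /= IH.
Qed.

Lemma fp_drop f g : fp X k f -> fp X k g -> fp X k (fun v => drop (size (f v)) (g v)).
Proof.
move=> hf hg; pose e (r : seq (option bool)) := if r is [:: None; x] then x else None.
apply: fp_ext (fp_emit2 e hf hg) _ => v _; move: (f v) (g v) => {f g hf hg} a b.
have e1 b' : emitted e [:: [::]; b'] (size b') = b' by elim: b' => //= y b' ->.
have e2 n a' : emitted e [:: a'; [::]] n = [::].
  by elim: n a' => //= n IH [|x a'] /=; rewrite IH.
elim: a b => [|x a IH] [|y b]; rewrite ?max0n ?e1 ?e2 ?drop0 //=.
by rewrite maxnSS /= IH.
Qed.

Lemma fp_nseq c f : fp X k f -> fp X k (fun v => nseq (size (f v)) c).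
Proof.
move=> hf; pose e (r : seq (option bool)) := if r is [:: Some _] then Some c else None.
apply: fp_ext (fp_comp1 (@fp_transduce (emit e) (fun=> None) X 1) hf) _ => v _.
by rewrite transduce_emit longest1; elim: (f v) => //= x s ->.
Qed.

(** * Polynomial-time predicates *)

Definition fpb (P : seq str -> bool) : Prop := fp X k (fun v => [:: P v]).
Implicit Types P Q : seq str -> bool.

(** Truth values are one-bit strings, so a transducer makes a single step, stores the value of [g]
    in its state and emits it at the end. The list is nonempty so that this step takes place. *)
Lemma fpb_map (g : seq bool -> bool) P Ps : every fpb (P :: Ps) ->
  fpb (fun v => g [seq Q v | Q <- P :: Ps]).
Proof.
move=> hPs; pose st (q : option bool) r : option bool * option bool :=
  (Some (g (map (odflt false) r)), None).
pose Gs := [seq (fun v => [:: Q v]) | Q <- P :: Ps].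
have hGs : every (fp X k) Gs by rewrite /Gs; elim: (P :: Ps) hPs => //= Q Qs IH [h /IH].
apply: fp_ext (fp_comp (@fp_transduce st id X (size Gs)) erefl hGs) _ => v _.
rewrite transduce_mute //; have -> : longest [seq G v | G <- Gs] = 1.
  rewrite /longest /Gs !big_map /= big_cons /=; apply/eqP; rewrite eqn_leq geq_max /=.
  by rewrite leq_maxl andbT; elim/big_ind: _ => // a b; rewrite geq_max => -> ->.
rewrite [runs _ _ _ _]/= /reads /Gs -!map_comp; congr [:: g _].
Qed.

Lemma fpb_and P Q : fpb P -> fpb Q -> fpb (fun v => P v && Q v).
Proof.
move=> hP hQ.
exact: (@fpb_map (fun bs => nth false bs 0 && nth false bs 1) P [:: Q] (conj hP (conj hQ I))).
Qed.

Lemma fpb_if P Q R : fpb P -> fpb Q -> fpb R -> fpb (fun v => if P v then Q v else R v).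
Proof.
move=> hP hQ hR.
exact: (@fpb_map (fun bs => if nth false bs 0 then nth false bs 1 else nth false bs 2)
  P [:: Q; R] (conj hP (conj hQ (conj hR I)))).
Qed.

Lemma runs_fail (st : option bool -> seq (option bool) -> option bool * option bool) v n :
  (forall r, (st (Some false) r).1 = Some false) -> runs st (Some false) v n = Some false.
Proof. by move=> h; elim: n v => //= n IH v; rewrite h. Qed.

(** [None] means equal so far. Different lengths are noticed as well, because the end of a string is
    read as [None]. *)
Definition eq_step (q : option bool) (r : seq (option bool)) : option bool * option bool :=
  (if r is [:: x; y] then if (q == None) && (x == y) then None else Some false else None,
   None).

Lemma runs_eq a b :
  (runs eq_step None [:: a; b] (maxn (size a) (size b)) == None) = (a == b).
Proof.
have fail v n : size v = 2 -> runs eq_step (Some false) v n = Some false.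
  by elim: n v => //= n IH [|x [|y []]] // _; rewrite IH.
elim: a b => [|x a IH] [|y b] //=; first by rewrite ?max0n /= fail.
  by rewrite fail.
rewrite maxnSS /= eqseq_cons; have [->|ne] := eqVneq x y; first by rewrite eqxx IH.
by rewrite ifF ?fail //; case: (x) (y) ne => [] [].
Qed.

Lemma fpb_eq f g : fp X k f -> fp X k g -> fpb (fun v => f v == g v).
Proof.
move=> hf hg.
apply: fp_ext (fp_comp2 (@fp_transduce eq_step (fun q => Some (q == None)) X 2) hf hg) _.
by move=> v _; rewrite transduce_mute // longest2 runs_eq.
Qed.

(* [None]: carrying; [Some true]: the rest must agree; [Some false]: failure. *)
Definition inc_step (q : option bool) (r : seq (option bool)) : option bool * option bool :=
  (match q, r with
   | None, [:: Some false; Some true] => Some true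
   | None, [:: Some true; Some false] => None
   | Some true, [:: x; y] => Some (x == y)
   | _, _ => Some false
   end, None).

Lemma runs_inc a b :
  (runs inc_step None [:: a; b] (maxn (size a) (size b)) == Some true) = inc a b.
Proof.
have fail v n : runs inc_step (Some false) v n = Some false by exact: runs_fail.
have eqm c d : (runs inc_step (Some true) [:: c; d] (maxn (size c) (size d)) == Some true)
    = (c == d).
  elim: c d => [|x c IH] [|y d] //=; first by rewrite ?max0n /= fail.
    by rewrite fail.
  rewrite maxnSS /= eqseq_cons; have [->|ne] := eqVneq x y; first by rewrite eqxx IH.
  by rewrite (_ : Some x == Some y = false) ?fail //; case: (x) (y) ne => [] [].
elim: a b => [|x a IH] [|y b] //=; first by rewrite ?max0n /= fail.
  by case: x; rewrite /= fail.
by rewrite maxnSS /=; case: x y => [] []; rewrite /= ?fail ?IH ?eqm.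
Qed.

Lemma fpb_inc f g : fp X k f -> fp X k g -> fpb (fun v => inc (f v) (g v)).
Proof.
move=> hf hg.
apply: fp_ext (fp_comp2 (@fp_transduce inc_step (fun q => Some (q == Some true)) X 2) hf hg) _.
by move=> v _; rewrite transduce_mute // longest2 runs_inc.
Qed.

End Closure.

(** * Polynomial lengths *)

Section Lengths.
Variable X : finType.

Definition unary (g : nat -> nat) : Prop :=
  exists2 U, fp X 1 U & forall x, size (U [:: x]) = g (size x).

Lemma unary_const c : unary (fun=> c).
Proof. by exists (fun=> nseq c false); [exact: fp_const|move=> x; rewrite size_nseq]. Qed.

Lemma unary_id : unary id.
Proof. by exists (fun v => nth [::] v 0); first exact: fp_nth. Qed.

Lemma unary_add g h : unary g -> unary h -> unary (fun n => g n + h n).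
Proof.
move=> [U hU sU] [V hV sV]; exists (fun v => U v ++ V v); first exact: fp_append.
by move=> x; rewrite size_cat sU sV.
Qed.

Lemma unary_mul g h : unary g -> unary h -> unary (fun n => g n * h n).
Proof.
move=> [U hU sU] [V hV sV].
exists (fun v => flatten (nseq (size (U v)) (V v))); first exact: (fp_comp2 (@fp_mul X)).
by move=> x; rewrite size_flatten /shape map_nseq sumn_nseq sU sV mulnC.
Qed.

Lemma unary_poly e : unary (poly e).
Proof.
rewrite /poly; apply: unary_mul; first exact: unary_const.
elim: e => [|e IH]; first exact: unary_const.
have -> : (fun n => n.+1 ^ e.+1) = (fun n => (1 + n) * n.+1 ^ e).
  by apply: funext => n; rewrite expnS.
exact: (unary_mul (unary_add (unary_const 1) unary_id) IH).
Qed.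

End Lengths.

Lemma is_polynomial_add q r : is_polynomial q -> is_polynomial r ->
  is_polynomial (fun n => q n + r n).
Proof.
move=> [P hP] [Q hQ]; exists (P + Q)%R => n.
by rewrite GRing.natrD hP hQ hornerD.
Qed.

Lemma is_polynomial_const c : is_polynomial (fun=> c).
Proof. by exists (c%:R%:P)%R => n; rewrite hornerC. Qed.

(** The coefficient is the sum of the absolute values of the coefficients, rounded up; the exponent
    is the number of coefficients. *)
Lemma is_polynomial_le q : is_polynomial q -> exists e, forall n, q n <= poly e n.
Proof.
move=> [P hP]; pose S := (\sum_(i < size P) `|P`_i|)%R.
have S0 : (0 <= S)%R by apply: Num.Theory.sumr_ge0 => i _; exact: Num.Theory.normr_ge0.
have [c cS] : exists c : nat, (S <= c%:R)%R.
  exists (Num.bound S); apply: Order.POrderTheory.ltW; exact: Num.Theory.archi_boundP.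
exists (c + size P) => n.
have : ((q n)%:R <= (c * n.+1 ^ size P)%:R :> rat)%R.
  rewrite hP horner_coef; apply: Order.POrderTheory.le_trans (Num.Theory.ler_norm _) _.
  apply: Order.POrderTheory.le_trans (Num.Theory.ler_norm_sum _ _ _) _.
  rewrite GRing.natrM; apply: Order.POrderTheory.le_trans
    (Num.Theory.ler_wpM2r (Num.Theory.ler0n _ _) cS).
  rewrite GRing.mulr_suml; apply: Num.Theory.ler_sum => i _.
  rewrite Num.Theory.normrM; apply: Num.Theory.ler_wpM2l; first exact: Num.Theory.normr_ge0.
  rewrite -GRing.natrX Num.Theory.normr_nat Num.Theory.ler_nat.
  apply: leq_trans (_ : n.+1 ^ i <= _); first by case: (val i) => // j; rewrite leq_exp2r.
  by apply: leq_pexp2l => //; apply: ltnW.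
rewrite Num.Theory.ler_nat => /leq_trans; apply.
by apply: leq_mul; [exact: leq_addr|apply: leq_pexp2l => //; exact: leq_addl].
Qed.

Lemma polytime_poly k (N : ntm k) : polytime N ->
  exists e, forall v : k.-tuple str, halts_within (poly e (\sum_(x <- v) size x)) (init N v).
Proof.
case=> q /is_polynomial_le[e qe] h; exists e => v.
exact: halts_le (qe _) (h v).
Qed.

(** * The new cluster machine *)

(** If the path is no longer than [o], no default zero was supplied, and the path is a prefix of
    [o]. *)
Lemma replay_take k (N : ntm k) n (c : config N) o :
  size (replay n c o).1 <= size o ->
  (replay n c o).1 = take (size (replay n c o).1) o.
Proof.
elim: n c o => [|n IH] c o /=; case e: (instr_at c) => [r|a|a0 a1] //=; rewrite ?take0 //.
  exact: IH.
case: o => [|b o] /=; first by case: replay.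
by have := IH (apply c (if b then a1 else a0)) o; case: replay => w c' /= h /h <-.
Qed.

Lemma noflip_path k (M : ntm k) (c : config M) w r d :
  deterministic M -> computation c w r d -> w = [::].
Proof.
move=> dM; elim=> {c w r d} // c a0 a1 g w r d e.
by have := dM c.1 [ffun t => read_tape (c.2 t)]; rewrite -/(instr_at c) e.
Qed.

Section Construction.
Variables (p : nat -> nat) (M Nl Nu : ntm 1) (P : ntm 3).
Variables (eM el eu eP : nat).
Hypothesis M_halts : forall v : 1.-tuple str,
  halts_within (poly eM (\sum_(x <- v) size x)) (init M v).
Hypothesis Nl_halts : forall v : 1.-tuple str,
  halts_within (poly el (\sum_(x <- v) size x)) (init Nl v).
Hypothesis Nu_halts : forall v : 1.-tuple str,
  halts_within (poly eu (\sum_(x <- v) size x)) (init Nu v).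
Hypothesis P_halts : forall v : 3.-tuple str,
  halts_within (poly eP (\sum_(x <- v) size x)) (init P v).

Let X : finType := ((aux M + state M) + ((aux Nl + state Nl) +
  ((aux Nu + state Nu) + (aux P + state P))))%type.

Let getM (x : X) := if x is inl a then Some a else None.
Let getl (x : X) := if x is inr (inl a) then Some a else None.
Let getu (x : X) := if x is inr (inr (inl a)) then Some a else None.
Let getP (x : X) := if x is inr (inr (inr a)) then Some a else None.

Let getMK : pcancel (fun a => inl a : X) getM. Proof. by []. Qed.
Let getlK : pcancel (fun a => inr (inl a) : X) getl. Proof. by []. Qed.
Let getuK : pcancel (fun a => inr (inr (inl a)) : X) getu. Proof. by []. Qed.
Let getPK : pcancel (fun a => inr (inr (inr a)) : X) getP. Proof. by []. Qed.

Definition word (x s : str) : str := (result M eM [:: x; s]).1.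
Definition accM (x s : str) : bool := verdict (result M eM [:: x; s]).2.

(* A certificate [z] consists of an accepting path of [Nl], one of [Nu], and zeros. *)
Definition pathl (x z : str) : str := (result Nl el [:: x; z]).1.
Definition accl (x z : str) : bool := verdict (result Nl el [:: x; z]).2.
Definition least (x z : str) : str := output (result Nl el [:: x; z]).2.
Definition rest (x z : str) : str := drop (size (pathl x z)) z.
Definition pathu (x z : str) : str := (result Nu eu [:: x; rest x z]).1.
Definition accu (x z : str) : bool := verdict (result Nu eu [:: x; rest x z]).2.
Definition greatest (x z : str) : str := output (result Nu eu [:: x; rest x z]).2.
Definition padding (x z : str) : str := drop (size (pathu x z)) (rest x z).
Definition certificate (x z : str) : bool :=
  accl x z && (accu x z && (padding x z == nseq (size (padding x z)) false)).

Definition adjacent (x y z : str) : bool :=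
  verdict (result P eP [:: x; y; z; [::]]).2.

(* [p |x|] is obtained here by measuring a path of [M]. *)
Definition new_cluster (x r : str) : bool :=
  cluster (size (word x (drop 2 r))) (fun=> accM x (drop 2 r)) (certificate x) r.

(** The acceptance predicate is constant: [accM] is given all of [drop 2 r], and [M] by itself stops
    reading after the first [p |x|] bits. *)
Definition new_edge (x r r' : str) : bool :=
  edge (size (word x (drop 2 r))) (fun=> accM x (drop 2 r)) (certificate x)
    (least x) (greatest x) (adjacent x) r r'.

Section Programs.
Variables (k : nat) (x s y z : seq str -> str).
Hypotheses (hx : fp X k x) (hs : fp X k s) (hy : fp X k y) (hz : fp X k z).

Lemma fp_word : fp X k (fun v => word (x v) (s v)).
Proof. exact: fp_comp2 (fp_consumed M_halts getMK) hx hs. Qed.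

Lemma fpb_accM : fpb X k (fun v => accM (x v) (s v)).
Proof. exact: fp_comp2 (fp_verdict M_halts getMK) hx hs. Qed.

Lemma fp_least : fp X k (fun v => least (x v) (s v)).
Proof. exact: fp_comp2 (fp_output Nl_halts getlK) hx hs. Qed.

Lemma fp_rest : fp X k (fun v => rest (x v) (s v)).
Proof. by apply: fp_drop hs; exact: fp_comp2 (fp_consumed Nl_halts getlK) hx hs. Qed.

Lemma fp_greatest : fp X k (fun v => greatest (x v) (s v)).
Proof. exact: fp_comp2 (fp_output Nu_halts getuK) hx fp_rest. Qed.

Lemma fpb_certificate : fpb X k (fun v => certificate (x v) (s v)).
Proof.
have hp : fp X k (fun v => padding (x v) (s v)).
  by apply: fp_drop fp_rest; exact: fp_comp2 (fp_consumed Nu_halts getuK) hx fp_rest.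
apply: fpb_and; first exact: fp_comp2 (fp_verdict Nl_halts getlK) hx hs.
apply: fpb_and; first exact: fp_comp2 (fp_verdict Nu_halts getuK) hx fp_rest.
exact: fpb_eq hp (fp_nseq _ hp).
Qed.

Lemma fpb_adjacent : fpb X k (fun v => adjacent (x v) (y v) (z v)).
Proof.
apply: (fp_comp (Gs := [:: x; y; z; fun=> [::]]) (fp_verdict P_halts getPK)) => //=.
by do !split=> //; exact: fp_const.
Qed.

End Programs.

Section EdgePrograms.
Variables (k : nat) (x r r' : seq str -> str).
Hypotheses (hx : fp X k x) (hr : fp X k r) (hr' : fp X k r').

Let fp_tail f : fp X k f -> fp X k (fun v => drop 2 (f v)).
Proof. by move=> hf; exact: (fp_drop (@fp_const X k [:: false; false]) hf). Qed.

Let fpb_head f a b : fp X k f -> fpb X k (fun v => take 2 (f v) == [:: a; b]).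
Proof.
move=> hf; apply: fpb_eq; last exact: fp_const.
exact: (fp_take (@fp_const X k [:: false; false]) hf).
Qed.

Let fpb_inside : fpb X k (fun v => accM (x v) (drop 2 (r v)) &&
  certificate (x v) (drop (size (word (x v) (drop 2 (r v)))) (drop 2 (r v)))).
Proof.
apply: fpb_and; first exact: fpb_accM hx (fp_tail hr).
apply: fpb_certificate => //; apply: fp_drop; last exact: fp_tail.
exact: fp_word hx (fp_tail hr).
Qed.

Lemma fpb_cluster : fpb X k (fun v => new_cluster (x v) (r v)).
Proof. by apply: fpb_and fpb_inside; exact: fpb_head. Qed.

Lemma fpb_edge : fpb X k (fun v => new_edge (x v) (r v) (r' v)).
Proof.
have hs := fp_tail hr; have hs' := fp_tail hr'; have hw := fp_word hx hs.
have hy := fp_take hw hs; have hy' := fp_take hw hs'.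
have hz := fp_drop hw hs; have hz' := fp_drop hw hs'.
have hc a b := fpb_head a b hr; have hc' a b := fpb_head a b hr'.
have ss := fpb_eq hs hs'.
apply: fpb_if (hc _ _) (fpb_and ss (fpb_if fpb_inside (hc' _ _) (hc' _ _))) _.
apply: fpb_if (hc _ _) (fpb_if fpb_inside (fpb_and (fpb_eq hz hz') _) (fpb_and ss (hc' _ _))) _.
  apply: fpb_if (fpb_eq hy (fp_greatest hx hz)) _ _.
    exact: fpb_and (hc' _ _) (fpb_eq hy' (fp_least hx hz)).
  exact: fpb_and (hc' _ _) (fpb_adjacent hx hy hy').
apply: fpb_if (hc _ _) (fpb_and ss _) (fpb_and (hc' _ _) (fpb_inc hs hs')).
exact: fpb_if (fpb_and fpb_inside (fpb_eq hy (fp_least hx hz))) (hc' _ _) (hc' _ _).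
Qed.

End EdgePrograms.

(** The running times of [Nl] and [Nu] bound the lengths of their paths. *)
Definition width (n : nat) : nat := poly el n + poly eu n.
Definition new_length (n : nat) : nat := (p n + width n).+2.

Hypothesis M_balanced : forall x w, path_name M [tuple x] w <-> size w = p (size x).

Lemma path_word x s : size (word x s) = p (size x).
Proof.
apply/M_balanced; exists (accM x s), (result M eM [:: x; s]).2.
exact: (resultP M_halts [tuple x] s).
Qed.

Lemma accME x y z : size y = p (size x) ->
  accM x (y ++ z) = `[< accepts M [tuple x] y >].
Proof.
move=> /M_balanced[r [c hc]]; have [e v] := result_eq M_halts z hc.
rewrite /accM; move: e v; rewrite /= => -> /= ->; apply/idP/asboolP => [hr|[c' hc']].
  by rewrite hr in hc; exists c.
by have [] := computation_uniq hc hc'.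
Qed.

(** The polynomial [p] is never evaluated: the path of [M] with all choices zero has length
    [p |x|]. *)
Lemma length_new : exists2 U, fp X 1 U & forall x, size (U [:: x]) = new_length (size x).
Proof.
have [W hW sW] := unary_add (unary_poly X el) (unary_poly X eu).
exists (fun v => [:: false; false] ++ (word (nth [::] v 0) [::] ++ W v)).
  apply: fp_append (fp_append _ hW); first exact: fp_const.
  by apply: fp_word; [exact: fp_nth|exact: fp_const].
by move=> x; rewrite /= size_cat path_word sW.
Qed.

Variables (prec : str -> str -> str -> bool) (gl gu : str -> option str).
Hypothesis P_det : deterministic P.
Hypothesis precP : forall x y z, prec x y z <-> exists w, accepts P [tuple x; y; z] w.

Lemma adjacentE x y z : adjacent x y z = prec x y z.
Proof.
have hc := resultP P_halts [tuple x; y; z] [::]; rewrite /= in hc.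
have w0 := noflip_path P_det hc; rewrite w0 in hc.
apply/idP/idP => [hv|/precP[w [c hc']]].
  by apply/precP; exists [::], (result P eP [:: x; y; z; [::]]).2; rewrite -hv.
have w0' := noflip_path P_det hc'; rewrite w0' in hc'.
by have [] := computation_uniq hc hc'.
Qed.

Hypothesis Nl_uniq : forall x w w', accepts Nl [tuple x] w -> accepts Nl [tuple x] w' -> w = w'.
Hypothesis Nu_uniq : forall x w w', accepts Nu [tuple x] w -> accepts Nu [tuple x] w' -> w = w'.
Hypothesis Nl_out : forall x y, gl x = Some y <->
  exists w c, computation (init Nl [tuple x]) w true c /\ output c = y.
Hypothesis Nu_out : forall x y, gu x = Some y <->
  exists w c, computation (init Nu [tuple x]) w true c /\ output c = y.

Section Word.
Variables (x l u : str).
Hypotheses (xl : gl x = Some l) (xu : gu x = Some u).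

(** By unambiguity an accepting replay can only follow [wl], then [wu]; as [z] is long enough for
    both, they really occur in it as prefixes, and the remainder is prescribed to be zero. *)
Lemma certificateP : exists z0, [/\ size z0 = width (size x), certificate x z0 &
  forall z, size z = width (size x) -> certificate x z ->
    [/\ z = z0, least x z = l & greatest x z = u]].
Proof.
have tx : \sum_(y <- [tuple x]) size y = size x by rewrite big_cons big_nil addn0.
have [wl [cl [hl ol]]] := (Nl_out x l).1 xl; have [wu [cu [hu ou]]] := (Nu_out x u).1 xu.
have sl : size wl <= poly el (size x) by rewrite -tx; exact: size_computation hl (Nl_halts _).
have su : size wu <= poly eu (size x) by rewrite -tx; exact: size_computation hu (Nu_halts _).
pose pad := nseq (width (size x) - size wl - size wu) false.
have rl z : result Nl el [:: x; wl ++ z] = (wl, cl) /\ verdict cl.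
  by have [-> ->] := result_eq Nl_halts z hl.
have ru z : result Nu eu [:: x; wu ++ z] = (wu, cu) /\ verdict cu.
  by have [-> ->] := result_eq Nu_halts z hu.
have restE z : rest x (wl ++ z) = z by rewrite /rest /pathl (rl z).1 drop_size_cat.
exists (wl ++ wu ++ pad); split.
- by rewrite !size_cat size_nseq /width; lia.
- rewrite /certificate /accl (rl _).1 (rl [::]).2 /accu /padding /pathu !restE (ru _).1.
  by rewrite (ru [::]).2 drop_size_cat // size_nseq eqxx.
move=> z sz /andP[al /andP[au /eqP pz]].
have hl' := resultP Nl_halts [tuple x] z; rewrite /= -/(accl x z) al in hl'.
have wlE : pathl x z = wl.
  by apply: (@Nl_uniq x); [exists (result Nl el [:: x; z]).2|exists cl].
have zE : z = wl ++ rest x z.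
  rewrite -{1}(cat_take_drop (size wl) z) /rest wlE; congr (_ ++ _).
  rewrite -{2}wlE [RHS]replay_take /= -/(pathl x z) ?wlE //.
  by rewrite sz; apply: leq_trans sl (leq_addr _ _).
have hu' := resultP Nu_halts [tuple x] (rest x z); rewrite /= -/(accu x z) au in hu'.
have wuE : pathu x z = wu.
  by apply: (@Nu_uniq x); [exists (result Nu eu [:: x; rest x z]).2|exists cu].
have srest : size (rest x z) = width (size x) - size wl by rewrite /rest wlE size_drop sz.
have restzE : rest x z = wu ++ padding x z.
  rewrite -{1}(cat_take_drop (size wu) (rest x z)) /padding wuE; congr (_ ++ _).
  rewrite -{2}wuE [RHS]replay_take /= -/(pathu x z) ?wuE //.
  by rewrite srest /width; lia.
have spad : size (padding x z) = width (size x) - size wl - size wu.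
  by rewrite /padding wuE size_drop srest.
split.
- by rewrite zE restzE pz spad.
- apply: Some_inj; rewrite -xl; apply/esym/Nl_out.
  by exists (pathl x z), (result Nl el [:: x; z]).2.
- apply: Some_inj; rewrite -xu; apply/esym/Nu_out.
  by exists (pathu x z), (result Nu eu [:: x; rest x z]).2.
Qed.

End Word.

Variable f : str -> nat.
Hypothesis p_poly : is_polynomial p.
Hypothesis f_card : forall x, f x = #|acc p M x|.
Hypothesis f_cluster : forall x, f x <> 0 -> exists l u idx,
  [/\ indexed (fun y z => prec x y z) (acc p M x) l u idx,
      gl x = Some (val l) & gu x = Some (val u)].

Definition accepting (x y : str) : bool := `[< accepts M [tuple x] y >].

Lemma accM_take x (s : str) : p (size x) <= size s ->
  accM x s = accepting x (take (p (size x)) s).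
Proof. by move=> le; rewrite -{1}(cat_take_drop (p (size x)) s) accME // size_takel. Qed.

Lemma new_clusterE x (r : str) : size r = new_length (size x) ->
  new_cluster x r = cluster (p (size x)) (accepting x) (certificate x) r.
Proof.
move=> sr; rewrite /new_cluster /cluster /inside path_word accM_take //.
by rewrite size_drop sr /new_length; lia.
Qed.

Lemma new_edgeE x (r r' : str) : size r = new_length (size x) ->
  new_edge x r r' = edge (p (size x)) (accepting x) (certificate x)
    (least x) (greatest x) (prec x) r r'.
Proof.
move=> sr; rewrite /new_edge /edge /inside path_word accM_take ?adjacentE //.
by rewrite size_drop sr /new_length; lia.
Qed.

Lemma accepting_acc x (y : (p (size x)).-tuple bool) : accepting x y = (y \in acc p M x).
Proof. by rewrite inE. Qed.

Lemma new_order x (D : {set (new_length (size x)).-tuple bool}) :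
  (forall r, (r \in D) = new_cluster x r) ->
  exists h : {perm (new_length (size x)).-tuple bool},
  [/\ h zeros = zeros, h ones = ones,
      forall a b : (new_length (size x)).-tuple bool, new_edge x a b <-> lexsucc (h a) (h b),
      f x <> 0 -> contiguous h D & f x = #|D|].
Proof.
move=> DE; set n := p (size x); set T := width (size x).
have DE' r : (r \in D) = cluster n (accepting x) (certificate x) r.
  by rewrite DE new_clusterE ?size_tuple.
have eE (a b : (new_length (size x)).-tuple bool) : new_edge x a b = edge n (accepting x)
    (certificate x) (least x) (greatest x) (prec x) a b.
  by rewrite new_edgeE ?size_tuple.
have tupleE (y : str) : size y = n -> exists t : n.-tuple bool, val t = y.
  by move=> /eqP sy; exists (Tuple sy).
have [f0|f0] := eqVneq (f x) 0.
  have A0 (y : str) : size y = n -> accepting x y = false.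
    move=> /tupleE[t <-]; rewrite accepting_acc; apply/negbTE/negP => tA.
    by move: f0; rewrite f_card => /eqP; rewrite cards_eq0 => /eqP e; rewrite e inE in tA.
  have D0 : D = set0.
    apply/setP => r; rewrite inE DE' /cluster /inside A0 ?andbF //.
    by rewrite size_takel // size_drop size_tuple /new_length; lia.
  (* No path accepts, so the conditions on accepting words are vacuous, and dummy strings of the
     right lengths serve as certificate and ends. *)
  have [|||||||||h [h1 h2 h3 h4]] := @edge_perm n (accepting x) (certificate x) (least x)
      (greatest x) (prec x) T (nseq T false) (nseq n false) (nseq n false) (fun=> 0);
      rewrite ?size_nseq //.
  - by move=> y z sy _; rewrite A0.
  - by move=> y y' sy; rewrite A0.
  - by move=> y y' sy sy'; rewrite A0.
  - by move=> y sy; rewrite A0.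
  exists h; split=> //; first by move=> a b; rewrite eE.
  by rewrite f0 D0 cards0.
have [l [u [idx [ix xl xu]]]] := f_cluster (elimN eqP f0).
have [z0 [sz0 gz0 uz0]] := certificateP xl xu.
(* [idx] lives on tuples but [edge_perm] works with strings; strings of other lengths get the
   default [l]. *)
pose tup (y : str) : n.-tuple bool := insubd l y.
have tupK (y : str) : size y = n -> val (tup y) = y.
  by move=> sy; rewrite val_insubd sy eqxx.
have tupA (y : str) : size y = n -> (tup y \in acc p M x) = accepting x y.
  by move=> sy; rewrite -accepting_acc /= tupK.
have tup_l : tup l = l by apply: val_inj; rewrite tupK ?size_tuple.
have tup_u : tup u = u by apply: val_inj; rewrite tupK ?size_tuple.
have tup_inj (y y' : str) : size y = n -> size y' = n -> tup y = tup y' -> y = y'.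
  by move=> sy sy' e; rewrite -(tupK y) // -(tupK y') // e.
have [|||||||||h [h1 h2 h3 h4]] := @edge_perm n (accepting x) (certificate x) (least x)
    (greatest x) (prec x) T z0 l u (fun y => idx (tup y)); rewrite ?size_tuple //.
- move=> y z sy sz Ay gz; have [-> -> ->] := uz0 z sz gz.
  by rewrite !accepting_acc; split=> //; case: ix.
- by rewrite tup_l; case: ix.
- by move=> y sy Ay; rewrite tup_u; apply: (idx_le ix); rewrite tupA.
- move=> y y' sy sy' Ay Ay' e; apply: tup_inj => //.
  by apply: (idx_inj ix); rewrite ?tupA.
- move=> y y' sy sy' Ay yu; rewrite -tupA // -(idx_succ ix) ?tupA ?tupK //.
  by apply: contraNneq yu => e; rewrite -(tupK y) // e.
- move=> y sy Ay yu; have [||y' y'A e] := @idx_next _ _ _ _ _ _ ix (tup y).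
  + by rewrite tupA.
  + by apply: contraNneq yu => e; rewrite -(tupK y) // e.
  exists y'; split; rewrite ?size_tuple ?accepting_acc //.
  by rewrite -e; congr idx; apply: val_inj; rewrite tupK ?size_tuple.
(* Adding the control bits and the only correct certificate maps the accepting paths of [M]
   bijectively onto the new cluster, so the count is preserved. *)
have sg (y : n.-tuple bool) : size [:: false, true & y ++ z0] == new_length (size x).
  by rewrite /= size_cat size_tuple sz0.
pose g y : (new_length (size x)).-tuple bool := Tuple (sg y).
have gi : injective g.
  move=> y y' /(congr1 val) /= [] /eqP; rewrite eqseq_cat ?size_tuple // => /andP[/eqP e _].
  exact: val_inj.
have Dg : D = g @: acc p M x.
  apply/setP => r; rewrite DE'; apply/idP/imsetP => [|[y yA ->]]; last first.
    rewrite /cluster /= take0 drop0 /inside take_size_cat ?size_tuple //.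
    by rewrite drop_size_cat ?size_tuple // accepting_acc yA.
  have [c1 [c2 [y [z [rE sy sz]]]]] := @word_split n T r (size_tuple r).
  rewrite rE /cluster /= !take0 !drop0 insideE // eq_pair.
  case/andP=> /andP[/eqP c10 /eqP c2t] /andP[Ay gz]; exists (tup y); first by rewrite tupA.
  apply: val_inj; rewrite /= tupK // rE c10 c2t.
  by have [-> _ _] := uz0 z sz gz.
have cD : f x = #|D| by rewrite Dg card_imset // -f_card.
exists h; split=> //; first by move=> a b; rewrite eE.
move=> _; apply: h4 => //; apply/eqP => D0.
by move: f0; rewrite cD D0 cards0 eqxx.
Qed.

Lemma construction : CLUP f.
Proof.
have [U hU sU] := length_new.
have hx : fp X 2 (fun v => nth [::] v 0) by exact: fp_nth.
have hr : fp X 2 (fun v => nth [::] v 1) by exact: fp_nth.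
have hx3 : fp X 3 (fun v => nth [::] v 0) by exact: fp_nth.
have hr3 : fp X 3 (fun v => nth [::] v 1) by exact: fp_nth.
have hr3' : fp X 3 (fun v => nth [::] v 2) by exact: fp_nth.
have [M' bM' aM'] := fp_balanced hU (fpb_cluster hx hr) sU.
exists new_length, M', (fun x => nseq (size (U [:: x])) false),
  (fun x => nseq (size (U [:: x])) true), (fun x a b => head false [:: new_edge x a b]).
split=> //.
- have := is_polynomial_add (is_polynomial_add p_poly (is_polynomial_add
    (is_polynomial_poly el) (is_polynomial_poly eu))) (is_polynomial_const 2).
  by congr is_polynomial; apply: funext => n; rewrite addn2.
- by split; apply: (fp_FPt (F := fun v => nseq (size (U v)) _)); exact: fp_nseq _ hU.
- exact: fp_pred3 (fpb_edge hx3 hr3 hr3').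
move=> x; have [|h [h1 h2 h3 h4 h5]] := @new_order x (acc new_length M' x).
  move=> r; rewrite inE; apply/asboolP/idP; rewrite aM' ?size_tuple //.
exists h; split=> //.
- by rewrite !size_nseq sU.
- by split; [exists zeros|exists ones]; rewrite //= sU.
Qed.

End Construction.

(** * The free and the circular model *)

Lemma cluster_closure f p M prec gl gu :
  is_polynomial p -> balanced p M -> polytime_pred3 prec -> UPSVp gl -> UPSVp gu ->
  (forall x, f x = #|acc p M x|) ->
  (forall x, f x <> 0 -> exists l u idx,
    [/\ indexed (fun y z => prec x y z) (acc p M x) l u idx,
        gl x = Some (val l) & gu x = Some (val u)]) ->
  CLUP f.
Proof.
move=> p_poly [/polytime_poly[eM hM] bM] [P [dP /polytime_poly[eP hP] pP]].
move=> [Nl [/polytime_poly[el hl] ul ol]] [Nu [/polytime_poly[eu hu] uu ou]] fc fcl.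
exact: (construction hM hl hu hP bM dP pP ul uu ol ou p_poly fc fcl).
Qed.

Lemma contiguous_rk n (h : {perm n.-tuple bool}) A : contiguous h A ->
  exists l u, forall y, (y \in A) = (rk (h l) <= rk (h y) <= rk (h u)).
Proof. by case=> l [u ->]; exists l, u => y; rewrite inE !rk_le. Qed.

Theorem free_closure f p M prec : computed_free f p M prec ->
  UPSVp (greatest_free p M prec) -> UPSVp (least_free p M prec) -> CLUP f.
Proof.
move=> [p_poly bM hprec hx] hg hl; apply: (cluster_closure p_poly bM hprec hl hg) => x.
  by have [h []] := hx x.
have [h [hR hc hf]] := hx x => f0; have [l [u AE]] := contiguous_rk (hc f0).
have A0 : acc p M x != set0 by rewrite -cards_eq0 -hf; apply/eqP.
have RE (y y' : (p (size x)).-tuple bool) : prec x y y' = (rk (h y') == (rk (h y)).+1).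
  by rewrite -lexsuccE; apply/idP/idP; move/hR.
exists l, u, (fun y => rk (h y) - rk (h l)); split.
- exact: interval_indexed.
- by rewrite /least_free (interval_least (R := fun y z => prec x y z) AE).
- by rewrite /greatest_free (interval_greatest (R := fun y z => prec x y z) AE).
Qed.

Theorem circular_closure f p M prec : computed_circular f p M prec ->
  UPSVp (greatest_circular p M prec) -> UPSVp (least_circular p M prec) -> CLUP f.
Proof.
move=> [p_poly bM hprec hx] hg hl; apply: (cluster_closure p_poly bM hprec hl hg) => x.
  by have [h []] := hx x.
have [h [hR hc hf]] := hx x => f0; have [l [u AE]] := contiguous_rk (hc f0).
have A0 : acc p M x != set0 by rewrite -cards_eq0 -hf; apply/eqP.
have RE (y y' : (p (size x)).-tuple bool) : prec x y y' = circsucc (h y) (h y').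
  by apply/idP/idP; move/hR.
have cT : #|[set: (p (size x)).-tuple bool]| = 2 ^ p (size x).
  by rewrite cardsT card_tuple card_bool.
rewrite /least_circular /greatest_circular; case: eqP => full; last first.
  (* A cluster that is not full misses the first or the last rank, so the wrap-around never joins
     two of its elements. *)
  have lu0 : 0 < rk (h l) \/ (rk (h u)).+1 < 2 ^ p (size x).
    apply: contra_notP full; rewrite not_orP => -[/negP l0 /negP u1].
    rewrite -cT; congr #|pred_of_set _|; apply/setP => y; rewrite AE inE.
    by have := rk_bound (h y); lia.
  have RS y y' : y \in acc p M x -> y' \in acc p M x ->
      prec x y y' = (rk (h y') == (rk (h y)).+1).
    rewrite !AE RE circsuccE; have := rk_bound (h y); have := rk_bound (h y').
    by case: ifP; lia.
  exists l, u, (fun y => rk (h y) - rk (h l)); split.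
  - apply: interval_indexed => // y y'; rewrite AE RE circsuccE.
    have := rk_bound (h y); have := rk_bound (h u); rewrite -(inj_eq (@perm_inj _ h)).
    rewrite -(inj_eq (@rk_inj _)); case: ifP; lia.
  - by rewrite /least_free (interval_least (R := fun y z => prec x y z) AE).
  - by rewrite /greatest_free (interval_greatest (R := fun y z => prec x y z) AE).
have AT : acc p M x = setT.
  by apply/eqP; rewrite eqEcard subsetT cT full leqnn.
(* For the full cluster the greatest element is by convention the string [1...1], wherever [h] puts
   it; the cycle is cut there, and [l'] is its circular successor. *)
have [l' el'] : exists l', rk (h l') =
    if (rk (h ones)).+1 < 2 ^ p (size x) then (rk (h ones)).+1 else 0.
  have [|a ea] := @rk_onto (p (size x))
    (if (rk (h ones)).+1 < 2 ^ p (size x) then (rk (h ones)).+1 else 0).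
    by case: ifP => // _; rewrite expn_gt0.
  by exists ((h^-1)%g a); rewrite permKV.
have Rl : prec x (@ones (p (size x))) l' by rewrite RE circsuccE el'.
have [idx ix] := full_indexed AT RE Rl.
exists l', ones, idx; split=> //.
(* For paths of length 0 the only word is empty, so the conventional value agrees with [l']. *)
case: eqP => [p0|_].
  by congr Some; apply/esym/size0nil; rewrite size_tuple.
rewrite (the_eq (z := l')) // => w; rewrite -[nseq _ true]/(tval ones) RE circsuccE -el'.
by move=> /eqP/rk_inj/perm_inj.
Qed.

Theorem theorem3p3 :
  (forall (f : str -> nat) (p : nat -> nat) (M : ntm 1)
          (prec : str -> str -> str -> bool),
     computed_free f p M prec ->
     UPSVp (greatest_free p M prec) ->
     UPSVp (least_free p M prec) ->
     CLUP f) /\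
  (forall (f : str -> nat) (p : nat -> nat) (M : ntm 1)
          (prec : str -> str -> str -> bool),
     computed_circular f p M prec ->
     UPSVp (greatest_circular p M prec) ->
     UPSVp (least_circular p M prec) ->
     CLUP f).
Proof.
by split=> f p M prec; [exact: free_closure|exact: circular_closure].
Qed.
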